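(* Let $H$ be a Hilbert space, $\mathcal{M}$ and $\mathcal{N}$ be von Neumann algebras acting on $H$, $\chi\in\mathcal{M}\otimes_{\sigma\mathrm{h}}\mathcal{M}$, and let $W\in\mathcal{B}(H)\bar\otimes\mathcal{N}$ and $V\in\mathcal{N}\bar\otimes\mathcal{B}(H)$ be unitary operators. The following are equivalent: (i) $\Phi_\chi(\mathcal{A}(W,V))\subseteq\mathcal{N}$; (ii) $\mathcal{T}\circ(\Gamma_W\otimes\Gamma'_V)(\chi)\in\mathcal{B}(H)\bar\otimes\mathcal{N}\bar\otimes\mathcal{B}(H)$.
   Context: $\bar\otimes$ denotes the weak* spatial (von Neumann algebra) tensor product. For dual operator spaces $\mathcal{X},\mathcal{Y}$, the normal Haagerup tensor product $\mathcal{X}\otimes_{\sigma\mathrm{h}}\mathcal{Y}$ is the operator space dual of the operator space of all separately weak* continuous (normal) completely bounded bilinear forms on $\mathcal{X}\times\mathcal{Y}$; the elementary tensor $a\otimes b$ is the functional $F\mapsto F(a,b)$. If $\phi:\mathcal{X}\to\mathcal{X}_1$ and $\psi:\mathcal{Y}\to\mathcal{Y}_1$ are normal completely bounded maps between dual operator spaces, $\phi\otimes\psi:\mathcal{X}\otimes_{\sigma\mathrm{h}}\mathcal{Y}\to\mathcal{X}_1\otimes_{\sigma\mathrm{h}}\mathcal{Y}_1$ denotes the unique normal completely bounded map with $(\phi\otimes\psi)(a\otimes b)=\phi(a)\otimes\psi(b)$. For $\chi\in\mathcal{M}\otimes_{\sigma\mathrm{h}}\mathcal{M}$, $\Phi_\chi:\mathcal{B}(H)\to\mathcal{B}(H)$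 is the completely bounded $\mathcal{M}'$-bimodule map given by $\langle\Phi_\chi(x)\xi,\eta\rangle=\langle\chi,F_{x,\xi,\eta}\rangle$, where $F_{x,\xi,\eta}(a,b)=\langle axb\xi,\eta\rangle$ for $a,b\in\mathcal{M}$, $x\in\mathcal{B}(H)$, $\xi,\eta\in H$; in particular $\Phi_{a\otimes b}(x)=axb$. For a von Neumann algebra $\mathcal{R}$ and $f,g\in\mathcal{R}_*$, let $L_f=f\otimes\mathrm{id}$ and $R_g=\mathrm{id}\otimes g$ be the normal slice maps $\mathcal{R}\bar\otimes\mathcal{R}\to\mathcal{R}$, and let $\mathrm{m}:\mathcal{R}\otimes_{\sigma\mathrm{h}}\mathcal{R}\to\mathcal{R}$ be the unique weak* continuous completely contractive extension of operator multiplication. $\mathcal{T}:(\mathcal{R}\bar\otimes\mathcal{R})\otimes_{\sigma\mathrm{h}}(\mathcal{R}\bar\otimes\mathcal{R})\to\mathcal{R}\bar\otimes\mathcal{R}\bar\otimes\mathcal{R}$ is the weak* continuous linear contraction determined by $\langle\mathcal{T}(\psi),f\otimes\omega\otimes g\rangle=\langle\mathrm{m}((L_f\otimes R_g)(\psi)),\omega\rangle$ for $f,\omega,g\in\mathcal{R}_*$; it satisfies $\mathcal{T}(\chi_1\otimes\chi_2)=(\chi_1\otimes1)(1\otimes\chi_2)$. Here it is used with $\mathcal{R}=\mathcal{B}(H)$. The maps $\Gamma_W,\Gamma'_V:\mathcal{M}\to\mathcal{B}(H\otimes H)=\mathcal{B}(H)\bar\otimes\mathcal{B}(H)$ are the normal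 completely bounded maps $\Gamma_W(a)=W^*(1\otimes a)W$ and $\Gamma'_V(b)=V(b\otimes1)V^*$. The reduced operator space of the pair $(W,V)$ is the norm closed linear span $\mathcal{A}(W,V)=\overline{\mathrm{span}}^{\|\cdot\|}\{L_f(W)R_g(V): f,g\in\mathcal{B}(H)_*\}$, where $L_f(W)=(f\otimes\mathrm{id})(W)$ and $R_g(V)=(\mathrm{id}\otimes g)(V)$; it is a norm closed subspace of $\mathcal{N}$. *)

(* Defs.v *)
From HB Require Import structures.
From mathcomp Require Import all_boot all_order all_algebra.
From mathcomp Require Import sesquilinear complex.
From mathcomp Require Import all_classical all_reals.
From mathcomp Require Import topology normedtype sequences.

Set Implicit Arguments.
Unset Strict Implicit.
Unset Printing Implicit Defensive.
Import Order.TTheory GRing.Theory Num.Theory.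
Import numFieldTopology.Exports numFieldNormedType.Exports.

Local Open Scope classical_set_scope.
Local Open Scope ring_scope.

(* The complex numbers, as a constant of type numClosedFieldType: the norm and
   topology instances are keyed on that structure and are not found on R[i]. *)
Definition cplx (R : realType) : numClosedFieldType := R[i].

(* The inner product is linear in its first argument. *)
HB.mixin Record isHilbert (R : realType) H of CompleteNormedModule (cplx R) H := {
  inner : {dot H for @Num.conj (cplx R)};
  normr_inner : forall x : H, `|x| ^+ 2 = inner x x
}.

#[short(type="hilbertType")]
HB.structure Definition Hilbert (R : realType) :=
  {H of isHilbert R H & CompleteNormedModule (cplx R) H}.

Notation "''[' x , y ]" := (inner x y) (format "''[' x ,  y ]") : ring_scope.

(* The finite linear combinations of elements of A. *)
Definition lspan (C : numClosedFieldType) (V : lmodType C) (A : set V) : set V :=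
  [set x | exists n (c : 'I_n -> C) (a : 'I_n -> V),
    (forall i, A (a i)) /\ x = \sum_(i < n) c i *: a i].

Section bounded_operators.
Variables (R : realType) (H K : hilbertType R).

Definition bounded_op : {pred H -> K} := [pred f | `[< linear f /\ continuous f >]].

Record bop := Bop { bop_val :> H -> K; bop_valP : bop_val \in bounded_op }.

HB.instance Definition _ := [isSub for bop_val].
HB.instance Definition _ := [Choice of bop by <:].

Lemma bounded_op_submod : submod_closed bounded_op.
Proof.
split=> [|c f g /asboolP[lf cf] /asboolP[lg cg]]; apply/asboolP; split.
- by move=> c x y /=; rewrite scaler0 addr0.
- exact: cst_continuous.
- by move=> d x y /=; rewrite !fctE lf lg !scalerDr !scalerA mulrC addrACA.
- by move=> x; apply: cvgD; [exact: cvgZr (cf x) | exact: cg].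
Qed.

HB.instance Definition _ := GRing.isSubmodClosed.Build _ _ bounded_op bounded_op_submod.
HB.instance Definition _ := [SubChoice_isSubLmodule of bop by <:].
HB.instance Definition _ := isPointed.Build bop 0.

End bounded_operators.

Arguments bounded_op {R} H K _.

Reserved Notation "''B(' H )" (format "''B(' H )").
Notation "''B(' H )" := (bop H H) : type_scope.

Section composition.
Variable R : realType.

Lemma bop_id_subproof (H : hilbertType R) : idfun \in bounded_op H H.
Proof. by apply/asboolP; split=> // x; exact: cvg_id. Qed.

Definition bop_id (H : hilbertType R) : 'B(H) := Bop (bop_id_subproof H).

Lemma bop_comp_subproof (H K L : hilbertType R) (f : bop K L) (g : bop H K) :
  f \o g \in bounded_op H L.
Proof.
have /asboolP[lf cf] := bop_valP f; have /asboolP[lg cg] := bop_valP g.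
apply/asboolP; split.
  by move=> c x y /=; rewrite lg lf.
by move=> x; apply: continuous_comp; [exact: cg | exact: cf].
Qed.

Definition bop_comp (H K L : hilbertType R) (f : bop K L) (g : bop H K) : bop H L :=
  Bop (bop_comp_subproof f g).

End composition.

Notation "f ** g" := (bop_comp f g) (at level 40, left associativity) : ring_scope.

Section operators.
Variables (R : realType) (H : hilbertType R).
Local Notation C := (cplx R).

(* Here and below, [get] picks the only element of the set that characterizes
   the object. *)
Definition adj (x : 'B(H)) : 'B(H) :=
  get [set y : 'B(H) | forall xi eta, '[x xi, eta] = '[xi, y eta]].

Definition unitary (u : 'B(H)) :=
  adj u ** u = bop_id H /\ u ** adj u = bop_id H.

(* The closure for the operator norm: [x - y] has norm at most [e]. *)
Definition norm_closure (A : set 'B(H)) : set 'B(H) :=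
  [set x | forall e : C, 0 < e ->
    exists2 y, A y & forall xi, `|(x - y) xi| <= e * `|xi|].

(* B(H)_*: the trace class operators, as functionals on B(H). *)
Definition predual : set ('B(H) -> C) :=
  [set f | exists xi eta : nat -> H,
    [/\ cvgn (series (fun n => `|xi n| ^+ 2 : C)),
        cvgn (series (fun n => `|eta n| ^+ 2 : C)) &
        forall x : 'B(H),
          series (fun n => '[x (xi n), eta n] : C) @ \oo --> (f x : C)]].

(* B(H) with its weak* topology, that of pointwise convergence on B(H)_*. *)
Definition weakstar_eval (x : 'B(H)) : {ptws set_type predual -> C} :=
  fun f => set_val f x.
Definition weakstar : topologicalType := initial_topology weakstar_eval.

Definition weakstar_closure (A : set 'B(H)) : set 'B(H) :=
  @closure weakstar A.

Definition commutant (M : set 'B(H)) : set 'B(H) :=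
  [set x | forall a, M a -> x ** a = a ** x].

Definition von_neumann (M : set 'B(H)) :=
  (forall a, M a -> M (adj a)) /\ commutant (commutant M) = M.

(* Weak* continuity on M, whose weak* topology is the one induced by B(H). *)
Definition normal_on (M : set 'B(H)) (f : 'B(H) -> C) :=
  {within (M : set weakstar), continuous (f : weakstar -> C)}.

End operators.

Section normal_Haagerup.
Variables (R : realType) (H K : hilbertType R).
Local Notation C := (cplx R).
Implicit Types (M : set 'B(H)) (N : set 'B(K)) (F : 'B(H) -> 'B(K) -> C).

(* The matrix A of operators has norm at most c as an operator E^n -> E^n,
   with the l^2 norm on E^n. *)
Definition mxnorm_le (E : normedModType C) n (A : 'I_n -> 'I_n -> E -> E) (c : C) :=
  0 <= c /\ forall xi : 'I_n -> E,
    \sum_(i < n) `|\sum_(j < n) A i j (xi j)| ^+ 2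
      <= c ^+ 2 * \sum_(j < n) `|xi j| ^+ 2.

Definition bilinear_on M N F :=
  (forall (c : C) a a' b, M a -> M a' -> N b ->
     F (c *: a + a') b = c * F a b + F a' b) /\
  (forall (c : C) a b b', M a -> N b -> N b' ->
     F a (c *: b + b') = c * F a b + F a b').

(* The completely bounded norm of F on M * N is at most k: the amplifications
   (a, b) |-> [\sum_l F (a i l) (b l j)]_(i, j) from M_n(M) * M_n(N) to M_n(C)
   are bounded by k, for all n. *)
Definition cb_norm_le M N F (k : C) :=
  0 <= k /\ forall n (a : 'M['B(H)]_n) (b : 'M['B(K)]_n) (s t : C),
    (forall i j, M (a i j)) -> (forall i j, N (b i j)) ->
    mxnorm_le (fun i j => a i j : H -> H) s ->
    mxnorm_le (fun i j => b i j : K -> K) t ->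
    mxnorm_le (E := C^o)
      (fun i j z => (\sum_(l < n) F (a i l) (b l j)) * z) (k * (s * t)).

Definition ncb_forms M N : set ('B(H) -> 'B(K) -> C) :=
  [set F | [/\ bilinear_on M N F,
               forall b, N b -> normal_on M (F^~ b),
               forall a, M a -> normal_on N (F a) &
               exists k, cb_norm_le M N F k]].

(* The dual of the space of normal completely bounded forms on M * N. Forms are
   represented by functions on B(H) * B(K), of which only the restriction to
   M * N matters: by boundedness, chi takes the same value on two forms that
   agree on M * N. The values of chi outside ncb_forms M N are irrelevant. *)
Definition normal_haagerup M N : set (('B(H) -> 'B(K) -> C) -> C) :=
  [set chi |
    (forall (c : C) F G, ncb_forms M N F -> ncb_forms M N G ->
       chi (fun a b => c * F a b + G a b) = c * chi F + chi G) /\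
    exists2 r : C, 0 <= r &
      forall F k, ncb_forms M N F -> cb_norm_le M N F k -> `|chi F| <= r * k].

Definition nh_elem (a : 'B(H)) (b : 'B(K)) : ('B(H) -> 'B(K) -> C) -> C :=
  fun F => F a b.

End normal_Haagerup.

(* The tensor product phi (x) psi of two normal completely bounded maps on
   normal Haagerup tensor products, which is the adjoint of F |-> F o (phi, psi):
   it is weak* continuous and maps a (x) b to phi a (x) psi b. *)
Definition nh_map (R : realType) (H K H' K' : hilbertType R)
    (phi : 'B(H) -> 'B(H')) (psi : 'B(K) -> 'B(K'))
    (chi : ('B(H) -> 'B(K) -> cplx R) -> cplx R) :
    ('B(H') -> 'B(K') -> cplx R) -> cplx R :=
  fun F => chi (fun a b => F (phi a) (psi b)).

Lemma nh_map_elem (R : realType) (H K H' K' : hilbertType R)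
    (phi : 'B(H) -> 'B(H')) (psi : 'B(K) -> 'B(K')) a b :
  nh_map phi psi (nh_elem a b) = nh_elem (phi a) (psi b).
Proof. by []. Qed.

Section normal_Haagerup_maps.
Variables (R : realType) (H : hilbertType R).
Local Notation C := (cplx R).
Implicit Type chi : ('B(H) -> 'B(H) -> C) -> C.

Definition Phi chi (x : 'B(H)) : 'B(H) :=
  get [set y : 'B(H) | forall xi eta : H,
    '[y xi, eta] = chi (fun a b => '[(a ** x ** b) xi, eta])].

(* The weak* continuous extension of a (x) b |-> a b is given on the predual by
   omega |-> ((a, b) |-> omega (a b)). *)
Definition mult chi : 'B(H) :=
  get [set y : 'B(H) | forall omega, predual omega ->
    omega y = chi (fun a b => omega (a ** b))].

End normal_Haagerup_maps.

(* A Hilbert space tensor product of H and K, which is determined up to a unique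
   unitary that preserves the elementary tensors. *)
Record hilbert_tensor (R : realType) (H K : hilbertType R) := HilbertTensor {
  tspace :> hilbertType R;
  tensor : {bilinear H -> K -> tspace};
  inner_tensor : forall x x' y y',
    '[tensor x y, tensor x' y'] = '[x, x'] * '[y, y'];
  dense_tensor : dense (lspan [set tensor x y | x in [set: H] & y in [set: K]])
}.

Section tensor_products.
Variables (R : realType) (H K : hilbertType R) (T : hilbert_tensor H K).
Local Notation C := (cplx R).

Definition tensor_op (a : 'B(H)) (b : 'B(K)) : 'B(T) :=
  get [set z : 'B(T) | forall x y,
    z (tensor T x y) = tensor T (a x) (b y)].

(* The weak* closed linear span of the a (x) b, for a in M and b in N. *)
Definition vn_tensor (M : set 'B(H)) (N : set 'B(K)) : set 'B(T) :=
  weakstar_closure (lspan [set tensor_op a b | a in M & b in N]).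

(* The functional f (x) g on B(T), determined by its values on the a (x) b. *)
Definition tensor_fun (f : 'B(H) -> C) (g : 'B(K) -> C) : 'B(T) -> C :=
  get [set h | predual h /\ forall a b, h (tensor_op a b) = f a * g b].

(* The normal slice maps f (x) id and id (x) g. *)
Definition lslice (f : 'B(H) -> C) (x : 'B(T)) : 'B(K) :=
  get [set y : 'B(K) | forall g, predual g -> g y = tensor_fun f g x].

Definition rslice (g : 'B(K) -> C) (x : 'B(T)) : 'B(H) :=
  get [set y : 'B(H) | forall f, predual f -> f y = tensor_fun f g x].

End tensor_products.

Arguments tensor_op {R H K} T a b.
Arguments vn_tensor {R H K} T M N.
Arguments tensor_fun {R H K} T f g x.
Arguments lslice {R H K} T f x.
Arguments rslice {R H K} T g x.

Section reduced_space.
Variables (R : realType) (H : hilbertType R) (HH : hilbert_tensor H H).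
Implicit Types W V : 'B(HH).

Definition Gamma W (a : 'B(H)) : 'B(HH) :=
  adj W ** tensor_op HH (bop_id H) a ** W.

Definition Gamma' V (b : 'B(H)) : 'B(HH) :=
  V ** tensor_op HH b (bop_id H) ** adj V.

Definition reduced_space W V : set 'B(H) :=
  norm_closure (lspan
    [set lslice HH f W ** rslice HH g V | f in @predual R H & g in @predual R H]).

(* The map T, with values in B(H (x) H (x) H), where H (x) H (x) H is
   (H (x) H) (x) H. *)
Definition T3 (HHH : hilbert_tensor HH H)
    (psi : ('B(HH) -> 'B(HH) -> cplx R) -> cplx R) : 'B(HHH) :=
  get [set z : 'B(HHH) | forall f omega g,
    predual f -> predual omega -> predual g ->
    tensor_fun HHH (tensor_fun HH f omega) g z =
    omega (mult (nh_map (lslice HH f) (rslice HH g) psi))].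

End reduced_space.

(* Main.v *)
From HB Require Import structures.
Require Import Defs.
From mathcomp Require Import all_boot all_order all_algebra.
From mathcomp Require Import sesquilinear complex ring lra zify.
From mathcomp Require Import all_classical all_reals.
From mathcomp Require Import topology function_spaces normedtype sequences.

(** The slices of [T3 (Gamma_W (x) Gamma'_V) chi] along f (x) id (x) g involve the
    products [L_f(Gamma_W a) R_g(Gamma'_V b)].  Writing [x_12] and [x_23] for the
    legs of x in H (x) H (x) H and [a_2] for 1 (x) a (x) 1, one has
    [(L_f A)(R_g B) = (f (x) id (x) g)(A_12 B_23)], so that
    [T3 (Gamma_W (x) Gamma'_V) chi = W_12^* Z V_23^*], where Z is the image of
    [W_12 V_23] under id (x) Phi_chi (x) id.  The slice of Z along f (x) id (x) g is
    [Phi_chi(L_f(W) R_g(V))].  An operator belongs to B(H) (x) N (x) B(H) if and only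
    if it commutes with all [n_2] for n in the commutant of N, if and only if all its
    slices belong to N.  Since [W_12] and [V_23] are unitaries commuting with every
    [n_2], condition (ii) says that Z commutes with every [n_2], i.e., that Phi_chi
    maps the generators of A(W, V) to N; this is (i), because Phi_chi is
    norm continuous. *)

Set Implicit Arguments.
Unset Strict Implicit.
Unset Printing Implicit Defensive.
Import Order.TTheory GRing.Theory Num.Theory.
Import numFieldTopology.Exports numFieldNormedType.Exports.

Local Open Scope classical_set_scope.
Local Open Scope ring_scope.

(** * The real norm and limits *)

Section rnorm.
Variable R : realType.
Local Notation C := (cplx R).

(** The obstacle is that [chi] is only a bounded functional on forms: it has no expansion into
    elementary tensors from which id (x) Phi_chi (x) id could be assembled. Z is therefore recovered
    from its values h(Z) = chi((a, b) |-> h(a_2 X b_2)), where X = W_12 V_23. Two facts are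
    required. These forms must be normal and completely bounded: normality says that a |-> a_2 is
    compatible with normal functionals, and the bound is a direct matrix estimate. And h |->
    chi(...) must be given by an operator: vector functionals yield a bounded sesquilinear form, and
    a general h is a finite sum of them up to an error that is uniformly small on bounded sets. The
    factors adj W and adj V in Gamma_W and Gamma'_V do not involve a or b, so they are moved into h;
    this is how they get out of [chi]. Finally, objects chosen by [get] mean something only after an
    existence proof, and legs are flipped or regrouped by changing the tensor structure on one fixed
    Hilbert space, so that the operators remain the same. *)

Definition rc (a : R) : C := (a%:C)%C.

Lemma rcD a b : rc (a + b) = rc a + rc b. Proof. exact: rmorphD. Qed.
Lemma rcM a b : rc (a * b) = rc a * rc b. Proof. exact: rmorphM. Qed.
Lemma rcN a : rc (- a) = - rc a. Proof. exact: rmorphN. Qed.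
Lemma rcV a : rc a^-1 = (rc a)^-1. Proof. exact: fmorphV. Qed.
Lemma rcX a n : rc (a ^+ n) = rc a ^+ n. Proof. exact: rmorphXn. Qed.
Lemma rc0 : rc 0 = 0. Proof. by []. Qed.
Lemma rc1 : rc 1 = 1. Proof. by []. Qed.
Lemma rc_inj : injective rc. Proof. exact: complexI. Qed.
Lemma rc_le a b : (rc a <= rc b) = (a <= b). Proof. exact: lecR. Qed.
Lemma rc_lt a b : (rc a < rc b) = (a < b). Proof. exact: ltcR. Qed.
Lemma rc_sum (I : Type) (r : seq I) (P : pred I) (F : I -> R) :
  rc (\sum_(i <- r | P i) F i) = \sum_(i <- r | P i) rc (F i).
Proof. exact: rmorph_sum. Qed.

Lemma ge0_ReK (z : C) : 0 <= z -> rc (complex.Re z) = z.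
Proof. by move=> z0; apply: RRe_real; apply: ger0_real. Qed.

Lemma norm_rc a : `|rc a| = rc `|a|.
Proof. by rewrite normc_def /= expr0n addr0 sqrtr_sqr. Qed.

(** Norms of modules over [cplx R] are complex numbers, ordered only partially; estimates are
    carried out on these real parts, where [lra] and [nra] apply. *)
Definition rnorm (V : normedModType C) (x : V) : R := complex.Re (`|x| : C).

Section basic.
Variable V : normedModType C.
Implicit Types x y : V.

Lemma rnormE x : `|x| = rc (rnorm x).
Proof. by rewrite /rnorm ge0_ReK. Qed.

Lemma rnorm_ge0 x : 0 <= rnorm x.
Proof. by rewrite -rc_le -rnormE rc0 normr_ge0. Qed.

Lemma rnormD x y : rnorm (x + y) <= rnorm x + rnorm y.
Proof. by rewrite -rc_le rcD -!rnormE ler_normD. Qed.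

Lemma rnorm0 : rnorm (0 : V) = 0.
Proof. by rewrite /rnorm normr0. Qed.

Lemma rnorm_eq0 x : rnorm x = 0 -> x = 0.
Proof. by move=> x0; apply/eqP; rewrite -normr_eq0 rnormE x0. Qed.

Lemma rnormN x : rnorm (- x) = rnorm x.
Proof. by rewrite /rnorm normrN. Qed.

Lemma rnormB x y : rnorm (x - y) = rnorm (y - x).
Proof. by rewrite -rnormN opprB. Qed.

Lemma rnormZ (c : C) x : rnorm (c *: x) = rnorm (c : C^o) * rnorm x.
Proof.
by apply: rc_inj; rewrite rcM -!rnormE normrZ.
Qed.

Lemma rnorm_sum (I : Type) (r : seq I) (P : pred I) (F : I -> V) :
  rnorm (\sum_(i <- r | P i) F i) <= \sum_(i <- r | P i) rnorm (F i).
Proof.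
elim/big_rec2: _ => [|i a b _ h]; first by rewrite rnorm0.
by rewrite (le_trans (rnormD _ _))// lerD2l.
Qed.

Lemma rnorm_triangle z x y : rnorm (x - y) <= rnorm (x - z) + rnorm (z - y).
Proof. by rewrite (le_trans _ (rnormD _ _))// addrA subrK. Qed.

End basic.

Lemma rnormM (a b : C) : rnorm (a * b : C^o) = rnorm (a : C^o) * rnorm (b : C^o).
Proof. exact: rnormZ. Qed.

Lemma rnorm_real (a : R) : rnorm (rc a : C^o) = `|a|.
Proof.
by apply: rc_inj; rewrite -rnormE -norm_rc.
Qed.

Lemma rnorm_conj (a : C) : rnorm (Num.conj a : C^o) = rnorm (a : C^o).
Proof. by rewrite /rnorm norm_conjC. Qed.

Lemma Re_le_rnorm (a : C) : `|complex.Re a| <= rnorm (a : C^o).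
Proof. by rewrite -rc_le -rnormE /rc normc_ge_Re. Qed.

Lemma Im_le_rnorm (a : C) : `|complex.Im a| <= rnorm (a : C^o).
Proof.
have -> : complex.Im a = complex.Re (- (a * 'i%C)) :> R.
  by case: a => x y /=; ring.
by rewrite (le_trans (Re_le_rnorm _))// rnormN rnormM
  /rnorm /= expr0n expr1n add0r sqrtr1 mulr1.
Qed.

Lemma rnorm_le_ReIm (a : C) :
  rnorm (a : C^o) <= `|complex.Re a| + `|complex.Im a|.
Proof.
have {1}-> : a = rc (complex.Re a) + 'i%C * rc (complex.Im a) by exact: complexE.
rewrite (le_trans (rnormD _ _))// rnorm_real lerD2l rnormM rnorm_real.
by rewrite /rnorm /= expr0n expr1n add0r sqrtr1 mul1r.
Qed.

(** A real [e] and a non-strict bound let limits be combined by linear arithmetic; [limitP] links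
    this to filters. *)
Definition limit (V : normedModType C) (u : nat -> V) (l : V) :=
  forall e : R, 0 < e -> exists N, forall n, (N <= n)%N -> rnorm (u n - l) <= e.

Lemma limitP (V : normedModType C) (u : nat -> V) (l : V) :
  (u @ \oo --> l) <-> limit u l.
Proof.
split=> [/cvgrPdist_le h e e0|h].
  have /h[N _ hN] : 0 < rc e by rewrite rc_lt.
  exists N => n /hN; by rewrite distrC rnormE rc_le.
apply/cvgrPdist_le => e e0.
have e0' : 0 < complex.Re e by rewrite -rc_lt ge0_ReK// ltW.
have [N hN] := h _ e0'.
exists N => // n /hN; rewrite distrC rnormE => h'.
by rewrite -(ge0_ReK (ltW e0)) rc_le.
Qed.

Lemma small_eq0 (c x : R) : 0 <= x -> 0 <= c -> (forall e : R, 0 < e -> x <= c * e) -> x = 0.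
Proof.
move=> x0 c0 h; apply/eqP; rewrite eq_le x0 andbT.
have [c00|cn] := eqVneq c 0; first by have := h 1 ltr01; rewrite c00 mul0r.
apply/ler_addgt0Pr => e e0; rewrite add0r.
have cp : 0 < c by rewrite lt_def cn.
by have := h (e / c) (divr_gt0 e0 cp); rewrite mulrC divfK.
Qed.

Lemma limit_unique (V : normedModType C) (u : nat -> V) (l l' : V) :
  limit u l -> limit u l' -> l = l'.
Proof.
move=> h h'; apply/eqP; rewrite -subr_eq0; apply/eqP; apply: rnorm_eq0.
apply: (@small_eq0 2) => // [|e e0]; first exact: rnorm_ge0.
have [N hN] := h _ e0; have [N' hN'] := h' _ e0.
have {}hN := hN (maxn N N') (leq_maxl _ _).
have {}hN' := hN' (maxn N N') (leq_maxr _ _).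
rewrite (le_trans (rnorm_triangle (u (maxn N N')) _ _))// rnormB; lra.
Qed.

Lemma limit_le (V : normedModType C) (u : nat -> V) (l : V) (b : R) :
  limit u l -> (forall n, rnorm (u n) <= b) -> rnorm l <= b.
Proof.
move=> h hb; apply/ler_addgt0Pr => e e0.
have [N hN] := h _ e0; have := hN N (leqnn _); have := hb N.
have := rnorm_triangle (u N) l 0; rewrite !subr0 rnormB; lra.
Qed.

Definition rlimit (u : nat -> R) (l : R) :=
  forall e : R, 0 < e -> exists N, forall n, (N <= n)%N -> `|u n - l| <= e.

Lemma rcauchy (u : nat -> R) :
  (forall e : R, 0 < e -> exists N, forall n m, (N <= n)%N -> (N <= m)%N -> `|u n - u m| <= e) ->
  exists l, rlimit u l.
Proof.
move=> h; have cu : cvgn u.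
  apply/cauchy_cvgP/cauchy_ballP => e e0.
  have [N hN] := h (e / 2) ltac:(lra).
  exists (u @` [set n | (N <= n)%N], u @` [set n | (N <= n)%N]).
    by split; exists N => // n /= Nn; exists n.
  move=> [_ _] /= [[n hn <-] [m hm <-]]; rewrite /ball /=.
  by have := hN _ _ hn hm; lra.
exists (lim (u @ \oo)) => e e0.
have /cvgrPdist_le /(_ _ e0) [N _ hN] := cu.
by exists N => n /hN; rewrite distrC.
Qed.

Lemma ccauchy (u : nat -> C) :
  (forall e : R, 0 < e -> exists N, forall n m, (N <= n)%N -> (N <= m)%N ->
     rnorm (u n - u m : C^o) <= e) ->
  exists l, limit (u : nat -> C^o) l.
Proof.
move=> h.
have [|a ha] := @rcauchy (fun n => complex.Re (u n)).
  move=> e /h[N hN]; exists N => n m hn hm.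
  by rewrite -raddfB (le_trans (Re_le_rnorm _))// hN.
have [|b hb] := @rcauchy (fun n => complex.Im (u n)).
  move=> e /h[N hN]; exists N => n m hn hm.
  by rewrite -raddfB (le_trans (Im_le_rnorm _))// hN.
exists (a +i* b)%C => e e0.
have [N hN] := ha (e / 2) ltac:(lra); have [M hM] := hb (e / 2) ltac:(lra).
exists (maxn N M) => n; rewrite geq_max => /andP[/hN h1 /hM h2].
rewrite (le_trans (rnorm_le_ReIm _))// !raddfB /=; lra.
Qed.

Lemma hcauchy (V : completeNormedModType C) (u : nat -> V) :
  (forall e : R, 0 < e -> exists N, forall n m, (N <= n)%N -> (N <= m)%N ->
     rnorm (u n - u m) <= e) ->
  exists l, limit u l.
Proof.
move=> h; have cu : cvgn u.
  apply/cauchy_cvgP/cauchy_ballP => e e0.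
  have e0' : 0 < complex.Re e by rewrite -rc_lt ge0_ReK// ltW.
  have [N hN] := h (complex.Re e / 2) ltac:(lra).
  exists (u @` [set n | (N <= n)%N], u @` [set n | (N <= n)%N]).
    by split; exists N => // n /= Nn; exists n.
  move=> [_ _] /= [[n hn <-] [m hm <-]]; rewrite -ball_normE /=.
  have {}hN := hN _ _ hn hm.
  rewrite rnormE -(ge0_ReK (ltW e0)) rc_lt; lra.
by exists (lim (u @ \oo)); apply/limitP.
Qed.

(** Every block beyond the threshold is small, whatever its length. This is the form in which square
    summability of vectors is used for normal functionals. *)
Lemma bounded_series (a : nat -> R) (c : R) :
  (forall n, 0 <= a n) -> (forall n, \sum_(k < n) a k <= c) ->
  forall e : R, 0 < e -> exists N, forall n m, (N <= n)%N -> \sum_(n <= k < m) a k <= e.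
Proof.
move=> a0 ac e e0.
have nd : nondecreasing_seq (series a).
  by apply/nondecreasing_seqP => n; rewrite /series /= big_nat_recr//= lerDl.
have cv : cvgn (series a).
  apply: nondecreasing_is_cvgn => //; exists c => _ [n _ <-].
  by rewrite /series /= big_mkord.
have /cvgrPdist_le /(_ _ e0) [N _ hN] := cv.
exists N => n m Nn; have [mn|nm] := leqP m n; first by rewrite big_geq// ltW.
have h1 := hN _ Nn.
have h2 := nondecreasing_cvgn_le nd cv m.
have h3 := nondecreasing_cvgn_le nd cv n.
move: h1; rewrite ger0_norm ?subr_ge0//.
have : series a m = series a n + \sum_(n <= k < m) a k.
  by rewrite /series /= (big_cat_nat (leq0n n) (ltnW nm)).
by move: h2; set l := lim _; set t := \sum_(n <= k < m) _; lra.
Qed.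

End rnorm.

(** * Limits, inner products and the Riesz representation theorem *)

Section hilbert.
Variable R : realType.
Local Notation C := (cplx R).

Section limits.
Variable V : normedModType C.
Implicit Types (u v : nat -> V) (x y : V).

Lemma limit_cst x : limit (fun=> x) x.
Proof. by move=> e e0; exists 0%N => n _; rewrite subrr rnorm0 ltW. Qed.

Lemma limitD u v x y : limit u x -> limit v y -> limit (fun n => u n + v n) (x + y).
Proof. by move=> /limitP hu /limitP hv; apply/limitP; apply: cvgD. Qed.

Lemma limitZ (c : C) u x : limit u x -> limit (fun n => c *: u n) (c *: x).
Proof. by move=> /limitP hu; apply/limitP; apply: cvgZr. Qed.

Lemma limitN u x : limit u x -> limit (fun n => - u n) (- x).
Proof. by move=> /limitP hu; apply/limitP; apply: cvgN. Qed.

Lemma limitB u v x y : limit u x -> limit v y -> limit (fun n => u n - v n) (x - y).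
Proof. by move=> hu hv; apply: limitD => //; apply: limitN. Qed.

Lemma limit_sum n (u : 'I_n -> nat -> V) (x : 'I_n -> V) :
  (forall i, limit (u i) (x i)) ->
  limit (fun m => \sum_(i < n) u i m) (\sum_(i < n) x i).
Proof.
elim: n u x => [|n IH] u x h.
  have -> : (fun m => \sum_(i < 0) u i m) = fun=> 0 by apply/funext => m; rewrite big_ord0.
  rewrite big_ord0; exact: limit_cst.
have -> : (fun m => \sum_(i < n.+1) u i m) =
    fun m => \sum_(i < n) u (widen_ord (leqnSn n) i) m + u ord_max m.
  by apply/funext => m; rewrite big_ord_recr.
by rewrite big_ord_recr; apply: limitD => //; apply: IH.
Qed.

Lemma limit_dom u x (a : nat -> R) (c : R) : 0 <= c ->
  rlimit a 0 -> (forall n, rnorm (u n - x) <= c * a n) -> limit u x.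
Proof.
move=> c0 ha hu e e0.
have c1 : 0 < c + 1 by lra.
have [N hN] := ha _ (divr_gt0 e0 c1).
exists N => n /hN; rewrite subr0 => h; apply: (le_trans (hu n)).
apply: (@le_trans _ _ ((c + 1) * (e / (c + 1)))); last by rewrite mulrC divfK ?gt_eqF.
have := ler_norm (a n); have := normr_ge0 (a n); nra.
Qed.

Lemma limit_rnorm u x : limit u x <-> rlimit (fun n => rnorm (u n - x)) 0.
Proof.
split=> h e /h [N hN]; exists N => n /hN; rewrite subr0 ger0_norm //; exact: rnorm_ge0.
Qed.

End limits.

Lemma rlimit_inv : rlimit (fun n => n.+1%:R^-1 : R) 0.
Proof.
move=> e e0; have [N hN] : exists N, e^-1 < N%:R.
  by exists (Num.bound e^-1); apply: archi_boundP; rewrite invr_ge0 ltW.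
exists N => n Nn; rewrite subr0 ger0_norm ?invr_ge0//.
rewrite invf_ple ?posrE// (le_trans (ltW hN))// ler_nat; exact: leqW.
Qed.

Section inner.
Variable H : hilbertType R.
Implicit Types (x y z : H) (c : C).

Lemma innerDl x y z : '[x + y, z] = '[x, z] + '[y, z].
Proof. exact: linearDl. Qed.
Lemma innerDr x y z : '[x, y + z] = '[x, y] + '[x, z].
Proof. exact: linearDr. Qed.
Lemma innerZl c x y : '[c *: x, y] = c * '[x, y].
Proof. exact: linearZl_LR. Qed.
Lemma innerZr c x y : '[x, c *: y] = Num.conj c * '[x, y].
Proof. exact: linearZr_LR. Qed.
Lemma inner0l x : '[0, x] = 0. Proof. exact: linear0l. Qed.
Lemma inner0r x : '[x, 0] = 0. Proof. exact: linear0r. Qed.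
Lemma innerNr x y : '[x, - y] = - '[x, y]. Proof. exact: linearNr. Qed.
Lemma innerBl x y z : '[x - y, z] = '[x, z] - '[y, z].
Proof. exact: linearBl. Qed.
Lemma innerBr x y z : '[x, y - z] = '[x, y] - '[x, z].
Proof. exact: linearBr. Qed.
Lemma inner_suml (I : Type) (r : seq I) (P : pred I) (F : I -> H) x :
  '[\sum_(i <- r | P i) F i, x] = \sum_(i <- r | P i) '[F i, x].
Proof. exact: linear_sumlz. Qed.
Lemma inner_sumr (I : Type) (r : seq I) (P : pred I) (F : I -> H) x :
  '[x, \sum_(i <- r | P i) F i] = \sum_(i <- r | P i) '[x, F i].
Proof. exact: linear_sumr. Qed.
Lemma inner_conj x y : Num.conj '[x, y] = '[y, x].
Proof. by rewrite [RHS]hermC expr0 mul1r. Qed.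

Lemma innerxx x : '[x, x] = rc (rnorm x ^+ 2).
Proof. by rewrite -normr_inner rnormE rcX. Qed.

Lemma rnorm_sqrD x y :
  rnorm (x + y) ^+ 2 = rnorm x ^+ 2 + rnorm y ^+ 2 + 2 * complex.Re '[x, y].
Proof.
have h (a : C) : a + Num.conj a = rc (2 * complex.Re a).
  case: a => u v; apply/eqP; rewrite eq_complex /=; apply/andP; split; apply/eqP; rewrite /=; ring.
apply: rc_inj; rewrite !rcD -h -!innerxx inner_conj innerDl !innerDr; ring.
Qed.

Lemma pythagoras x y : '[x, y] = 0 -> rnorm (x + y) ^+ 2 = rnorm x ^+ 2 + rnorm y ^+ 2.
Proof. by move=> xy; rewrite rnorm_sqrD xy /= mulr0 addr0. Qed.

Lemma parallelogram x y :
  rnorm (x + y) ^+ 2 + rnorm (x - y) ^+ 2 = 2 * rnorm x ^+ 2 + 2 * rnorm y ^+ 2.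
Proof. rewrite !rnorm_sqrD rnormN innerNr raddfN /=; ring. Qed.

(** The vector x is the orthogonal sum of x - c y and c y, where c = <x, y> / |y|^2, so |c| |y| <=
    |x|. *)
Lemma cauchy_schwarz x y : rnorm ('[x, y] : C^o) <= rnorm x * rnorm y.
Proof.
have [y0|yn0] := eqVneq (rnorm y) 0.
  by rewrite (rnorm_eq0 y0) inner0r !rnorm0 mulr0.
have y_gt0 : 0 < rnorm y by rewrite lt_def yn0 rnorm_ge0.
pose c := '[x, y] / rc (rnorm y ^+ 2).
have yC : rc (rnorm y ^+ 2) != 0 by rewrite -rc0 (inj_eq (@rc_inj R)) expf_neq0.
have hc : '[x, y] = c * rc (rnorm y ^+ 2) by rewrite divfK.
have zy : '[x - c *: y, c *: y] = 0.
  by rewrite innerZr innerBl innerZl innerxx -hc subrr mulr0.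
have := pythagoras zy; rewrite subrK rnormZ => e.
have le : rnorm (c : C^o) * rnorm y <= rnorm x.
  rewrite -(@ler_pXn2r _ 2)// ?nnegrE ?mulr_ge0 ?rnorm_ge0// e lerDr sqr_ge0//.
by rewrite hc rnormM rnorm_real ger0_norm ?sqr_ge0// expr2 mulrA ler_wpM2r// ltW.
Qed.

Lemma inner_eq0 x : (forall y, '[x, y] = 0) -> x = 0.
Proof.
move=> h; apply: rnorm_eq0; apply/eqP; rewrite -sqrf_eq0; apply/eqP.
by apply: rc_inj; rewrite -innerxx h.
Qed.

Lemma inner_ext x x' : (forall y, '[x, y] = '[x', y]) -> x = x'.
Proof.
move=> h; apply/eqP; rewrite -subr_eq0; apply/eqP/inner_eq0 => y.
by rewrite innerBl h subrr.
Qed.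

Lemma rnorm_le_inner x (c : R) : 0 <= c ->
  (forall y, rnorm ('[x, y] : C^o) <= c * rnorm y) -> rnorm x <= c.
Proof.
move=> c0 /(_ x); rewrite innerxx rnorm_real ger0_norm ?sqr_ge0// => h.
have [x0|xn0] := eqVneq (rnorm x) 0; first by rewrite x0.
have x_gt0 : 0 < rnorm x by rewrite lt_def xn0 rnorm_ge0.
by move: h; rewrite expr2 ler_pM2r.
Qed.

Lemma limit_inner (u v : nat -> H) x y : limit u x -> limit v y ->
  limit (fun n => '[u n, v n] : C^o) '[x, y].
Proof.
move=> hu hv e e0.
have X := rnorm_ge0 x; have Y := rnorm_ge0 y.
set c := 1 + rnorm x + rnorm y.
have c0 : 0 < c by rewrite /c; lra.
have [N hN] := hu (Num.min 1 (e / (2 * c))) ltac:(by rewrite lt_min ltr01 divr_gt0// mulr_gt0).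
have [M hM] := hv (Num.min 1 (e / (2 * c))) ltac:(by rewrite lt_min ltr01 divr_gt0// mulr_gt0).
exists (maxn N M) => n; rewrite geq_max => /andP[/hN h1 /hM h2].
move: h1 h2; rewrite !le_min => /andP[h1 h1'] /andP[h2 h2'].
have -> : '[u n, v n] - '[x, y] = '[u n - x, v n] + '[x, v n - y].
  by rewrite innerBl innerBr; ring.
rewrite (le_trans (rnormD (_ : C^o) (_ : C^o)))//.
have vn : rnorm (v n) <= 1 + rnorm y.
  by have := rnormD (v n - y) y; rewrite subrK; lra.
have e1 := cauchy_schwarz (u n - x) (v n).
have e2 := cauchy_schwarz x (v n - y).
have A : rnorm (u n - x) * rnorm (v n) <= e / (2 * c) * c.
  by rewrite ler_pM ?rnorm_ge0//; rewrite /c; lra.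
have B : rnorm x * rnorm (v n - y) <= c * (e / (2 * c)).
  by rewrite ler_pM ?rnorm_ge0//; rewrite /c; lra.
have D : e / (2 * c) * c = e / 2 by field; rewrite gt_eqF.
by move: A B; rewrite [c * _]mulrC D => A B; lra.
Qed.

(* The vector y is the limit of a minimizing sequence of |x|^2 - 2 Re (phi x). *)
Lemma riesz (phi : H -> C) (c : R) :
  (forall a x y, phi (a *: x + y) = a * phi x + phi y) ->
  (forall x, rnorm (phi x : C^o) <= c * rnorm x) ->
  exists y, forall x, phi x = '[x, y].
Proof.
move=> phiL phiB.
have phiD x y : phi (x + y) = phi x + phi y by rewrite -[x]scale1r phiL mul1r scale1r.
have phi0 : phi 0 = 0.
  by apply: (addrI (phi 0)); rewrite -phiD !addr0.
have phiZ a x : phi (a *: x) = a * phi x by rewrite -[a *: x]addr0 phiL phi0 addr0.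
pose J x : R := rnorm x ^+ 2 - 2 * complex.Re (phi x).
have JD u w : J (u + w) = J u + rnorm w ^+ 2 + 2 * complex.Re ('[w, u] - phi w).
  rewrite /J rnorm_sqrD phiD !raddfD raddfN /=.
  have -> : complex.Re '[u, w] = complex.Re '[w, u].
    by rewrite -inner_conj; case: '[w, u].
  ring.
have Jlb x : - c ^+ 2 <= J x.
  have := le_trans (le_trans (ler_norm _) (Re_le_rnorm (phi x))) (phiB x).
  by rewrite /J; have := sqr_ge0 (rnorm x - c); nra.
pose S := range J.
have infS : has_inf S.
  by split; [exists (J 0), 0 | exists (- c ^+ 2) => _ [x _ <-]].
pose m := inf S.
have Jm x : m <= J x by apply: ge_inf; [case: infS | exists x].
have xsP n : exists x, J x <= m + n.+1%:R^-1.
  have [|_ [x _ <-] h] := @inf_adherent _ S n.+1%:R^-1 _ infS; first by rewrite invr_gt0.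
  by exists x; exact: ltW.
have [xs hxs] := choice xsP.
(* Comparing the value of [J] at the midpoint with the infimum [m] turns the parallelogram law into
   a bound on |x - y|^2, so minimizing sequences are Cauchy. *)
have half x y : rnorm (x - y) ^+ 2 <= 2 * (J x - m) + 2 * (J y - m).
  have := parallelogram x y; have := Jm (2^-1 *: (x + y)); rewrite /J.
  have -> : phi (2^-1 *: (x + y)) = rc 2^-1 * (phi x + phi y).
    by rewrite phiZ phiD rcV; congr (_ * _); congr (_^-1); rewrite /rc rmorph_nat.
  rewrite rnormZ.
  have -> : rnorm (2^-1 : C^o) = 2^-1 :> R.
    have -> : (2^-1 : C) = rc 2^-1 by rewrite rcV; congr (_^-1); rewrite /rc rmorph_nat.
    by rewrite rnorm_real ger0_norm ?invr_ge0 ?ler0n.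
  have -> : complex.Re (rc 2^-1 * (phi x + phi y)) =
     2^-1 * (complex.Re (phi x) + complex.Re (phi y)).
    by case: (phi x) (phi y) => [a b] [a' b'] /=; ring.
  by rewrite exprMn; lra.
have [y hy] : exists y, limit xs y.
  apply: hcauchy => e e0.
  have [N hN] := rlimit_inv (divr_gt0 (exprn_gt0 2 e0) (ltr0n _ 4)).
  exists N => n k /hN hn /hN hk.
  rewrite -(@ler_pXn2r _ 2)// ?nnegrE ?rnorm_ge0 ?(ltW e0)//.
  move: hn hk; rewrite !subr0 !ger0_norm ?invr_ge0 ?ler0n// => hn hk.
  have {}hn : J (xs n) <= m + e ^+ 2 / 4 by rewrite (le_trans (hxs n))// lerD2l.
  have {}hk : J (xs k) <= m + e ^+ 2 / 4 by rewrite (le_trans (hxs k))// lerD2l.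
  have := half (xs n) (xs k); lra.
exists y => x.
pose d : C := phi x - '[x, y].
pose D := rnorm (d : C^o); pose X := rnorm x.
have D0 : 0 <= D := rnorm_ge0 _.
have X0 : 0 <= X := rnorm_ge0 _.
(* Moving by t x, with t = s conj(d), lowers [J] by 2 s D^2 up to an error of order e. The choice of
   [s] gives s X^2 <= 1, so the quadratic term s^2 D^2 X^2 costs at most s D^2, also when X = 0. *)
pose s := (1 + X ^+ 2)^-1.
have s1 : 0 < 1 + X ^+ 2 by have := sqr_ge0 X; lra.
have s0 : 0 < s by rewrite invr_gt0.
have sX : s * X ^+ 2 <= 1.
  by rewrite mulrC ler_pdivrMr// mul1r; lra.
pose t : C := rc s * Num.conj d.
have nt : rnorm (t : C^o) = s * D.
  by rewrite rnormM rnorm_conj rnorm_real ger0_norm ?(ltW s0).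
suff : s * D ^+ 2 = 0.
  move=> /eqP; rewrite mulf_eq0 gt_eqF//= expf_eq0/= => /eqP d0.
  by apply/eqP; rewrite -subr_eq0; apply/eqP; exact: (rnorm_eq0 d0).
apply: (@small_eq0 _ (1 + 2 * (s * D * X))).
- by rewrite mulr_ge0 ?sqr_ge0 ?(ltW s0).
- have : 0 <= s * D * X by rewrite !mulr_ge0// ltW.
  lra.
move=> e e0.
have [N hN] := hy _ e0; have [N' hN'] := rlimit_inv e0.
set n := maxn N N'.
have {}hN := hN n (leq_maxl _ _).
have {}hN' : n.+1%:R^-1 <= e.
  by have := hN' n (leq_maxr _ _); rewrite subr0 ger0_norm ?invr_ge0 ?ler0n.
have := Jm (xs n + t *: x); rewrite JD => h1.
have h2 : J (xs n) <= m + e by rewrite (le_trans (hxs n))// lerD2l.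
have h3 : '[t *: x, xs n] - phi (t *: x) = - rc (s * D ^+ 2) + t * '[x, xs n - y].
  rewrite phiZ innerZl innerBr.
  have -> : rc (s * D ^+ 2) = t * d.
    rewrite rcM rcX -rnormE normCK /t; ring.
  rewrite /d; ring.
have h4 : rnorm (t * '[x, xs n - y] : C^o) <= s * D * (X * e).
  rewrite rnormM nt ler_wpM2l ?mulr_ge0 ?(ltW s0)//.
  by rewrite (le_trans (cauchy_schwarz _ _))// ler_wpM2l.
have h5 := le_trans (ler_norm _) (le_trans (Re_le_rnorm _) h4).
move: h1; rewrite h3 raddfD raddfN /= rnormZ nt => h1.
rewrite -[rnorm x]/X in h1.
have h6 : s * D ^+ 2 * (s * X ^+ 2) <= s * D ^+ 2.
  by rewrite ler_piMr// mulr_ge0 ?sqr_ge0 ?(ltW s0).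
have h7 : (s * D * X) ^+ 2 = s * D ^+ 2 * (s * X ^+ 2) by ring.
lra.
Qed.

End inner.
End hilbert.

(** * Bounded operators *)

Section operators.
Variable R : realType.
Local Notation C := (cplx R).
Implicit Types H K L : hilbertType R.

Section bop_theory.
Variables H K : hilbertType R.
Implicit Types (f g : bop H K) (x : H) (c : C).

Lemma bop_linear f c x y : f (c *: x + y) = c *: f x + f y.
Proof. by have /asboolP[lf _] := bop_valP f; rewrite lf. Qed.
Lemma bopD f x y : f (x + y) = f x + f y.
Proof. by rewrite -[x]scale1r bop_linear !scale1r. Qed.
Lemma bop0 f : f 0 = 0.
Proof. by apply: (addrI (f 0)); rewrite -bopD !addr0. Qed.
Lemma bopZ f c x : f (c *: x) = c *: f x.
Proof. by rewrite -[c *: x]addr0 bop_linear bop0 addr0. Qed.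
Lemma bopN f x : f (- x) = - f x.
Proof. by apply: (addrI (f x)); rewrite -bopD !subrr bop0. Qed.
Lemma bopB f x y : f (x - y) = f x - f y.
Proof. by rewrite bopD bopN. Qed.
Lemma bop_sum f (I : Type) (r : seq I) (P : pred I) (F : I -> H) :
  f (\sum_(i <- r | P i) F i) = \sum_(i <- r | P i) f (F i).
Proof. exact: (big_morph _ (bopD f) (bop0 f)). Qed.

Lemma bop_ext f g : (forall x, f x = g x) -> f = g.
Proof. by move=> fg; apply: val_inj; apply/funext. Qed.

Lemma bop_inner_ext f g : (forall x (y : K), '[f x, y] = '[g x, y]) -> f = g.
Proof. by move=> h; apply: bop_ext => x; apply: inner_ext => y; rewrite h. Qed.

Lemma add_bopE f g x : (f + g) x = f x + g x. Proof. by []. Qed.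
Lemma scale_bopE c f x : (c *: f) x = c *: f x. Proof. by []. Qed.
Lemma sum_bopE (I : Type) (r : seq I) (P : pred I) (F : I -> bop H K) x :
  (\sum_(i <- r | P i) F i) x = \sum_(i <- r | P i) F i x.
Proof. exact: (big_morph (fun f : bop H K => f x) (fun f g => erefl) erefl). Qed.

Definition bounded_by (d : R) (f : H -> K) := forall x, rnorm (f x) <= d * rnorm x.

Lemma bounded_op_of (f : H -> K) d :
  linear f -> bounded_by d f -> f \in bounded_op H K.
Proof.
move=> lf bf; apply/asboolP; split=> // x.
apply/cvgrPdist_le => e e0.
have e0' : 0 < complex.Re e by rewrite -rc_lt ge0_ReK// ltW.
set d' := 1 + `|d|.
have d'0 : 0 < d' by have := normr_ge0 d; rewrite /d'; lra.
have e1 : (0 : C) < rc (complex.Re e / d') by rewrite rc_lt divr_gt0.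
have /cvgrPdist_le/(_ _ e1) : (fun y => y) @ nbhs x --> x by exact: cvg_id.
apply: filterS => y; rewrite rnormE rc_le -(ge0_ReK (ltW e0)) rnormE rc_le.
have -> : f x - f y = f (x - y).
  by rewrite addrC -scaleN1r -lf scaleN1r [- y + x]addrC.
rewrite ler_pdivlMr// mulrC; apply: le_trans; apply: (le_trans (bf _)).
by rewrite ler_wpM2r ?rnorm_ge0// /d'; have := ler_norm d; lra.
Qed.

Lemma bop_of (f : H -> K) d : linear f -> bounded_by d f ->
  exists2 z : bop H K, (forall x, z x = f x) & bounded_by d z.
Proof. by move=> lf bf; exists (Bop (bounded_op_of lf bf)). Qed.

(** Continuity at 0 bounds [f] by 1 on an open ball; a nonzero vector is rescaled to half its
    radius. *)
Lemma bop_bounded f : exists2 d : R, 0 <= d & bounded_by d f.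
Proof.
have /asboolP[_ cf] := bop_valP f.
have := cf 0 => /cvgrPdist_le /(_ 1 ltr01) /nbhs_normP[e /= e0 he].
have e0' : 0 < complex.Re e by rewrite -rc_lt ge0_ReK// ltW.
set r := complex.Re e / 2.
have r0 : 0 < r by rewrite divr_gt0.
exists r^-1; first by rewrite invr_ge0 ltW.
move=> x; have [x0|xn0] := eqVneq (rnorm x) 0.
  by rewrite (rnorm_eq0 x0) bop0 !rnorm0 mulr0.
have x_gt0 : 0 < rnorm x by rewrite lt_def xn0 rnorm_ge0.
set t := r / rnorm x.
have t0 : 0 < t by rewrite divr_gt0.
have nt : rnorm (rc t *: x) = r by rewrite rnormZ rnorm_real ger0_norm ?ltW// divfK.
have := he (rc t *: x); rewrite /= sub0r normrN rnormE nt.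
rewrite -(ge0_ReK (ltW e0)) rc_lt bop0 sub0r normrN rnormE -rc1 rc_le bopZ rnormZ.
rewrite rnorm_real (ger0_norm (ltW t0)) => /(_ ltac:(rewrite /r; lra)).
rewrite /t mulrAC ler_pdivrMr// mul1r => h.
by rewrite -(ler_pM2l r0) mulrA divff ?gt_eqF// mul1r.
Qed.

Lemma limit_bop f (u : nat -> H) x : limit u x -> limit (fun n => f (u n)) (f x).
Proof.
move=> /limit_rnorm hu; have [d d0 hd] := bop_bounded f.
by apply: (limit_dom d0 hu) => n; rewrite -bopB hd.
Qed.

Lemma bounded_by_form f d : 0 <= d ->
  (forall x (y : K), rnorm ('[f x, y] : C^o) <= d * rnorm x * rnorm y) -> bounded_by d f.
Proof.
move=> d0 h x; apply: rnorm_le_inner => [|y]; last exact: h.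
by rewrite mulr_ge0 ?rnorm_ge0.
Qed.

(** For fixed x, y |-> conj (B x y) is a bounded linear functional and Riesz provides its vector.
    Operators known only through their matrix coefficients, such as adjoints, slices and Z, are
    obtained in this way. *)
Lemma form_bop (B : H -> K -> C) d :
  (forall c x x' y, B (c *: x + x') y = c * B x y + B x' y) ->
  (forall c x (y y' : K), B x (c *: y + y') = Num.conj c * B x y + B x y') ->
  (forall x y, rnorm (B x y : C^o) <= d * rnorm x * rnorm y) -> 0 <= d ->
  exists z : bop H K, (forall x y, '[z x, y] = B x y) /\ bounded_by d z.
Proof.
move=> Bl Br Bb d0.
have /choice[f hf] : forall x, exists w, forall y, Num.conj (B x y) = '[y, w].
  move=> x; apply: (@riesz R K _ (d * rnorm x)) => [c y y'|y].
    by rewrite Br rmorphD rmorphM /= conjCK.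
  by rewrite rnorm_conj.
have fB x y : '[f x, y] = B x y by rewrite -inner_conj -hf conjCK.
have lf : linear f.
  by move=> c x y; apply: inner_ext => w; rewrite innerDl innerZl !fB Bl.
have bf : bounded_by d f.
  move=> x; apply: rnorm_le_inner => [|y]; first by rewrite mulr_ge0 ?rnorm_ge0.
  by rewrite fB.
by have [z zE bz] := bop_of lf bf; exists z; split => // x y; rewrite zE.
Qed.

(** [E] is a densely defined linear relation rather than a function: the bound makes it single
    valued, so a map on an algebraic tensor product can be given on representations by lists without
    choosing one. [G] is the closure of its graph, total because K is complete. *)
Lemma extend_bop (E : H -> K -> Prop) d : 0 <= d ->
  (forall c s t s' t', E s t -> E s' t' -> E (c *: s + s') (c *: t + t')) ->
  (forall s t, E s t -> rnorm t <= d * rnorm s) ->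
  (forall x (e : R), 0 < e -> exists s t, E s t /\ rnorm (s - x) <= e) ->
  exists2 z : bop H K, (forall s t, E s t -> z s = t) & bounded_by d z.
Proof.
move=> d0 El Eb Ed.
pose G x y := exists s t, [/\ forall n, E (s n) (t n), limit s x & limit t y].
have E_sub s t s' t' : E s t -> E s' t' -> rnorm (t - t') <= d * rnorm (s - s').
  move=> h h'; have := Eb _ _ (El (-1) _ _ _ _ h' h).
  by rewrite !scaleN1r ![- _ + _]addrC.
have Gb x y : G x y -> rnorm y <= d * rnorm x.
  move=> [s [t [Est ls lt]]].
  apply/ler_addgt0Pr => e e0.
  have d1 : 0 < d + 1 by lra.
  have e1 : 0 < e / (2 * (d + 1)) by rewrite divr_gt0// mulr_gt0.
  have e2 : d * (e / (2 * (d + 1))) <= e / 2.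
    have -> : e / 2 = (d + 1) * (e / (2 * (d + 1))) by field; rewrite gt_eqF.
    by rewrite ler_wpM2r ?ltW//; lra.
  have [N hN] := ls _ e1; have [M hM] := lt (e / 2) ltac:(lra).
  have {}hN := hN (maxn N M) (leq_maxl _ _); have {}hM := hM (maxn N M) (leq_maxr _ _).
  set n := maxn N M in hN hM.
  have h1 := Eb _ _ (Est n).
  have h2 := rnormD (s n - x) x; rewrite subrK in h2.
  have h3 := rnormD (y - t n) (t n); rewrite subrK rnormB in h3.
  have h4 : d * rnorm (s n) <= d * (e / (2 * (d + 1))) + d * rnorm x.
    by rewrite -mulrDr ler_wpM2l//; lra.
  lra.
have Gl c x y x' y' : G x y -> G x' y' -> G (c *: x + x') (c *: y + y').
  move=> [s [t [Est ls lt]]] [s' [t' [Est' ls' lt']]].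
  exists (fun n => c *: s n + s' n), (fun n => c *: t n + t' n); split.
  - by move=> n; apply: El.
  - by apply: limitD => //; apply: limitZ.
  - by apply: limitD => //; apply: limitZ.
have Gt x : exists y, G x y.
  have /choice[s /choice[t h]] : forall n, exists s t, E s t /\ rnorm (s - x) <= n.+1%:R^-1.
    by move=> n; apply: Ed; rewrite invr_gt0.
  have ls : limit s x.
    by apply: (limit_dom ler01 (@rlimit_inv R)) => n; rewrite mul1r; case: (h n).
  have [y lt] : exists y, limit t y.
    apply: hcauchy => e e0.
    have d1 : 0 < d + 1 by lra.
    have e1 : 0 < e / (2 * (d + 1)) by rewrite divr_gt0// mulr_gt0.
    have [N hN] := ls _ e1; exists N => n m /hN hn /hN hm.
    rewrite (le_trans (E_sub _ _ _ _ (h n).1 (h m).1))//.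
    have := rnorm_triangle x (s n) (s m); rewrite [rnorm (x - _)]rnormB => h3.
    have -> : e = (d + 1) * (2 * (e / (2 * (d + 1)))) by field; rewrite gt_eqF.
    by rewrite ler_pM ?rnorm_ge0//; lra.
  by exists y, s, t; split => // n; case: (h n).
have Gu x y y' : G x y -> G x y' -> y = y'.
  move=> h h'; have := Gb _ _ (Gl (-1) _ _ _ _ h h').
  rewrite !scaleN1r addNr rnorm0 mulr0 => h0.
  have : rnorm (- y + y') = 0 by apply/eqP; rewrite eq_le h0 rnorm_ge0.
  by move=> /rnorm_eq0/eqP; rewrite addrC subr_eq0 => /eqP.
have [f hf] := choice Gt.
have lf : linear f by move=> c x y; apply: Gu (hf _) (Gl _ _ _ _ _ (hf x) (hf y)).
have bf : bounded_by d f by move=> x; apply: Gb.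
have [z zE bz] := bop_of lf bf; exists z => // s t Est.
rewrite zE; apply: Gu (hf _) _; exists (fun=> s), (fun=> t).
by split => //; exact: limit_cst.
Qed.

End bop_theory.

Lemma bop_compE H K L (f : bop K L) (g : bop H K) x : (f ** g) x = f (g x).
Proof. by []. Qed.
Lemma bop_idE H (x : H) : bop_id H x = x.
Proof. by []. Qed.
Lemma bop_compA H K L M (f : bop L M) (g : bop K L) (h : bop H K) :
  f ** (g ** h) = f ** g ** h.
Proof. exact: bop_ext. Qed.
Lemma bop_comp1 H K (f : bop H K) : f ** bop_id H = f.
Proof. exact: bop_ext. Qed.
Lemma bop_1comp H K (f : bop H K) : bop_id K ** f = f.
Proof. exact: bop_ext. Qed.

Lemma bounded_by_comp H K L (f : bop K L) (g : bop H K) d e : 0 <= d ->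
  bounded_by d f -> bounded_by e g -> bounded_by (d * e) (f ** g).
Proof.
by move=> d0 hf hg x; rewrite (le_trans (hf _))// -mulrA ler_wpM2l.
Qed.

Section adjoint.
Variable H : hilbertType R.
Implicit Types (x y : 'B(H)).

Lemma adjE x xi eta : '[x xi, eta] = '[xi, adj x eta].
Proof.
have [d d0 hd] := bop_bounded x.
have [z [hz _]] : exists z : 'B(H), (forall u v, '[z u, v] = '[u, x v]) /\ bounded_by d z.
  apply: form_bop => //.
  - by move=> c u u' v; rewrite innerDl innerZl.
  - by move=> c u v v'; rewrite bop_linear innerDr innerZr.
  - move=> u v; rewrite (le_trans (cauchy_schwarz _ _))// -mulrA mulrCA ler_wpM2l ?rnorm_ge0//.
have := @getPex _ [set y : 'B(H) | forall xi eta, '[x xi, eta] = '[xi, y eta]].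
apply; exists z => u v; by rewrite -inner_conj -hz inner_conj.
Qed.

Lemma adjEl x xi eta : '[adj x xi, eta] = '[xi, x eta].
Proof. by rewrite -inner_conj -adjE inner_conj. Qed.

Lemma adj_unique x y : (forall xi eta, '[x xi, eta] = '[xi, y eta]) -> y = adj x.
Proof.
by move=> h; apply: bop_inner_ext => u v; rewrite adjEl -inner_conj -h inner_conj.
Qed.

End adjoint.
End operators.

(** * Tensor products of operators *)

Section orthonormal.
Variables (R : realType) (K : hilbertType R).
Local Notation C := (cplx R).
Implicit Types (e : nat -> K) (y : K).

Definition onb m e := forall i j, (i < m)%N -> (j < m)%N -> '[e i, e j] = (i == j)%:R.

(** Membership in the span of an orthonormal family, given as an expansion that can be substituted
    into tensors. *)
Definition fixed m e y := y = \sum_(k < m) '[y, e k] *: e k.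

Lemma onb_coef m e (c : nat -> C) j : onb m e -> (j < m)%N ->
  '[\sum_(k < m) c k *: e k, e j] = c j.
Proof.
move=> he jm; rewrite inner_suml (bigD1 (Ordinal jm))//= innerZl he// eqxx mulr1.
rewrite big1 ?addr0// => i ij; rewrite innerZl he//.
by rewrite -[_ == _](inj_eq val_inj) /= in ij; rewrite (negbTE ij) mulr0.
Qed.

Lemma onb_bessel m e y : onb m e ->
  \sum_(k < m) rnorm ('[y, e k] : C^o) ^+ 2 <= rnorm y ^+ 2.
Proof.
move=> he; pose p := \sum_(k < m) '[y, e k] *: e k.
have pe j : (j < m)%N -> '[p, e j] = '[y, e j].
  by move=> jm; exact: (onb_coef (fun k => '[y, e k]) he jm).
have pp v : '[v, p] = \sum_(k < m) Num.conj '[y, e k] * '[v, e k].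
  by rewrite inner_sumr; apply: eq_bigr => k _; rewrite innerZr.
have yp : '[y - p, p] = 0.
  by rewrite innerBl !pp -sumrB big1// => k _; rewrite pe// subrr.
have -> : \sum_(k < m) rnorm ('[y, e k] : C^o) ^+ 2 = rnorm p ^+ 2.
  apply: rc_inj; rewrite -innerxx pp rc_sum; apply: eq_bigr => k _.
  by rewrite pe// rcX -rnormE normCK mulrC.
by rewrite -[y in leRHS](subrK p) pythagoras// lerDr sqr_ge0.
Qed.

(** The induction appends the normalized remainder of [y], unless it vanishes. Applied to the second
    legs of a finite sum of elementary tensors, this rewrites the sum as sum_k xi_k (x) e_k, whose
    squared norm is sum_k |xi_k|^2. *)
Lemma gram_schmidt (s : seq K) :
  exists m e, onb m e /\ forall y, y \in s -> fixed m e y.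
Proof.
elim: s => [|y s [m [e [he hs]]]].
  by exists 0%N, (fun=> 0); split => // i j.
pose r := y - \sum_(k < m) '[y, e k] *: e k.
have re j : (j < m)%N -> '[r, e j] = 0.
  by move=> jm; rewrite innerBl (onb_coef (fun k => '[y, e k]) he jm) subrr.
have [r0|rn0] := eqVneq r 0.
  exists m, e; split => // x; rewrite inE => /orP[/eqP->|/hs//].
  by apply/eqP; rewrite -subr_eq0 -/r r0.
have nr : rnorm r != 0 by apply: contra_neq rn0 => /rnorm_eq0.
have nr0 : 0 < rnorm r by rewrite lt_def nr rnorm_ge0.
pose f := rc (rnorm r)^-1 *: r.
have rf : r = rc (rnorm r) *: f by rewrite scalerA -rcM divff// rc1 scale1r.
have ff : '[f, f] = 1.
  rewrite innerxx rnormZ rnorm_real ger0_norm ?invr_ge0 ?rnorm_ge0//.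
  by rewrite mulVf// expr1n rc1.
have fe j : (j < m)%N -> '[f, e j] = 0 by move=> jm; rewrite innerZl re// mulr0.
have ef j : (j < m)%N -> '[e j, f] = 0 by move=> jm; rewrite -inner_conj fe// rmorph0.
pose e' k := if (k < m)%N then e k else f.
have e'E k : (k < m)%N -> e' k = e k by rewrite /e' => ->.
have e'm : e' m = f by rewrite /e' ltnn.
have sumE x : \sum_(k < m.+1) '[x, e' k] *: e' k =
    \sum_(k < m) '[x, e k] *: e k + '[x, f] *: f.
  by rewrite big_ord_recr /= e'm; congr (_ + _); apply: eq_bigr => k _; rewrite e'E.
have fxf x : fixed m e x -> '[x, f] = 0.
  by move=> ->; rewrite inner_suml big1// => k _; rewrite innerZl ef// mulr0.
exists m.+1, e'; split => [i j|x].
  have c k : (k < m.+1)%N -> k = m \/ (k < m)%N.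
    by rewrite ltnS leq_eqVlt => /orP[/eqP->|]; [left|right].
  move=> /c[->|im] /c[->|jm].
  - by rewrite e'm ff eqxx.
  - by rewrite e'm e'E// fe// gtn_eqF.
  - by rewrite e'm e'E// ef// ltn_eqF.
  - by rewrite !e'E// he.
rewrite inE /fixed sumE => /orP[/eqP->|/hs fx]; last first.
  by rewrite fxf// scale0r addr0.
have -> : '[y, f] = rc (rnorm r).
  have {1}-> : y = \sum_(k < m) '[y, e k] *: e k + r by rewrite addrC subrK.
  rewrite innerDl inner_suml big1 ?add0r => [|k _]; last by rewrite innerZl ef// mulr0.
  by rewrite {1}rf innerZl ff mulr1.
by rewrite -rf addrC subrK.
Qed.

End orthonormal.

Section tensor.
Variable R : realType.
Local Notation C := (cplx R).
Implicit Types H K L : hilbertType R.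

Section theory.
Variables (H K : hilbertType R) (T : hilbert_tensor H K).
Implicit Types (x : H) (y : K) (u v : T) (l : seq (H * K)).
Local Notation tn := (tensor T).

Lemma tensorDl x x' y : tn (x + x') y = tn x y + tn x' y.
Proof. exact: linearDl. Qed.
Lemma tensorDr x y y' : tn x (y + y') = tn x y + tn x y'.
Proof. exact: linearDr. Qed.
Lemma tensorZl c x y : tn (c *: x) y = c *: tn x y.
Proof. exact: linearZl_LR. Qed.
Lemma tensorZr c x y : tn x (c *: y) = c *: tn x y.
Proof. exact: linearZr_LR. Qed.
Lemma tensor_suml (I : Type) (r : seq I) (P : pred I) (F : I -> H) y :
  tn (\sum_(i <- r | P i) F i) y = \sum_(i <- r | P i) tn (F i) y.
Proof. exact: linear_sumlz. Qed.
Lemma tensor_sumr (I : Type) (r : seq I) (P : pred I) (F : I -> K) x :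
  tn x (\sum_(i <- r | P i) F i) = \sum_(i <- r | P i) tn x (F i).
Proof. exact: linear_sumr. Qed.

Lemma rnorm_tensor x y : rnorm (tn x y) = rnorm x * rnorm y.
Proof.
apply/eqP; rewrite -(@eqrXn2 _ 2)// ?mulr_ge0 ?rnorm_ge0//; apply/eqP/rc_inj.
by rewrite -innerxx inner_tensor !innerxx exprMn [in RHS]rcM.
Qed.

(** Vectors of the algebraic tensor product are handled through lists of pairs; different lists may
    give the same vector. *)
Definition elt l : T := \sum_(p <- l) tn p.1 p.2.

Lemma alg_dense u (e : R) : 0 < e -> exists l, rnorm (elt l - u) <= e.
Proof.
move=> e0; have ec : 0 < rc e by rewrite -rc0 rc_lt.
have [z []] := @dense_tensor _ _ _ T (ball u (rc e)) (ex_intro _ u (ballxx _ ec))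
  (ball_open _ _).
rewrite -ball_normE /= rnormE rc_lt => hz [n [c [a [ha zE]]]].
have /choice[p hp] : forall i, exists p : H * K, tn p.1 p.2 = a i.
  by move=> i; have [x _ [y _ <-]] := ha i; exists (x, y).
exists [seq (c i *: (p i).1, (p i).2) | i <- enum 'I_n].
rewrite /elt big_map big_enum /= rnormB ltW// (le_lt_trans _ hz)// le_eqVlt.
apply/orP; left; apply/eqP; congr (rnorm (_ - _)); rewrite zE.
by apply: eq_bigr => i _; rewrite tensorZl hp.
Qed.

Lemma alg_seq u : exists l : nat -> seq (H * K), limit (fun n => elt (l n)) u.
Proof.
have /choice[l hl] : forall n, exists l, rnorm (elt l - u) <= n.+1%:R^-1.
  by move=> n; apply: alg_dense; rewrite invr_gt0.
exists l; apply: (limit_dom ler01 (@rlimit_inv R)) => n; rewrite mul1r; exact: hl.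
Qed.

Lemma bop_tensor_ext L (f g : bop T L) : (forall x y, f (tn x y) = g (tn x y)) -> f = g.
Proof.
move=> fg; apply: bop_ext => u; have [l hl] := alg_seq u.
apply: limit_unique (limit_bop f hl) _.
have -> : (fun n => f (elt (l n))) = fun n => g (elt (l n)).
  by apply/funext => n; rewrite !bop_sum; apply: eq_bigr => p _; rewrite fg.
exact: limit_bop.
Qed.

Lemma norm_onb m e (xi : nat -> H) : onb m e ->
  rnorm (\sum_(k < m) tn (xi k) (e k)) ^+ 2 = \sum_(k < m) rnorm (xi k) ^+ 2.
Proof.
move=> he; apply: rc_inj; rewrite -innerxx inner_suml rc_sum.
apply: eq_bigr => i _; rewrite inner_sumr (bigD1 i)//= inner_tensor he// eqxx mulr1.
rewrite innerxx big1 ?addr0// => j ji; rewrite inner_tensor he//.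
by rewrite eq_sym (inj_eq val_inj) (negbTE ji) mulr0.
Qed.

Lemma elt_onb m e l : (forall p, p \in l -> fixed m e p.2) ->
  elt l = \sum_(k < m) tn (\sum_(p <- l) '[p.2, e k] *: p.1) (e k).
Proof.
move=> hl; under eq_bigr do rewrite tensor_suml.
rewrite exchange_big /elt big_seq [RHS]big_seq; apply: eq_bigr => p pl /=.
rewrite {1}(hl _ pl) tensor_sumr; apply: eq_bigr => k _.
by rewrite tensorZl tensorZr.
Qed.

(** The image of [elt l] under a (x) 1, computed on the list because a (x) 1 is not yet available as
    an operator. *)
Definition amp (a : 'B(H)) l : T := \sum_(p <- l) tn (a p.1) p.2.

Lemma amp_onb m e a l : (forall p, p \in l -> fixed m e p.2) ->
  amp a l = \sum_(k < m) tn (a (\sum_(p <- l) '[p.2, e k] *: p.1)) (e k).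
Proof.
move=> hl; under eq_bigr do rewrite bop_sum tensor_suml.
rewrite exchange_big /amp big_seq [RHS]big_seq; apply: eq_bigr => p pl /=.
rewrite {1}(hl _ pl) tensor_sumr; apply: eq_bigr => k _.
by rewrite bopZ tensorZl tensorZr.
Qed.

End theory.

Definition mxb n H K (A : 'I_n -> 'I_n -> bop H K) (s : R) := forall xi : 'I_n -> H,
  \sum_(i < n) rnorm (\sum_(j < n) A i j (xi j)) ^+ 2
    <= s ^+ 2 * \sum_(j < n) rnorm (xi j) ^+ 2.

Lemma mxb1 H K (a : bop H K) s : bounded_by s a -> mxb (fun _ _ : 'I_1 => a) s.
Proof.
move=> ha xi; rewrite !big_ord1 -exprMn.
have h := ha (xi ord0); have h0 := le_trans (rnorm_ge0 _) h.
by rewrite ler_pXn2r// ?nnegrE ?rnorm_ge0.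
Qed.

Section amplification.
Variables (H K : hilbertType R) (T : hilbert_tensor H K).
Local Notation tn := (tensor T).

(** One orthonormal family for the second legs of all lists decouples the estimate: for each k it is
    the hypothesis on [A], applied to the coefficients along e_k. *)
Lemma amp_matrix n (A : 'I_n -> 'I_n -> 'B(H)) s (l : 'I_n -> seq (H * K)) :
  mxb A s ->
  \sum_(i < n) rnorm (\sum_(j < n) amp T (A i j) (l j)) ^+ 2
    <= s ^+ 2 * \sum_(j < n) rnorm (elt T (l j)) ^+ 2.
Proof.
move=> hA.
have [m [e [he hl]]] := gram_schmidt (flatten [seq unzip2 (l j) | j <- enum 'I_n]).
have {}hl j p : p \in l j -> fixed m e p.2.
  move=> pl; apply: hl; apply/flattenP; exists (unzip2 (l j)).
    by apply: map_f; rewrite mem_enum.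
  exact: map_f.
pose xi j k := \sum_(p <- l j) '[p.2, e k] *: p.1.
have -> : \sum_(j < n) rnorm (elt T (l j)) ^+ 2 =
    \sum_(k < m) \sum_(j < n) rnorm (xi j k) ^+ 2.
  rewrite exchange_big; apply: eq_bigr => j _ /=.
  by rewrite (elt_onb T (hl j)) (norm_onb T (xi j) he).
have -> : \sum_(i < n) rnorm (\sum_(j < n) amp T (A i j) (l j)) ^+ 2 =
    \sum_(k < m) \sum_(i < n) rnorm (\sum_(j < n) A i j (xi j k)) ^+ 2.
  rewrite exchange_big; apply: eq_bigr => i _ /=.
  rewrite -(norm_onb T (fun k => \sum_(j < n) A i j (xi j k)) he).
  congr (rnorm _ ^+ 2); under [RHS]eq_bigr do rewrite tensor_suml.
  by rewrite exchange_big; apply: eq_bigr => j _; rewrite (amp_onb T _ (hl j)).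
by rewrite mulr_sumr ler_sum.
Qed.

Lemma amp_exists (a : 'B(H)) d : 0 <= d -> bounded_by d a ->
  exists2 z : 'B(T), (forall x y, z (tn x y) = tn (a x) y) & bounded_by d z.
Proof.
move=> d0 ha.
have [||u e e0|z hz bz] := @extend_bop _ T T
    (fun s t => exists l, s = elt T l /\ t = amp T a l) d d0.
- move=> c _ _ _ _ [l [-> ->]] [l' [-> ->]].
  exists ([seq (c *: p.1, p.2) | p <- l] ++ l').
  rewrite /elt /amp !big_cat !big_map !scaler_sumr /=; split; congr (_ + _).
    by apply: eq_bigr => p _; rewrite tensorZl.
  by apply: eq_bigr => p _; rewrite bopZ tensorZl.
- move=> _ _ [l [-> ->]]; have := amp_matrix (fun=> l) (mxb1 ha).
  by rewrite !big_ord1 -exprMn ler_pXn2r ?nnegrE ?mulr_ge0 ?rnorm_ge0.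
- have [l hl] := alg_dense u e0.
  by exists (elt T l), (amp T a l); split => //; exists l.
exists z => // x y; apply: hz; exists [:: (x, y)].
by rewrite /elt /amp !big_seq1.
Qed.

End amplification.

Section flip.
Variables (H K : hilbertType R) (T : hilbert_tensor H K).

Definition flip_fun (y : K) (x : H) : T := tensor T x y.

Lemma flip_bilinear : bilinear_for *:%R *:%R flip_fun.
Proof.
split=> [x c y y'|y c x x'] /=; rewrite /flip_fun.
  by rewrite tensorDr tensorZr.
by rewrite tensorDl tensorZl.
Qed.

HB.instance Definition _ := bilinear_isBilinear.Build C K H T *:%R *:%R flip_fun
  flip_bilinear.

Lemma flip_inner y y' x x' : '[flip_fun y x, flip_fun y' x'] = '[y, y'] * '[x, x'].
Proof. by rewrite inner_tensor mulrC. Qed.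

Lemma flip_dense : dense (lspan [set flip_fun y x | y in [set: K] & x in [set: H]]).
Proof.
have -> : [set flip_fun y x | y in [set: K] & x in [set: H]] =
    [set tensor T x y | x in [set: H] & y in [set: K]].
  by apply/seteqP; split=> _ [x _ [y _ <-]]; exists y => //; exists x.
exact: dense_tensor.
Qed.

(** The underlying space is still [T], so operators on [T] and on [flip T] have convertible types,
    and results about one leg transfer to the other. *)
Definition flip : hilbert_tensor K H :=
  @HilbertTensor R K H T (flip_fun : {bilinear K -> H -> T}) flip_inner flip_dense.

End flip.

Section tensor_op.
Variables (H K : hilbertType R) (T : hilbert_tensor H K).
Local Notation tn := (tensor T).
Implicit Types (a : 'B(H)) (b : 'B(K)).

(** The operator is the product of a (x) 1 and 1 (x) b, the latter being b (x) 1 for the flipped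
    tensor product. *)
Lemma tensor_op_exists a b d d' : 0 <= d -> 0 <= d' -> bounded_by d a -> bounded_by d' b ->
  exists2 z : 'B(T), (forall x y, z (tn x y) = tn (a x) (b y)) & bounded_by (d * d') z.
Proof.
move=> d0 d0' ha hb.
have [z hz bz] := amp_exists T d0 ha.
have [z' hz' bz'] := amp_exists (flip T) d0' hb.
exists (z ** z'); last exact: bounded_by_comp.
by move=> x y; rewrite bop_compE (hz' y x) hz.
Qed.

Lemma tensor_opE a b x y : tensor_op T a b (tn x y) = tn (a x) (b y).
Proof.
have [d d0 hd] := bop_bounded a; have [d' d0' hd'] := bop_bounded b.
have [z hz _] := tensor_op_exists d0 d0' hd hd'.
apply: (@getPex _ [set z : 'B(T) | forall x y, z (tn x y) = tn (a x) (b y)]).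
by exists z.
Qed.

Lemma tensor_op_unique a b (z : 'B(T)) :
  (forall x y, z (tn x y) = tn (a x) (b y)) -> z = tensor_op T a b.
Proof. by move=> h; apply: bop_tensor_ext => x y; rewrite h tensor_opE. Qed.

Lemma tensor_op_bounded a b d d' : 0 <= d -> 0 <= d' -> bounded_by d a -> bounded_by d' b ->
  bounded_by (d * d') (tensor_op T a b).
Proof.
move=> d0 d0' ha hb; have [z hz bz] := tensor_op_exists d0 d0' ha hb.
by rewrite -(tensor_op_unique hz).
Qed.

Lemma tensor_op_comp a a' b b' :
  tensor_op T a b ** tensor_op T a' b' = tensor_op T (a ** a') (b ** b').
Proof. by apply: tensor_op_unique => x y; rewrite !bop_compE !tensor_opE. Qed.

Lemma tensor_op_id : tensor_op T (bop_id H) (bop_id K) = bop_id T.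
Proof. by apply/esym/tensor_op_unique. Qed.

Lemma tensor_op_lineal c a a' b :
  tensor_op T (c *: a + a') b = c *: tensor_op T a b + tensor_op T a' b.
Proof.
apply/esym/tensor_op_unique => x y.
by rewrite !add_bopE !scale_bopE !tensor_opE tensorDl tensorZl.
Qed.

Lemma tensor_op_linear c a b b' :
  tensor_op T a (c *: b + b') = c *: tensor_op T a b + tensor_op T a b'.
Proof.
apply/esym/tensor_op_unique => x y.
by rewrite !add_bopE !scale_bopE !tensor_opE tensorDr tensorZr.
Qed.

Lemma inner_tensor_ext (u u' : T) : (forall x y, '[u, tn x y] = '[u', tn x y]) -> u = u'.
Proof.
move=> h; apply: inner_ext => v; have [l hl] := alg_seq v.
apply: (limit_unique (limit_inner (limit_cst u) hl)).
have -> : (fun n => '[u, elt T (l n)]) = fun n => '[u', elt T (l n)].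
  by apply/funext => n; rewrite !inner_sumr; apply: eq_bigr => p _; rewrite h.
exact: limit_inner (limit_cst u') hl.
Qed.

Lemma tensor_op_adj a b : adj (tensor_op T a b) = tensor_op T (adj a) (adj b).
Proof.
apply: tensor_op_unique => x y; apply: inner_tensor_ext => x' y'.
by rewrite adjEl tensor_opE !inner_tensor !adjEl.
Qed.

Lemma limit_rc_le (a b : nat -> R) x y : (forall n, a n <= b n) ->
  limit (fun n => rc (a n) : C^o) (rc x) -> limit (fun n => rc (b n) : C^o) (rc y) -> x <= y.
Proof.
move=> ab ha hb; apply/ler_addgt0Pr => e e0.
have [N hN] := ha (e / 2) ltac:(lra); have [M hM] := hb (e / 2) ltac:(lra).
have := hN (maxn N M) (leq_maxl _ _); have := hM (maxn N M) (leq_maxr _ _).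
rewrite -!rcN -!rcD !rnorm_real; set n := maxn N M; have := ab n.
have := ler_norm (b n - y); have := ler_norm (- (a n - x)); rewrite normrN; lra.
Qed.

Lemma limit_rnorm_sqr (V : hilbertType R) (u : nat -> V) x :
  limit u x -> limit (fun n => rc (rnorm (u n) ^+ 2) : C^o) (rc (rnorm x ^+ 2)).
Proof.
move=> hu; rewrite -innerxx.
have -> : (fun n => rc (rnorm (u n) ^+ 2)) = fun n => '[u n, u n].
  by apply/funext => n; rewrite innerxx.
exact: limit_inner.
Qed.

(** Complete contractivity of a |-> a (x) 1: the estimate of [amp_matrix] passes to limits of
    algebraic vectors. *)
Lemma mxb_amp n (A : 'I_n -> 'I_n -> 'B(H)) s : mxb A s ->
  mxb (fun i j => tensor_op T (A i j) (bop_id K)) s.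
Proof.
move=> hA u.
have /choice[l hl] : forall j, exists l, limit (fun n => elt T (l n)) (u j).
  by move=> j; exact: alg_seq.
apply: (limit_rc_le (fun m => amp_matrix T (fun j => l j m) hA)).
  rewrite rc_sum.
  have -> : (fun m => rc (\sum_(i < n) rnorm (\sum_(j < n) amp T (A i j) (l j m)) ^+ 2)) =
    fun m => \sum_(i < n) rc (rnorm (\sum_(j < n) amp T (A i j) (l j m)) ^+ 2).
    by apply/funext => m; rewrite rc_sum.
  apply: (@limit_sum _ C^o) => i; apply: limit_rnorm_sqr; apply: limit_sum => j.
  have -> : (fun m => amp T (A i j) (l j m)) =
      fun m => tensor_op T (A i j) (bop_id K) (elt T (l j m)).
    apply/funext => m; rewrite bop_sum; apply: eq_bigr => p _.
    by rewrite tensor_opE.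
  exact: limit_bop.
rewrite mulr_sumr rc_sum.
have -> : (fun m => rc (s ^+ 2 * \sum_(j < n) rnorm (elt T (l j m)) ^+ 2)) =
  fun m => \sum_(j < n) rc (s ^+ 2) *: (rc (rnorm (elt T (l j m)) ^+ 2) : C^o).
  by apply/funext => m; rewrite mulr_sumr rc_sum; apply: eq_bigr => j _; rewrite rcM.
apply: (@limit_sum _ C^o) => j; rewrite rcM.
exact: (@limitZ _ C^o _ _ _ (limit_rnorm_sqr (hl j))).
Qed.

End tensor_op.

Lemma tensor_op_flip H K (T : hilbert_tensor H K) (a : 'B(H)) (b : 'B(K)) :
  tensor_op (flip T) b a = tensor_op T a b.
Proof. apply: (@tensor_op_unique H K T a b (tensor_op (flip T) b a)) => x y.
exact: (@tensor_opE K H (flip T) b a y x). Qed.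

End tensor.

(** * Normal functionals *)

Section shells.

(* Enumeration of nat * nat, shell by shell: its first n ^ 2 values are the pairs
   of numbers below n. *)
Definition shell m : seq (nat * nat) :=
  [seq (j, m) | j <- iota 0 m] ++ [seq (m, j) | j <- iota 0 m.+1].

Definition square n := flatten [seq shell m | m <- iota 0 n].

Definition square_nth k := nth (0%N, 0%N) (square k.+1) k.

Lemma squareS n : square n.+1 = square n ++ shell n.
Proof. by rewrite /square -[in LHS]addn1 iotaD map_cat flatten_cat /= cats0. Qed.

Lemma size_square n : size (square n) = (n ^ 2)%N.
Proof.
elim: n => // n IH; rewrite squareS size_cat IH /shell size_cat !size_map !size_iota; lia.
Qed.

Lemma square_prefix n m : (n <= m)%N -> exists s, square m = square n ++ s.
Proof.
move=> /subnK <-; elim: (m - n)%N => [|k [s IH]]; first by exists [::]; rewrite cats0.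
by exists (s ++ shell (k + n)); rewrite addSn squareS IH catA.
Qed.

Lemma square_nthE n k : (k < n ^ 2)%N -> nth (0%N, 0%N) (square n) k = square_nth k.
Proof.
move=> kn; rewrite /square_nth; have k1 : (k < k.+1 ^ 2)%N by nia.
have [h|/ltnW h] := leqP n k.+1; have [s ->] := square_prefix h;
  by rewrite nth_cat size_square ?kn ?k1.
Qed.

(** Double families of vectors become simple sequences whose partial sums of length n^2 are square
    double sums. *)
Lemma sum_square (V : nmodType) n (F : nat * nat -> V) :
  \sum_(k < n ^ 2) F (square_nth k) = \sum_(i < n) \sum_(j < n) F (i : nat, j : nat).
Proof.
have -> : \sum_(k < n ^ 2) F (square_nth k) = \sum_(q <- square n) F q.
  rewrite (big_nth (0%N, 0%N)) size_square big_mkord; apply: eq_bigr => k _.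
  by rewrite square_nthE.
elim: n => [|n IH]; first by rewrite big_nil big_ord0.
have it k (G : nat -> V) : \sum_(j <- iota 0 k) G j = \sum_(j < k) G j.
  by rewrite -(big_mkord xpredT) /index_iota subn0.
rewrite squareS big_cat IH /shell big_cat !big_map !it [RHS]big_ord_recr /= addrA.
congr (_ + _); under [RHS]eq_bigr do rewrite big_ord_recr /=.
by rewrite big_split.
Qed.

End shells.

Section predual.
Variable R : realType.
Local Notation C := (cplx R).

Section nuclear.
Variable H : hilbertType R.
Implicit Types (x y : 'B(H)) (xi eta : nat -> H) (f : 'B(H) -> C).

Definition sq_le (c : R) xi := forall n, \sum_(k < n) rnorm (xi k) ^+ 2 <= c.

Definition pairing xi eta n x : C := \sum_(k < n) '[x (xi k), eta k].

(* The normal functionals, with a bound on the vectors that represent them. *)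
Definition nuc (c : R) f := exists xi eta,
  [/\ sq_le c xi, sq_le c eta & forall x, limit (fun n => pairing xi eta n x : C^o) (f x)].

Lemma sq_le_ge0 c xi : sq_le c xi -> 0 <= c.
Proof. by move=> /(_ 0%N); rewrite big_ord0. Qed.

Lemma nuc_ge0 c f : nuc c f -> 0 <= c.
Proof. by case=> xi [eta [/sq_le_ge0]]. Qed.

(** By Cauchy-Schwarz and 2 |a| |b| <= |a|^2 + |b|^2; blocks of a pairing are thus controlled by
    blocks of the two square sums. *)
Lemma sum_pair_le (I : Type) (r : seq I) (P : pred I) (a b : I -> H) x d : 0 <= d ->
  bounded_by d x ->
  rnorm (\sum_(k <- r | P k) '[x (a k), b k] : C^o) <=
  d * 2^-1 * (\sum_(k <- r | P k) rnorm (a k) ^+ 2 + \sum_(k <- r | P k) rnorm (b k) ^+ 2).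
Proof.
move=> d0 hx; rewrite (le_trans (rnorm_sum _ _ _))// -big_split mulr_sumr /=.
apply: ler_sum => k _; rewrite (le_trans (cauchy_schwarz _ _))//.
have := ler_wpM2r (rnorm_ge0 (b k)) (hx (a k)); move/le_trans; apply.
rewrite -!mulrA ler_wpM2l//.
have := sqr_ge0 (rnorm (a k) - rnorm (b k)); nra.
Qed.

Lemma nuc_exists c xi eta : sq_le c xi -> sq_le c eta ->
  exists f, forall x, limit (fun n => pairing xi eta n x : C^o) (f x).
Proof.
move=> hxi heta; have c0 := sq_le_ge0 hxi.
suff /choice : forall x, exists l, limit (fun n => pairing xi eta n x : C^o) l.
  by case=> f hf; exists f.
move=> x; have [d d0 hd] := bop_bounded x.
apply: ccauchy => e e0.
have d1 : 0 < d + 1 by lra.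
have [N hN] := bounded_series (fun n => sqr_ge0 (rnorm (xi n))) hxi (divr_gt0 e0 d1).
have [M hM] := bounded_series (fun n => sqr_ge0 (rnorm (eta n))) heta (divr_gt0 e0 d1).
suff key n m : (maxn N M <= n)%N -> (n <= m)%N ->
    rnorm (pairing xi eta m x - pairing xi eta n x : C^o) <= e.
  exists (maxn N M) => n m hn hm; have [nm|/ltnW mn] := leqP n m.
    by rewrite rnormB; exact: key.
  exact: key.
rewrite geq_max => /andP[Nn Mn] nm.
have -> : pairing xi eta m x - pairing xi eta n x = \sum_(n <= k < m) '[x (xi k), eta k].
  rewrite /pairing -!(big_mkord xpredT (fun k => '[x (xi k), eta k])).
  by rewrite (big_cat_nat (leq0n n) nm) /= addrAC subrr add0r.
rewrite (le_trans (sum_pair_le _ _ _ _ d0 hd))//.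
have h1 := hN n m Nn; have h2 := hM n m Mn.
have -> : e = (d + 1) * (e / (d + 1)) by rewrite mulrC divfK ?gt_eqF.
rewrite -mulrA ler_pM ?mulr_ge0 ?addr_ge0 ?invr_ge0 ?sumr_ge0//; try lra.
  by move=> k _; rewrite sqr_ge0.
by move=> k _; rewrite sqr_ge0.
Qed.

Lemma pairing_linear xi eta n c x y :
  pairing xi eta n (c *: x + y) = c * pairing xi eta n x + pairing xi eta n y.
Proof.
rewrite /pairing mulr_sumr -big_split; apply: eq_bigr => k _.
by rewrite add_bopE scale_bopE innerDl innerZl.
Qed.

Lemma nuc_linear r f c x y : nuc r f -> f (c *: x + y) = c * f x + f y.
Proof.
move=> [xi [eta [_ _ h]]]; apply: limit_unique (h _) _.
have -> : (fun n => pairing xi eta n (c *: x + y)) =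
   fun n => c *: (pairing xi eta n x : C^o) + pairing xi eta n y.
  by apply/funext => n; rewrite pairing_linear.
by apply: (@limitD _ C^o) => //; apply: (@limitZ _ C^o).
Qed.

Lemma pairing_le c xi eta x d n : 0 <= d -> bounded_by d x -> sq_le c xi -> sq_le c eta ->
  rnorm (pairing xi eta n x : C^o) <= c * d.
Proof.
move=> d0 hd /(_ n) h1 /(_ n) h2.
rewrite (le_trans (sum_pair_le _ _ _ _ d0 hd))//.
apply: (@le_trans _ _ (d / 2 * (c + c))); last by lra.
by rewrite ler_wpM2l ?divr_ge0// lerD.
Qed.

Lemma nuc_bound c f x d : nuc c f -> 0 <= d -> bounded_by d x ->
  rnorm (f x : C^o) <= c * d.
Proof.
move=> [xi [eta [hxi heta h]]] d0 hd; apply: limit_le (h x) _ => n.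
exact: pairing_le.
Qed.

Lemma nuc_finite (c : R) m (a b : nat -> H) :
  \sum_(k < m) rnorm (a k) ^+ 2 <= c -> \sum_(k < m) rnorm (b k) ^+ 2 <= c ->
  nuc c (pairing a b m).
Proof.
pose z (a : nat -> H) k := if (k < m)%N then a k else 0.
have hz (V : nmodType) n (F : H -> H -> V) a' b' : (forall v, F 0 v = 0) ->
    \sum_(k < n) F (z a' k) (z b' k) = \sum_(k < minn n m) F (a' k) (b' k).
  move=> F0; elim: n => [|n IH]; first by rewrite min0n !big_ord0.
  rewrite big_ord_recr /= IH /z; case: ltnP => nm.
    by rewrite (minn_idPl nm) big_ord_recr.
  by rewrite F0 addr0 (minn_idPr (leqW nm)).
have hs (a' : nat -> H) : \sum_(k < m) rnorm (a' k) ^+ 2 <= c -> sq_le c (z a').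
  move=> h n; rewrite (hz _ n (fun u _ => rnorm u ^+ 2) a' a') => [|y]; last first.
    by rewrite rnorm0 expr0n.
  apply: le_trans h; rewrite -(big_mkord xpredT (fun k => rnorm (a' k) ^+ 2)).
  rewrite -(big_mkord xpredT (fun k => rnorm (a' k) ^+ 2)).
  rewrite [leRHS](big_cat_nat (leq0n _) (geq_minr n m)) /= lerDl sumr_ge0// => k _.
  exact: sqr_ge0.
move=> ha hb; exists (z a), (z b); split; [exact: hs|exact: hs|move=> x e e0].
exists m => n mn; rewrite /pairing (hz _ n (fun u v => '[x u, v]) a b) => [|y].
  by rewrite (minn_idPr mn) subrr rnorm0 ltW.
by rewrite bop0 inner0l.
Qed.

(** [nuc] asks for one bound on both families of vectors; the sum of squares serves without
    rescaling [u] and [v], but is cruder than |u| |v|. *)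
Lemma nuc_rank1 (u v : H) : nuc (rnorm u ^+ 2 + rnorm v ^+ 2) (fun x => '[x u, v]).
Proof.
have -> : (fun x => '[x u, v]) = pairing (fun=> u) (fun=> v) 1.
  by apply/funext => x; rewrite /pairing big_ord1.
by apply: nuc_finite; rewrite big_ord1 ?lerDl ?lerDr sqr_ge0.
Qed.

Lemma sum_shift (a : nat -> R) N n :
  \sum_(k < n) a (k + N)%N = \sum_(N <= k < N + n) a k.
Proof.
by rewrite -[in RHS](add0n N) big_addn add0n addKn big_mkord.
Qed.

(** The remainder is represented by the tails of the two families, so by [nuc_bound] it is small
    uniformly on bounded sets of operators. Reductions from normal functionals to finite sums of
    vector functionals rest on this uniformity. *)
Lemma nuc_tail c f xi eta : sq_le c xi -> sq_le c eta ->
  (forall x, limit (fun n => pairing xi eta n x : C^o) (f x)) ->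
  forall e : R, 0 < e -> exists N, nuc e (fun x => f x - pairing xi eta N x).
Proof.
move=> hxi heta hf e e0.
have [N hN] := bounded_series (fun n => sqr_ge0 (rnorm (xi n))) hxi e0.
have [M hM] := bounded_series (fun n => sqr_ge0 (rnorm (eta n))) heta e0.
set L := maxn N M; exists L, (fun k => xi (k + L)%N), (fun k => eta (k + L)%N).
split=> [n|n|x d d0].
- by rewrite (sum_shift (fun k => rnorm (xi k) ^+ 2)) hN// leq_maxl.
- by rewrite (sum_shift (fun k => rnorm (eta k) ^+ 2)) hM// leq_maxr.
have [L' hL'] := hf x d d0; exists L' => n L'n.
have -> : pairing (fun k => xi (k + L)%N) (fun k => eta (k + L)%N) n x =
    pairing xi eta (L + n) x - pairing xi eta L x.
  rewrite /pairing [X in _ = X - _]big_split_ord /= addrAC subrr add0r.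
  by apply: eq_bigr => k _; rewrite addnC.
by rewrite opprB addrA addrNK hL'// (leq_trans L'n)// leq_addl.
Qed.

(** The vectors of all [h m] are merged along [square_nth] into one representation of [f]; it
    remains to see that summing by squares and summing by rows agree. *)
Lemma nuc_series (c : nat -> R) (h : nat -> 'B(H) -> C) b :
  (forall m, nuc (c m) (h m)) -> (forall n, \sum_(m < n) c m <= b) ->
  exists2 f, nuc b f & forall x, limit (fun n => \sum_(m < n) h m x : C^o) (f x).
Proof.
move=> hn cb; have c0 m := nuc_ge0 (hn m).
have /choice[xi /choice[eta hh]] := hn.
pose xs k := xi (square_nth k).1 (square_nth k).2.
pose es k := eta (square_nth k).1 (square_nth k).2.
have sq (u : nat -> nat -> H) : (forall m, sq_le (c m) (u m)) ->
    sq_le b (fun k => u (square_nth k).1 (square_nth k).2).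
  move=> hu n; apply: le_trans (cb n).
  apply: (@le_trans _ _ (\sum_(k < n ^ 2) rnorm (u (square_nth k).1 (square_nth k).2) ^+ 2)).
    have nn : (n <= n ^ 2)%N by nia.
    pose a k := rnorm (u (square_nth k).1 (square_nth k).2) ^+ 2.
    rewrite -(big_mkord xpredT a) -(big_mkord xpredT a) [leRHS](big_cat_nat (leq0n _) nn) /=.
    by rewrite lerDl sumr_ge0// => k _; exact: sqr_ge0.
  rewrite (sum_square n (fun q => rnorm (u q.1 q.2) ^+ 2)); apply: ler_sum => i _ /=.
  exact: hu.
have hxs : sq_le b xs by apply: sq => m; case: (hh m).
have hes : sq_le b es by apply: sq => m; case: (hh m).
have [f hf] := nuc_exists hxs hes.
exists f; first by exists xs, es.
move=> x; have [d d0 hd] := bop_bounded x.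
pose B i n : C := pairing (xi i) (eta i) n x.
have fB e : 0 < e -> exists N, forall n, (N <= n)%N ->
    rnorm (\sum_(i < n) B i n - f x : C^o) <= e.
  move=> e0; have [N hN] := hf x e e0; exists N => n Nn.
  have -> : \sum_(i < n) B i n = pairing xs es (n ^ 2) x.
    by rewrite /pairing (sum_square n (fun q => '[x (xi q.1 q.2), eta q.1 q.2])).
  by apply: hN; nia.
move=> e e0.
(* This constant leaves e / 2 for the rows beyond [M]; the squares and the first [M] rows get e / 4
   each. *)
have d1 : 0 < 4 * (d + 1) by lra.
have [M hM] := bounded_series c0 cb (divr_gt0 e0 d1).
have [N1 hN1] := fB (e / 4) ltac:(lra).
have [N2 hN2] : exists N, forall n, (N <= n)%N ->
    rnorm (\sum_(i < M) (B i n - h i x) : C^o) <= e / 4.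
  have := @limit_sum _ C^o M (fun i n => B i n - h i x) (fun=> 0).
  have h0 (i : 'I_M) : limit (fun n => B i n - h i x : C^o) 0.
    have [_ _ /(_ x) hi] := hh i.
    by have := limitB hi (limit_cst (h i x : C^o)); rewrite subrr.
  move=> /(_ h0); rewrite big1// => /(_ (e / 4) ltac:(lra)) [N hN].
  by exists N => n /hN; rewrite subr0.
exists (maxn M (maxn N1 N2)) => n; rewrite !geq_max => /andP[Mn /andP[/hN1 h1 /hN2 h2]].
(* Both a full row and its truncation at [n] are at most c_i d. *)
have tail : rnorm (\sum_(M <= i < n) (B i n - h i x) : C^o) <= e / 2.
  rewrite (le_trans (rnorm_sum (V := C^o) _ _ _))//.
  apply: (@le_trans _ _ (\sum_(M <= i < n) (2 * d) * c i)).
    apply: ler_sum => i _; rewrite (le_trans (rnormD (_ : C^o) _))// rnormN.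
    have [hx he _] := hh i.
    have := pairing_le n d0 hd hx he; have := nuc_bound (hn i) d0 hd.
    rewrite -/(B i n); lra.
  rewrite -mulr_sumr; have := hM M n (leqnn _).
  have : 0 <= \sum_(M <= i < n) c i by apply: sumr_ge0.
  have -> : e / 2 = (2 * (d + 1)) * (e / (4 * (d + 1))) by field; rewrite gt_eqF//; lra.
  by move=> s0 s1; rewrite ler_pM//; lra.
have -> : \sum_(m < n) h m x - f x = (\sum_(i < n) B i n - f x) -
    (\sum_(i < M) (B i n - h i x) + \sum_(M <= i < n) (B i n - h i x)).
  rewrite -[X in X + \sum_(_ <= _ < _) _](big_mkord xpredT (fun i => B i n - h i x)).
  rewrite -(big_cat_nat (leq0n M) Mn) /= big_mkord sumrB; ring.
have t1 := rnormD (\sum_(i < n) B i n - f x : C^o)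
  (- (\sum_(i < M) (B i n - h i x) + \sum_(M <= i < n) (B i n - h i x))).
have t2 := rnormD (\sum_(i < M) (B i n - h i x) : C^o) (\sum_(M <= i < n) (B i n - h i x)).
rewrite rnormN in t1; lra.
Qed.

(** A series of squares converges if and only if its partial sums are bounded; the sum of the two
    bounds serves both families. *)
Lemma predualP f : predual f <-> exists c, nuc c f.
Proof.
have bnd xi : cvgn (series (fun n => `|xi n| ^+ 2 : C)) -> exists c, sq_le c xi.
  move=> /cvg_ex[l] /(@limitP R C^o) /(_ 1 ltr01) [N hN].
  exists (rnorm (l : C^o) + 1) => n.
  pose a k := rnorm (xi k) ^+ 2.
  have nm : (n <= maxn N n)%N by rewrite leq_maxr.
  apply: (@le_trans _ _ (\sum_(k < maxn N n) a k)).
    rewrite -!(big_mkord xpredT a) [leRHS](big_cat_nat (leq0n _) nm) /=.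
    by rewrite lerDl sumr_ge0// => k _; exact: sqr_ge0.
  have := hN _ (leq_maxl N n).
  have -> : series (fun n => `|xi n| ^+ 2 : C) (maxn N n) = rc (\sum_(k < maxn N n) a k).
    rewrite /series /= big_mkord rc_sum; apply: eq_bigr => k _.
    by rewrite rcX rnormE.
  have := rnormD (rc (\sum_(k < maxn N n) a k) - l : C^o) l; rewrite subrK rnorm_real.
  have := ler_norm (\sum_(k < maxn N n) a k); lra.
have cvs c xi : sq_le c xi -> cvgn (series (fun n => `|xi n| ^+ 2 : C)).
  move=> hc; have [l hl] : exists l, limit (series (fun n => `|xi n| ^+ 2 : C) : nat -> C^o) l.
    apply: ccauchy => e e0.
    have [N hN] := bounded_series (fun n => sqr_ge0 (rnorm (xi n))) hc e0.
    suff key n m : (N <= n)%N -> (n <= m)%N ->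
        rnorm (series (fun n => `|xi n| ^+ 2 : C) m -
          series (fun n => `|xi n| ^+ 2 : C) n : C^o) <= e.
      exists N => n m hn hm; have [nm|/ltnW mn] := leqP n m.
        by rewrite rnormB; exact: key.
      exact: key.
    move=> Nn nm; rewrite /series /= (big_cat_nat (leq0n n) nm) /= addrAC subrr add0r.
    have -> : \sum_(n <= k < m) (`|xi k| ^+ 2 : C) = rc (\sum_(n <= k < m) rnorm (xi k) ^+ 2).
      by rewrite rc_sum; apply: eq_bigr => k _; rewrite rcX rnormE.
    rewrite rnorm_real ger0_norm ?hN// sumr_ge0// => k _; exact: sqr_ge0.
  by apply/cvg_ex; exists l; apply/(@limitP R C^o).
have ser xi eta x : series (fun n => '[x (xi n), eta n] : C) = fun n => pairing xi eta n x.
  by apply/funext => n; rewrite /series /= big_mkord.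
split=> [[xi [eta [/bnd[c hc] /bnd[c' hc'] h]]]|[c [xi [eta [h1 h2 h]]]]].
  exists (c + c'), xi, eta; split.
  - by move=> n; rewrite (le_trans (hc n))// lerDl (sq_le_ge0 hc').
  - by move=> n; rewrite (le_trans (hc' n))// lerDr (sq_le_ge0 hc).
  - by move=> x; apply/limitP; rewrite -ser; exact: h.
exists xi, eta; split; [exact: cvs h1|exact: cvs h2|move=> x].
by rewrite ser; apply/(@limitP R C^o).
Qed.

Lemma predual_linear f c x y : predual f -> f (c *: x + y) = c * f x + f y.
Proof. by move=> /predualP[r]; exact: nuc_linear. Qed.

Lemma predual0 f : predual f -> f 0 = 0.
Proof.
move=> pf; have := predual_linear 1 0 0 pf; rewrite scale1r mul1r addr0 => h.
by apply: (addrI (f 0)); rewrite -h addr0.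
Qed.

Lemma predual_sum f (I : Type) (r : seq I) (P : pred I) (F : I -> 'B(H)) : predual f ->
  f (\sum_(i <- r | P i) F i) = \sum_(i <- r | P i) f (F i).
Proof.
move=> pf; apply: (big_morph f) => [x y|]; last exact: predual0.
by have := predual_linear 1 x y pf; rewrite scale1r mul1r.
Qed.

Lemma predual_rank1 (u v : H) : predual (fun x => '[x u, v]).
Proof. by apply/predualP; eexists; exact: nuc_rank1. Qed.

(** Since <a x b xi, eta> = <x (b xi), adj a eta>, the fixed operators are moved onto the
    vectors. *)
Lemma predual_comp f (a b : 'B(H)) : predual f -> predual (fun x => f (a ** x ** b)).
Proof.
move=> /predualP[c [xi [eta [h1 h2 h]]]]; apply/predualP.
have [d d0 hd] := bop_bounded b; have [d' d0' hd'] := bop_bounded (adj a).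
have c0 := sq_le_ge0 h1.
have sq (z : 'B(H)) e u : 0 <= e -> bounded_by e z -> sq_le c u -> 
    sq_le (e ^+ 2 * c) (fun k => z (u k)).
  move=> e0 hz hu n; apply: (@le_trans _ _ (e ^+ 2 * \sum_(k < n) rnorm (u k) ^+ 2)).
    rewrite mulr_sumr; apply: ler_sum => k _; rewrite -exprMn.
    by rewrite ler_pXn2r ?nnegrE ?mulr_ge0 ?rnorm_ge0.
  by rewrite ler_wpM2l ?sqr_ge0.
exists (d ^+ 2 * c + d' ^+ 2 * c), (fun k => b (xi k)), (fun k => adj a (eta k)); split.
- move=> n; rewrite (le_trans (sq _ _ _ d0 hd h1 n))// lerDl mulr_ge0 ?sqr_ge0//.
- move=> n; rewrite (le_trans (sq _ _ _ d0' hd' h2 n))// lerDr mulr_ge0 ?sqr_ge0//.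
- move=> x; have -> : (fun n => pairing (fun k => b (xi k)) (fun k => adj a (eta k)) n x) =
      fun n => pairing xi eta n (a ** x ** b).
    by apply/funext => n; apply: eq_bigr => k _; rewrite -adjE.
  exact: h.
Qed.

Lemma predual_compl f a : predual f -> predual (fun x => f (a ** x)).
Proof.
move=> /(predual_comp a (bop_id H)) h.
have -> // : (fun x => f (a ** x)) = fun x => f (a ** x ** bop_id H).
by apply/funext => x; rewrite bop_comp1.
Qed.

Lemma predual_compr f b : predual f -> predual (fun x => f (x ** b)).
Proof.
move=> /(predual_comp (bop_id H) b) h.
have -> // : (fun x => f (x ** b)) = fun x => f (bop_id H ** x ** b).
by apply/funext => x; rewrite bop_1comp.
Qed.

End nuclear.

End predual.

Section normality.
Variables (R : realType) (H K : hilbertType R) (T : hilbert_tensor H K).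
Local Notation C := (cplx R).
Local Notation tn := (tensor T).

Lemma slice_vec (v : T) (y : K) : exists w : H, forall x, '[tn x y, v] = '[x, w].
Proof.
apply: (@riesz _ _ _ (rnorm y * rnorm v)) => [c x x'|x].
  by rewrite tensorDl tensorZl innerDl innerZl.
rewrite (le_trans (cauchy_schwarz _ _))// rnorm_tensor le_eqVlt; apply/orP; left.
by apply/eqP; ring.
Qed.

(** The vector w = sum_k eta_k (x) e_k is the projection of v onto H (x) span(e_k); hence <w, v> =
    |w|^2, and Cauchy-Schwarz gives |w| <= |v|. *)
Lemma slice_bessel m e (eta : nat -> H) (v : T) : onb m e ->
  (forall k, (k < m)%N -> forall x, '[tn x (e k), v] = '[x, eta k]) ->
  \sum_(k < m) rnorm (eta k) ^+ 2 <= rnorm v ^+ 2.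
Proof.
move=> he hv; set S := \sum_(k < m) _.
pose w := \sum_(k < m) tn (eta k) (e k).
have Sw : rnorm w ^+ 2 = S by rewrite (norm_onb T eta he).
have wv : '[w, v] = rc S.
  by rewrite inner_suml rc_sum; apply: eq_bigr => k _; rewrite hv// innerxx.
have S0 : 0 <= S by rewrite -Sw sqr_ge0.
have := cauchy_schwarz w v; rewrite wv rnorm_real ger0_norm// -Sw => h.
have [w0|wn0] := eqVneq (rnorm w) 0; first by rewrite w0 expr0n sqr_ge0.
have w_gt0 : 0 < rnorm w by rewrite lt_def wn0 rnorm_ge0.
move: h; rewrite expr2 ler_pM2l// => h.
by rewrite -expr2 ler_pXn2r// ?nnegrE ?rnorm_ge0.
Qed.

(** Along an orthonormal family the functional is sum_k <a xi_k, eta_k>. Replacing xi_k by xi_k / t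
    and eta_k by t eta_k leaves it unchanged and balances a small [elt T l] against a fixed [v]. *)
Lemma nuc_amp_alg (l : seq (H * K)) (v : T) (t c : R) : 0 < t ->
  rnorm (elt T l) ^+ 2 <= c * t ^+ 2 -> t ^+ 2 * rnorm v ^+ 2 <= c ->
  nuc c (fun a : 'B(H) => '[tensor_op T a (bop_id K) (elt T l), v]).
Proof.
move=> t0 hl hv.
have [m [e [he hs]]] := gram_schmidt (unzip2 l).
have {}hs p : p \in l -> fixed m e p.2 by move=> pl; apply: hs; exact: map_f.
have /choice[eta heta] : forall k, exists w, forall x, '[tn x (e k), v] = '[x, w].
  by move=> k; exact: slice_vec.
pose xi k := \sum_(p <- l) '[p.2, e k] *: p.1.
have lE : elt T l = \sum_(k < m) tn (xi k) (e k) by rewrite (elt_onb T hs).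
have -> : (fun a : 'B(H) => '[tensor_op T a (bop_id K) (elt T l), v]) =
    pairing (fun k => rc t^-1 *: xi k) (fun k => rc t *: eta k) m.
  apply/funext => a; rewrite lE bop_sum inner_suml; apply: eq_bigr => k _.
  rewrite tensor_opE bop_idE heta bopZ innerZl innerZr mulrA.
  have -> : Num.conj (rc t) = rc t by apply: conj_Creal; rewrite ger0_real// -rc0 rc_le ltW.
  by rewrite -rcM mulVf ?gt_eqF// rc1 mul1r.
apply: nuc_finite.
  have -> : \sum_(k < m) rnorm (rc t^-1 *: xi k) ^+ 2 = t^-1 ^+ 2 * rnorm (elt T l) ^+ 2.
    rewrite lE (norm_onb T xi he) mulr_sumr; apply: eq_bigr => k _.
    by rewrite rnormZ rnorm_real exprMn real_normK ?num_real.
  by rewrite exprVn mulrC ler_pdivrMr ?exprn_gt0.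
apply: le_trans hv.
have -> : \sum_(k < m) rnorm (rc t *: eta k) ^+ 2 = t ^+ 2 * \sum_(k < m) rnorm (eta k) ^+ 2.
  rewrite mulr_sumr; apply: eq_bigr => k _.
  by rewrite rnormZ rnorm_real exprMn real_normK ?num_real.
rewrite ler_wpM2l ?sqr_ge0//; apply: (slice_bessel he) => k _; exact: heta.
Qed.

Lemma elt_sub l l' : exists l'', elt T l'' = elt T l - elt T l'.
Proof.
exists (l ++ [seq (- p.1, p.2) | p <- l']).
rewrite /elt big_cat big_map -sumrN /=; congr (_ + _); apply: eq_bigr => p _.
by rewrite -scaleN1r tensorZl scaleN1r.
Qed.

Lemma geo_sum n : \sum_(m < n) (4^-1 : R) ^+ m <= 2.
Proof.
have h : \sum_(m < n) (4^-1 : R) ^+ m = 4 / 3 * (1 - 4^-1 ^+ n).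
  elim: n => [|n IH]; first by rewrite big_ord0 expr0 subrr mulr0.
  by rewrite big_ord_recr /= IH exprS; field.
have : 0 <= (4^-1 : R) ^+ n by rewrite exprn_ge0 ?invr_ge0 ?ler0n.
rewrite h; lra.
Qed.

(* The vector u is the sum of a series of vectors of the algebraic tensor
   product that converges geometrically. *)
Lemma nuc_amp (u v : T) (b : R) : 0 < b -> rnorm u <= b -> rnorm v <= b ->
  nuc (128 * b ^+ 2) (fun a : 'B(H) => '[tensor_op T a (bop_id K) u, v]).
Proof.
move=> b0 ub vb.
have q0 m : 0 < (4^-1 : R) ^+ m by rewrite exprn_gt0 ?invr_gt0 ?ltr0n.
have /choice[s hs] : forall m, exists l, rnorm (elt T l - u) <= b * 4^-1 ^+ m.
  by move=> m; apply: alg_dense; rewrite mulr_gt0.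
have /choice[d hd] : forall m, exists l, elt T l = elt T (s m.+1) - elt T (s m).
  by move=> m; exact: elt_sub.
pose us m := if m is m'.+1 then d m' else s 0%N.
have sumus n : \sum_(m < n.+1) elt T (us m) = elt T (s n).
  elim: n => [|n IH]; first by rewrite big_ord1.
  by rewrite big_ord_recr IH /= hd addrC subrK.
(* The term of index 0 is at most 2 b, and the increment of index m + 1 at most 5 b 4^-(m + 1); the
   constant 8 covers both. *)
have usB m : rnorm (elt T (us m)) <= 8 * b * 4^-1 ^+ m.
  case: m => [|m] /=.
    have := hs 0%N; have := rnormD (elt T (s 0%N) - u) u; rewrite subrK expr0; lra.
  rewrite hd (le_trans (rnorm_triangle u _ _))// [rnorm (u - _)]rnormB.
  have := hs m; have := hs m.+1; rewrite exprS; have := mulr_gt0 b0 (q0 m); nra.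
(* With t = 2^-m, |us_m|^2 <= 64 b^2 16^-m = c_m t^2 and t^2 |v|^2 <= 4^-m b^2 <= c_m; the c_m add
   up to at most 128 b^2. *)
pose c m := 64 * b ^+ 2 * (4^-1 : R) ^+ m.
have hc m : nuc (c m) (fun a : 'B(H) => '[tensor_op T a (bop_id K) (elt T (us m)), v]).
  apply: (@nuc_amp_alg _ _ (2^-1 ^+ m)); first by rewrite exprn_gt0 ?invr_gt0 ?ltr0n.
    have -> : c m * (2^-1 ^+ m) ^+ 2 = (8 * b * 4^-1 ^+ m) ^+ 2.
      have -> : ((2^-1 : R) ^+ m) ^+ 2 = 4^-1 ^+ m.
        by rewrite -exprM mulnC exprM; congr (_ ^+ m); field.
      rewrite /c; ring.
    by rewrite ler_pXn2r ?nnegrE ?rnorm_ge0// !mulr_ge0// ltW.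
  have -> : ((2^-1 : R) ^+ m) ^+ 2 = 4^-1 ^+ m.
    by rewrite -exprM mulnC exprM; congr (_ ^+ m); field.
  rewrite /c mulrC ler_wpM2r ?(ltW (q0 m))//.
  have : rnorm v ^+ 2 <= b ^+ 2 by rewrite ler_pXn2r ?nnegrE ?rnorm_ge0// ltW.
  have := sqr_ge0 b; lra.
have cB n : \sum_(m < n) c m <= 128 * b ^+ 2.
  by rewrite -mulr_sumr; have := geo_sum n; have := sqr_ge0 b; nra.
have [f nf hf] := nuc_series hc cB.
have -> // : (fun a : 'B(H) => '[tensor_op T a (bop_id K) u, v]) = f.
apply/funext => a; apply: limit_unique _ (hf a) => e e0.
have q_lim : rlimit (fun m => (4^-1 : R) ^+ m) 0.
  move=> x x0; have [N hN] := rlimit_inv x0; exists N => n /hN; apply: le_trans.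
  rewrite !subr0 !ger0_norm ?invr_ge0 ?(ltW (q0 n))// exprVn lef_pV2 ?posrE ?exprn_gt0//.
  rewrite -natrX ler_nat; exact: ltn_expl.
have [N hN] := limit_inner (limit_bop (tensor_op T a (bop_id K))
  (limit_dom (ltW b0) q_lim hs)) (limit_cst v) e0.
exists N.+1 => -[//|n] Nn; have := hN n Nn.
by rewrite -sumus bop_sum inner_suml.
Qed.

(** This is weak* continuity of a |-> a (x) 1: each term of [h] is nuclear in a by [nuc_amp], and
    the bounds are summable. *)
Lemma predual_amp (h : 'B(T) -> C) : predual h ->
  predual (fun a => h (tensor_op T a (bop_id K))).
Proof.
move=> /predualP[c [xi [eta [h1 h2 hh]]]]; apply/predualP.
(* The summand 4^-n keeps the bounds positive, as [nuc_amp] requires, and adds at most 2 to their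
   sum. *)
pose a n := rnorm (xi n) ^+ 2 + rnorm (eta n) ^+ 2 + (4^-1 : R) ^+ n.
have q0 m : 0 < (4^-1 : R) ^+ m by rewrite exprn_gt0 ?invr_gt0 ?ltr0n.
have a0 n : 0 < a n.
  by have := q0 n; have := sqr_ge0 (rnorm (xi n)); have := sqr_ge0 (rnorm (eta n)); rewrite /a; lra.
have hn n : nuc (128 * a n) (fun z : 'B(H) => '[tensor_op T z (bop_id K) (xi n), eta n]).
  have -> : a n = Num.sqrt (a n) ^+ 2 by rewrite sqr_sqrtr// ltW.
  have q := q0 n; have X := sqr_ge0 (rnorm (xi n)); have Y := sqr_ge0 (rnorm (eta n)).
  apply: nuc_amp; first by rewrite sqrtr_gt0.
    by rewrite -[leLHS]ger0_norm ?rnorm_ge0// -sqrtr_sqr ler_wsqrtr// /a; lra.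
  by rewrite -[leLHS]ger0_norm ?rnorm_ge0// -sqrtr_sqr ler_wsqrtr// /a; lra.
have [|f nf hf] := nuc_series (b := 128 * (c + c + 2)) hn.
  move=> n; rewrite -mulr_sumr ler_wpM2l// !big_split /= !lerD ?geo_sum//.
  exact: h1.
  exact: h2.
exists (128 * (c + c + 2)); have -> // : (fun z => h (tensor_op T z (bop_id K))) = f.
apply/funext => z; apply: limit_unique (hh _) (hf z).
Qed.

(** The functional is the iterated series of <x (xi_i (x) xi'_j), eta_i (x) eta'_j>: for fixed i the
    inner series is nuclear with bound [k i], and these bounds are summable. *)
Lemma tensor_fun_exists (f : 'B(H) -> C) (g : 'B(K) -> C) : predual f -> predual g ->
  exists h : 'B(T) -> C, predual h /\ forall a b, h (tensor_op T a b) = f a * g b.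
Proof.
move=> /predualP[c [xi [eta [h1 h2 hf]]]] /predualP[c' [xi' [eta' [h1' h2' hg]]]].
have c'0 := sq_le_ge0 h1'.
pose k i := (rnorm (xi i) ^+ 2 + rnorm (eta i) ^+ 2) * c'.
have sq i (u : H) (w : nat -> K) : rnorm u ^+ 2 <= rnorm (xi i) ^+ 2 + rnorm (eta i) ^+ 2 ->
    sq_le c' w -> sq_le (k i) (fun j => tn u (w j)).
  move=> hu hw n; apply: (@le_trans _ _ (rnorm u ^+ 2 * \sum_(j < n) rnorm (w j) ^+ 2)).
    by rewrite mulr_sumr; apply: ler_sum => j _; rewrite rnorm_tensor exprMn.
  by rewrite ler_pM ?sqr_ge0 ?sumr_ge0// => j _; rewrite sqr_ge0.
have /choice[h hh] : forall i, exists h : 'B(T) -> C, forall x,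
    limit (fun n => pairing (fun j => tn (xi i) (xi' j)) (fun j => tn (eta i) (eta' j)) n x : C^o)
      (h x).
  move=> i; apply: (@nuc_exists _ _ (k i)); apply: sq => //.
    by rewrite lerDl sqr_ge0.
  by rewrite lerDr sqr_ge0.
have nh i : nuc (k i) (h i).
  exists (fun j => tn (xi i) (xi' j)), (fun j => tn (eta i) (eta' j)).
  split => //; apply: sq => //; rewrite ?lerDl ?lerDr sqr_ge0//.
have [|F nF hF] := nuc_series (b := (c + c) * c') nh.
  move=> n; rewrite -mulr_suml ler_wpM2r// big_split /= lerD//; [exact: h1|exact: h2].
exists F; split=> [|a b]; first by apply/predualP; exists ((c + c) * c').
apply: limit_unique (hF _) _.
have hab i : h i (tensor_op T a b) = '[a (xi i), eta i] * g b.
  apply: limit_unique (hh i _) _.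
  have -> : (fun n => pairing (fun j => tn (xi i) (xi' j)) (fun j => tn (eta i) (eta' j)) n
      (tensor_op T a b)) = fun n => '[a (xi i), eta i] *: (pairing xi' eta' n b : C^o).
    apply/funext => n; rewrite /pairing scaler_sumr; apply: eq_bigr => j _.
    by rewrite tensor_opE inner_tensor.
  exact: (@limitZ _ C^o).
have -> : (fun n => \sum_(m < n) h m (tensor_op T a b)) =
    fun n => g b *: (pairing xi eta n a : C^o).
  apply/funext => n; rewrite /pairing scaler_sumr; apply: eq_bigr => j _.
  by rewrite hab mulrC.
rewrite [f a * _]mulrC; exact: (@limitZ _ C^o).
Qed.

Lemma tensor_funP (f : 'B(H) -> C) (g : 'B(K) -> C) : predual f -> predual g ->
  predual (tensor_fun T f g) /\ forall a b, tensor_fun T f g (tensor_op T a b) = f a * g b.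
Proof.
move=> pf pg; exact: (getPex (tensor_fun_exists pf pg)).
Qed.

End normality.

Lemma predual_ampr (R : realType) (H K : hilbertType R) (T : hilbert_tensor H K)
    (h : 'B(T) -> cplx R) : predual h -> predual (fun b => h (tensor_op T (bop_id H) b)).
Proof.
move=> ph; have := @predual_amp R K H (flip T) h ph.
by under eq_fun do rewrite tensor_op_flip.
Qed.

(** * Weak* density and slice maps *)

Section weakstar.
Variables (R : realType) (H : hilbertType R).
Local Notation C := (cplx R).
Implicit Types (f g : 'B(H) -> C) (A : set 'B(H)).

Lemma predual_continuous f : predual f -> continuous (f : weakstar H -> C).
Proof.
move=> pf x; pose i : set_type (@predual R H) := SigSub (mem_set pf).
have -> : f = (fun v : {ptws set_type (@predual R H) -> C} => v i) \o @weakstar_eval R H.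
  by apply/funext => y; rewrite /weakstar_eval.
apply: continuous_comp; first exact: initial_continuous.
exact: (@proj_continuous _ (fun=> C)).
Qed.

(** The topology is initial for the evaluation into a product, and the product topology is a
    supremum of initial ones; both layers are unfolded here. *)
Lemma weakstar_cvg (F : set_system (weakstar H)) (x : weakstar H) : Filter F ->
  (forall f, predual f -> f y @[y --> F] --> f x) -> F --> x.
Proof.
move=> FF h.
have hev : (@weakstar_eval R H) @ F --> (weakstar_eval x : {ptws _ -> C}).
  apply/cvg_sup => i; apply/cvg_image.
    by rewrite eqEsubset; split=> v // _; exists (cst v).
  move=> W /= hW; exists [set v : {ptws set_type (@predual R H) -> C} | W (v i)].
    exact: (h _ (set_valP i) W hW).
  by rewrite eqEsubset; split=> [_ [v hv <-]//|c Wc]; exists (fun=> c).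
move=> A /= [_ [[B Bop <-] Bx sBA]].
have FB : F ((@weakstar_eval R H) @^-1` B) by apply: (hev B); exact: open_nbhs_nbhs.
by apply: filterS FB => y; exact: sBA.
Qed.

Lemma weakstar_closure_filter (F : set_system 'B(H)) A (x : 'B(H)) : ProperFilter F ->
  F A -> (forall f, predual f -> f y @[y --> F] --> f x) -> weakstar_closure A x.
Proof.
move=> PF FA /(@weakstar_cvg F x _) Fx B /Fx FB.
by have [y [Ay By]] := filter_ex (filterI FA (FB : F B)); exists y.
Qed.

Lemma predual_eq_closure f g A : predual f -> predual g ->
  (forall a, A a -> f a = g a) -> forall x, weakstar_closure (lspan A) x -> f x = g x.
Proof.
move=> pf pg fg x hx.
have fgs y : lspan A y -> f y = g y.
  move=> [n [c [a [Aa ->]]]]; rewrite !predual_sum//; apply: eq_bigr => i _.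
  have lin h : predual h -> h (c i *: a i) = c i * h (a i).
    by move=> ph; have := predual_linear (c i) (a i) 0 ph; rewrite addr0 predual0// addr0.
  by rewrite !lin// fg.
apply/eqP; rewrite -subr_eq0; apply/eqP; apply: (@rnorm_eq0 R C^o).
apply: (@small_eq0 _ 2) => //; first exact: rnorm_ge0.
move=> e e0.
have ec : 0 < rc e by rewrite -rc0 rc_lt.
have cf : continuous (f : weakstar H -> C) by exact: predual_continuous.
have cg : continuous (g : weakstar H -> C) by exact: predual_continuous.
have /(@cvgrPdist_le C C^o) /(_ _ ec) nf := cf x.
have /(@cvgrPdist_le C C^o) /(_ _ ec) ng := cg x.
have [y [/fgs ey []]] := hx _ (filterI nf ng).
rewrite /= !(@rnormE R C^o) !rc_le ey => h1 h2.
have := rnorm_triangle (g y : C^o) (f x) (g x); rewrite [rnorm (g y - g x)]rnormB; lra.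
Qed.

End weakstar.

Lemma lspan_sum (C : numClosedFieldType) (V : lmodType C) (A : set V) (I : finType)
  (F : I -> V) : (forall i, A (F i)) -> lspan A (\sum_i F i).
Proof.
move=> h; exists #|I|, (fun=> 1), (fun i => F (enum_val i)); split => //.
by rewrite big_enum_val; apply: eq_bigr => i _; rewrite scale1r.
Qed.

Section density.
Variables (R : realType) (H K : hilbertType R) (T : hilbert_tensor H K).
Local Notation C := (cplx R).
Local Notation tn := (tensor T).

Lemma proj_exists m e : onb m e -> exists2 q : 'B(K),
  (forall y, q y = \sum_(k < m) '[y, e k] *: e k) & bounded_by 1 q.
Proof.
move=> he; apply: bop_of => [c y y'|y].
  rewrite scaler_sumr -big_split; apply: eq_bigr => k _ /=.
  by rewrite innerDl innerZl scalerDl scalerA.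
rewrite mul1r -(@ler_pXn2r _ 2)// ?nnegrE ?rnorm_ge0//.
apply: le_trans (onb_bessel y he).
rewrite le_eqVlt; apply/orP; left; apply/eqP/rc_inj.
rewrite -innerxx rc_sum inner_suml; apply: eq_bigr => k _.
rewrite innerZl inner_sumr (bigD1 k)//= innerZr he// eqxx mulr1.
rewrite big1 ?addr0 => [|i ik].
  by rewrite rcX -rnormE normCK.
by rewrite innerZr he// eq_sym (inj_eq val_inj) (negbTE ik) mulr0.
Qed.

Lemma rank1_exists (e e' : K) : exists t : 'B(K), forall y, t y = '[y, e] *: e'.
Proof.
have [||t ht _] := @bop_of _ K K (fun y => '[y, e] *: e') (rnorm e * rnorm e').
- by move=> c y y' /=; rewrite innerDl innerZl scalerDl scalerA.
- move=> y; rewrite rnormZ; have := cauchy_schwarz y e.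
  move=> /(ler_wpM2r (rnorm_ge0 e'))/le_trans; apply.
  by rewrite le_eqVlt; apply/orP; left; apply/eqP; ring.
by exists t.
Qed.

Lemma slice_op (z : 'B(T)) (y y' : K) : exists a : 'B(H),
  forall x x', '[a x, x'] = '[z (tn x y), tn x' y'].
Proof.
have [d d0 hd] := bop_bounded z.
have [| | |//|a [ha _]] := @form_bop _ H H (fun x x' => '[z (tn x y), tn x' y'])
  (d * rnorm y * rnorm y').
- by move=> c x x' w; rewrite tensorDl tensorZl bop_linear innerDl innerZl.
- by move=> c x w w'; rewrite tensorDl tensorZl innerDr innerZr.
- move=> x x'; rewrite (le_trans (cauchy_schwarz _ _))//.
  have := ler_wpM2r (rnorm_ge0 (tn x' y')) (hd (tn x y)); move/le_trans; apply.
  by rewrite !rnorm_tensor le_eqVlt; apply/orP; left; apply/eqP; ring.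
- by rewrite !mulr_ge0 ?rnorm_ge0.
by exists a.
Qed.

(* Finite orthonormal families, directed by the finite sets that they span. *)
Definition onb_filter : set_system (nat * (nat -> K)) := [set P | exists s : seq K,
  forall m e, onb m e -> (forall y, y \in s -> fixed m e y) -> P (m, e)].

Lemma onb_filter_proper : ProperFilter onb_filter.
Proof.
apply: Build_ProperFilter_ex.
  move=> P [s hs]; have [m [e [he es]]] := gram_schmidt s.
  by exists (m, e); exact: hs.
split=> [|P Q [s hs] [t ht]|P Q PQ [s hs]].
- by exists [::].
- exists (s ++ t) => m e he h; split; [apply: hs|apply: ht] => // y ys;
    by apply: h; rewrite mem_cat ys ?orbT.
- by exists s => m e he h; apply: PQ; exact: hs.
Qed.

(** The compressions of z by 1 (x) q, with q the projection onto the span of a finite orthonormal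
    family, are finite sums of slices tensored with rank one operators, and they tend to z in the
    weak* topology. A filter replaces a sequence because K may be non-separable. *)
Lemma slice_dense (A : set 'B(H)) (z : 'B(T)) :
  (forall y y' (a : 'B(H)),
     (forall x x', '[a x, x'] = '[z (tn x y), tn x' y']) -> A a) ->
  vn_tensor T A setT z.
Proof.
move=> hA; have PF := onb_filter_proper.
have [d d0 hd] := bop_bounded z.
have /choice[q hq] : forall p : nat * (nat -> K), exists q : 'B(K), onb p.1 p.2 ->
    (forall y, q y = \sum_(k < p.1) '[y, p.2 k] *: p.2 k) /\ bounded_by 1 q.
  move=> [m e]; have [he|nhe] := pselect (onb m e); last by exists 0.
  by have [q h1 h2] := proj_exists he; exists q.
pose P p := tensor_op T (bop_id H) (q p).
pose w p := P p ** z ** P p.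
have onbF : onb_filter (fun p => onb p.1 p.2) by exists [::].
have P1 p : onb p.1 p.2 -> bounded_by 1 (P p).
  move=> /hq[_ bq]; rewrite -[1]mulr1; apply: tensor_op_bounded => // x.
  by rewrite mul1r.
have adjq p y y' : onb p.1 p.2 -> '[q p y, y'] = '[y, q p y'].
  move=> /hq[qE _]; rewrite !qE inner_suml inner_sumr; apply: eq_bigr => k _.
  by rewrite innerZl innerZr inner_conj mulrC.
have adjP p u v : onb p.1 p.2 -> '[P p u, v] = '[u, P p v].
  move=> he; rewrite adjE tensor_op_adj.
  have -> : adj (bop_id H) = bop_id H by apply/esym/adj_unique.
  have -> // : adj (q p) = q p by apply/esym/adj_unique => y y'; exact: adjq.
(* The contractions 1 (x) q tend strongly to 1, since they fix an algebraic vector as soon as q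
   fixes its second legs. *)
have fix_alg u (e : R) : 0 < e -> onb_filter (fun p => rnorm (P p u - u) <= e).
  move=> e0; have [l hl] := @alg_dense _ _ _ T u (e / 2) ltac:(lra).
  exists (unzip2 l) => m b hb hl'.
  have Pl : P (m, b) (elt T l) = elt T l.
    rewrite bop_sum /elt big_seq [RHS]big_seq; apply: eq_bigr => -[x y] pl.
    have yl : y \in unzip2 l by apply: (map_f snd pl).
    rewrite tensor_opE bop_idE; congr (tn _ _).
    by have [-> _] := hq (m, b) hb; rewrite /= -(hl' _ yl).
  rewrite -[u in X in rnorm (X - _)](subKr (elt T l)) bopB Pl.
  have := rnorm_triangle (elt T l) (elt T l - P (m, b) (elt T l - u)) u.
  rewrite -[X in rnorm (X - elt T l)]addrC addrK rnormN.
  have := P1 (m, b) hb (elt T l - u); rewrite mul1r; lra.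
apply: (@weakstar_closure_filter _ _ (w @ onb_filter)).
- apply: filterS onbF => -[m e] /= he.
  have /choice[zs hzs] : forall k : nat * nat, exists a : 'B(H),
      forall x x', '[a x, x'] = '[z (tn x (e k.1)), tn x' (e k.2)].
    by move=> k; exact: slice_op.
  have /choice[th hth] : forall k : nat * nat, exists t : 'B(K),
      forall y, t y = '[y, e k.1] *: e k.2.
    by move=> k; exact: rank1_exists.
  (* The coefficient of the matrix unit y |-> <y, e_i> e_j is the slice of z along (e_i, e_j). *)
  pose F (k : 'I_m * 'I_m) := tensor_op T (zs (val k.1, val k.2)) (th (val k.1, val k.2)).
  have -> : w (m, e) = \sum_k F k.
    apply: bop_tensor_ext => x y; apply: inner_tensor_ext => x' y'.
    have [qE _] := hq (m, e) he.
    rewrite /w !bop_compE adjP// !tensor_opE !bop_idE !qE /=.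
    rewrite sum_bopE inner_suml tensor_sumr bop_sum inner_suml.
    rewrite -(pair_bigA _ (fun i j : 'I_m => '[F (i, j) (tn x y), tn x' y'])) /=.
    apply: eq_bigr => i _; rewrite tensor_sumr inner_sumr; apply: eq_bigr => j _.
    rewrite /F tensor_opE inner_tensor hzs hth /= !tensorZr bopZ !innerZl !innerZr.
    rewrite inner_conj; ring.
  apply: lspan_sum => -[i j]; exists (zs (val i, val j)).
    by apply: hA => x x'; rewrite hzs.
  by exists (th (val i, val j)).
- move=> f /predualP[c [xi [eta [h1 h2 hf]]]].
  apply/(@cvgrPdist_le C C^o) => r r0.
  have r0' : 0 < complex.Re r by rewrite -rc_lt ge0_ReK// ltW.
  set e := complex.Re r in r0'.
  (* The remainder of [f] is at most e / 4 on z and on each compression, all bounded by [d]; the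
     finite part gets e / 2. *)
  pose e1 := e / (4 * (d + 1)).
  have e10 : 0 < e1 by rewrite divr_gt0// mulr_gt0//; lra.
  have [N hN] := nuc_tail h1 h2 hf e10.
  have wB p : onb p.1 p.2 -> bounded_by d (w p).
    move=> he; rewrite -[d]mulr1 -[d]mul1r.
    apply: bounded_by_comp; [lra| |exact: P1].
    by apply: bounded_by_comp; [exact: ler01|exact: P1|].
  have rank1_lim u v (b : R) : 0 < b ->
      onb_filter (fun p => rnorm ('[w p u, v] - '[z u, v] : C^o) <= b).
    move=> b0; have nu := rnorm_ge0 u; have nv := rnorm_ge0 v.
    pose k := (d + 1) * (rnorm u + rnorm v + 1).
    have k0 : 0 < k by rewrite mulr_gt0//; lra.
    have bk : 0 < b / k by rewrite divr_gt0.
    apply: filterS (filterI onbF (filterI (fix_alg u _ bk) (fix_alg v _ bk))).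
    move=> p [he [hu hv]].
    have -> : '[w p u, v] - '[z u, v] = '[z (P p u - u), P p v] + '[z u, P p v - v].
      by rewrite /w !bop_compE adjP// bopB innerBl innerBr; ring.
    rewrite (le_trans (rnormD (_ : C^o) _))//.
    have t1 := cauchy_schwarz (z (P p u - u)) (P p v).
    have t2 := cauchy_schwarz (z u) (P p v - v).
    have t3 := hd (P p u - u); have t4 := hd u; have t5 := P1 p he v.
    rewrite mul1r in t5.
    have s1 : rnorm (z (P p u - u)) * rnorm (P p v) <= d * (b / k) * rnorm v.
      rewrite ler_pM ?rnorm_ge0//; apply: (le_trans t3); exact: ler_wpM2l.
    have s2 : rnorm (z u) * rnorm (P p v - v) <= d * rnorm u * (b / k).
      by rewrite ler_pM ?rnorm_ge0.
    have bE : b = k * (b / k) by rewrite mulrC divfK ?gt_eqF.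
    have s3 : d * (rnorm u + rnorm v) * (b / k) <= k * (b / k).
      rewrite ler_wpM2r ?(ltW bk)// /k ler_pM ?addr_ge0//; lra.
    by rewrite -bE in s3; lra.
  have fin M (b : R) : 0 < b ->
      onb_filter (fun p => rnorm (pairing xi eta M (w p) - pairing xi eta M z : C^o) <= b).
    elim: M b => [|M IH] b b0.
      by apply: filterS onbF => p _; rewrite /pairing !big_ord0 subrr rnorm0 ltW.
    have b2 : 0 < b / 2 by rewrite divr_gt0.
    apply: filterS (filterI (IH _ b2) (rank1_lim (xi M) (eta M) _ b2)).
    move=> p [] p1 p2; rewrite /pairing !big_ord_recr /= -/(pairing xi eta M _).
    rewrite -/(pairing xi eta M _).
    have -> : pairing xi eta M (w p) + '[w p (xi M), eta M] -
        (pairing xi eta M z + '[z (xi M), eta M]) =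
      (pairing xi eta M (w p) - pairing xi eta M z) +
        ('[w p (xi M), eta M] - '[z (xi M), eta M]) by ring.
    by rewrite (le_trans (rnormD (_ : C^o) _))//; lra.
  have e20 : 0 < e / 2 by rewrite divr_gt0.
  change (onb_filter (fun p => (`|f z - f (w p)| : C) <= r)).
  apply: filterS (filterI onbF (fin N _ e20)) => p [he hp].
  rewrite /= (@rnormE R C^o) -(ge0_ReK (ltW r0)) rc_le -/e.
  have b1 := nuc_bound hN d0 hd; have b2 := nuc_bound hN d0 (wB p he).
  have -> : f z - f (w p) = (f z - pairing xi eta N z) -
     ((f (w p) - pairing xi eta N (w p)) + (pairing xi eta N (w p) - pairing xi eta N z)) by ring.
  have t1 := rnormD (f z - pairing xi eta N z : C^o)
    (- ((f (w p) - pairing xi eta N (w p)) + (pairing xi eta N (w p) - pairing xi eta N z))).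
  have t2 := rnormD (f (w p) - pairing xi eta N (w p) : C^o)
     (pairing xi eta N (w p) - pairing xi eta N z).
  rewrite rnormN in t1.
  have ed : e1 * d <= e / 4.
    have -> : e / 4 = e1 * (d + 1) by rewrite /e1; field; rewrite gt_eqF//; lra.
    by rewrite ler_wpM2l ?(ltW e10)//; lra.
  lra.
Qed.

Lemma vn_tensorT (z : 'B(T)) : vn_tensor T setT setT z.
Proof. exact: slice_dense. Qed.

(** By density of the span of the elementary tensors. It makes the functional chosen by [tensor_fun]
    unique and reduces identities between normal expressions to elementary tensors. *)
Lemma predual_tensor_ext (f g : 'B(T) -> C) : predual f -> predual g ->
  (forall a b, f (tensor_op T a b) = g (tensor_op T a b)) -> forall x, f x = g x.
Proof.
move=> pf pg fg x; apply: (@predual_eq_closure _ _ f g _ pf pg _ x (@vn_tensorT x)).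
by move=> _ [a _ [b _ <-]].
Qed.

End density.

Lemma vn_tensor_flip (R : realType) (H K : hilbertType R) (T : hilbert_tensor H K)
    (A : set 'B(H)) (B : set 'B(K)) : vn_tensor (flip T) B A = vn_tensor T A B.
Proof.
congr weakstar_closure; congr lspan; apply/seteqP; split=> _ [a Aa [b Bb <-]];
  by exists b => //; exists a => //; rewrite tensor_op_flip.
Qed.

Lemma slice_dense_flip (R : realType) (H K : hilbertType R) (T : hilbert_tensor H K)
    (A : set 'B(K)) (z : 'B(T)) :
  (forall x x' (b : 'B(K)),
     (forall y y', '[b y, y'] = '[z (tensor T x y), tensor T x' y']) -> A b) ->
  vn_tensor T setT A z.
Proof. by move=> h; rewrite -vn_tensor_flip; apply: (@slice_dense R K H (flip T)). Qed.

Section slices.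
Variables (R : realType) (H K : hilbertType R) (T : hilbert_tensor H K).
Local Notation C := (cplx R).
Local Notation tn := (tensor T).

Lemma tensor_fun_unique (f : 'B(H) -> C) (g : 'B(K) -> C) (h : 'B(T) -> C) :
  predual f -> predual g -> predual h ->
  (forall a b, h (tensor_op T a b) = f a * g b) -> tensor_fun T f g = h.
Proof.
move=> pf pg ph hE; have [pt tE] := tensor_funP T pf pg.
by apply/funext; apply: predual_tensor_ext => // a b; rewrite tE hE.
Qed.

Lemma tensor_fun_rank1 (x x' : H) (y y' : K) :
  tensor_fun T (fun a => '[a x, x']) (fun b => '[b y, y']) =
  (fun z => '[z (tn x y), tn x' y']).
Proof.
apply: tensor_fun_unique; try exact: predual_rank1.
by move=> a b; rewrite tensor_opE inner_tensor.
Qed.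

(** The right slice along a vector functional, from which slices along general normal functionals
    are built. *)
Definition slice (z : 'B(T)) (y y' : K) : 'B(H) :=
  get [set a : 'B(H) | forall x x', '[a x, x'] = '[z (tn x y), tn x' y']].

Lemma sliceE z y y' x x' : '[slice z y y' x, x'] = '[z (tn x y), tn x' y'].
Proof. exact: (getPex (slice_op z y y')). Qed.

Lemma slice_unique (z : 'B(T)) y y' (a : 'B(H)) :
  (forall x x', '[a x, x'] = '[z (tn x y), tn x' y']) ->
  a = slice z y y'.
Proof. by move=> h; apply: bop_inner_ext => x x'; rewrite h sliceE. Qed.

Lemma slice_bounded (z : 'B(T)) (y y' : K) d : 0 <= d -> bounded_by d z ->
  bounded_by (d * rnorm y * rnorm y') (slice z y y').
Proof.
move=> d0 hd; apply: bounded_by_form => [|x x']; first by rewrite !mulr_ge0 ?rnorm_ge0.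
rewrite sliceE (le_trans (cauchy_schwarz _ _))//.
have := ler_wpM2r (rnorm_ge0 (tn x' y')) (hd (tn x y)); move/le_trans; apply.
by rewrite !rnorm_tensor le_eqVlt; apply/orP; left; apply/eqP; ring.
Qed.

Lemma slice_linearl (z : 'B(T)) c y1 y2 y' :
  slice z (c *: y1 + y2) y' = c *: slice z y1 y' + slice z y2 y'.
Proof.
apply/esym/slice_unique => x x'.
by rewrite add_bopE scale_bopE innerDl innerZl !sliceE tensorDr tensorZr bop_linear
  innerDl innerZl.
Qed.

Lemma slice_linearr (z : 'B(T)) c y y1 y2 :
  slice z y (c *: y1 + y2) = Num.conj c *: slice z y y1 + slice z y y2.
Proof.
apply/esym/slice_unique => x x'.
by rewrite add_bopE scale_bopE innerDl innerZl !sliceE tensorDr tensorZr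
  innerDr innerZr.
Qed.

Lemma slice_tensor_op a b y y' : slice (tensor_op T a b) y y' = '[b y, y'] *: a.
Proof.
apply/esym/slice_unique => x x'.
by rewrite scale_bopE innerZl tensor_opE inner_tensor mulrC.
Qed.

(** Tensoring the vectors that represent [f] with [y] and [y'] represents the new functional. *)
Lemma nuc_slice c (f : 'B(H) -> C) (y y' : K) : nuc c f ->
  nuc ((rnorm y ^+ 2 + rnorm y' ^+ 2) * c) (fun z => f (slice z y y')).
Proof.
move=> [xi [eta [h1 h2 hf]]].
have c0 := sq_le_ge0 h1.
have sq (w : K) (u : nat -> H) : rnorm w ^+ 2 <= rnorm y ^+ 2 + rnorm y' ^+ 2 ->
    sq_le c u -> sq_le ((rnorm y ^+ 2 + rnorm y' ^+ 2) * c) (fun i => tn (u i) w).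
  move=> hw hu n; apply: (@le_trans _ _ (rnorm w ^+ 2 * \sum_(j < n) rnorm (u j) ^+ 2)).
    by rewrite mulr_sumr; apply: ler_sum => j _; rewrite rnorm_tensor exprMn mulrC.
  by rewrite ler_pM ?sqr_ge0 ?sumr_ge0// => j _; rewrite sqr_ge0.
exists (fun i => tn (xi i) y), (fun i => tn (eta i) y'); split.
- by apply: sq => //; rewrite lerDl sqr_ge0.
- by apply: sq => //; rewrite lerDr sqr_ge0.
move=> z; have -> : (fun n => pairing (fun i => tn (xi i) y) (fun i => tn (eta i) y') n z) =
    fun n => pairing xi eta n (slice z y y').
  by apply/funext => n; apply: eq_bigr => k _; rewrite sliceE.
exact: hf.
Qed.

(** The form (y, y') |-> f (slice x y y') defines the operator, which settles vector functionals g.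
    A general g is a series of these, and summing over it yields a normal functional on B(T) that is
    f (x) g by uniqueness. *)
Lemma lslice_exists (f : 'B(H) -> C) (x : 'B(T)) : predual f ->
  exists y : 'B(K), forall g, predual g -> g y = tensor_fun T f g x.
Proof.
move=> pf; have [c nf] := (predualP f).1 pf.
have c0 := nuc_ge0 nf.
have [d d0 hd] := bop_bounded x.
have [| | |//|w [hw _]] := @form_bop _ K K (fun y y' => f (slice x y y')) (c * d).
- by move=> r y1 y2 y'; rewrite slice_linearl predual_linear.
- by move=> r y y1 y2; rewrite slice_linearr predual_linear.
- move=> y y'; have := nuc_bound nf _ (slice_bounded y y' d0 hd).
  by rewrite !mulrA; apply; rewrite !mulr_ge0 ?rnorm_ge0.
- by rewrite mulr_ge0.
exists w => g pg; have [c' [xi [eta [h1 h2 hg]]]] := (predualP g).1 pg.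
have [|F nF hF] := nuc_series (b := (c' + c') * c) (fun j => nuc_slice (xi j) (eta j) nf).
  by move=> n; rewrite -mulr_suml ler_wpM2r// big_split lerD.
have -> : tensor_fun T f g = F.
  apply: tensor_fun_unique => //; first by apply/predualP; exists ((c' + c') * c).
  move=> a b; apply: limit_unique (hF _) _.
  have -> : (fun n => \sum_(m < n) f (slice (tensor_op T a b) (xi m) (eta m))) =
      fun n => f a *: (pairing xi eta n b : C^o).
    apply/funext => n; rewrite /pairing scaler_sumr; apply: eq_bigr => j _.
    rewrite slice_tensor_op -[_ *: a]addr0 predual_linear// predual0// addr0.
    by rewrite mulrC.
  exact: (@limitZ _ C^o).
apply: limit_unique (hg w) _.
have -> // : (fun n => pairing xi eta n w) = fun n => \sum_(m < n) f (slice x (xi m) (eta m)).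
by apply/funext => n; apply: eq_bigr => k _; rewrite hw.
Qed.

Lemma lsliceP (f : 'B(H) -> C) (x : 'B(T)) g : predual f -> predual g ->
  g (lslice T f x) = tensor_fun T f g x.
Proof. by move=> pf pg; exact: (getPex (lslice_exists x pf)). Qed.

End slices.

Lemma tensor_fun_flip (R : realType) (H K : hilbertType R) (T : hilbert_tensor H K)
    (f : 'B(H) -> cplx R) (g : 'B(K) -> cplx R) : predual f -> predual g ->
  tensor_fun (flip T) g f = tensor_fun T f g.
Proof.
move=> pf pg; have [pt tE] := tensor_funP T pf pg.
apply: (@tensor_fun_unique R K H (flip T)) => // b a.
by rewrite tensor_op_flip tE mulrC.
Qed.

Section rslice.
Variables (R : realType) (H K : hilbertType R) (T : hilbert_tensor H K).
Local Notation C := (cplx R).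

Lemma rsliceP (g : 'B(K) -> C) (x : 'B(T)) f : predual g -> predual f ->
  f (rslice T g x) = tensor_fun T f g x.
Proof.
move=> pg pf; suff /getPex : exists y : 'B(H), forall f, predual f -> f y = tensor_fun T f g x.
  by apply.
have [y hy] := @lslice_exists R K H (flip T) g x pg.
by exists y => f' pf'; rewrite hy// tensor_fun_flip.
Qed.

Lemma vn_commute (A : set 'B(H)) (B : set 'B(K)) (c z : 'B(T)) : vn_tensor T A B z ->
  (forall a b, A a -> B b -> c ** tensor_op T a b = tensor_op T a b ** c) ->
  c ** z = z ** c.
Proof.
move=> hz hc; apply: bop_inner_ext => u v.
apply: (@predual_eq_closure _ _ (fun z => '[(c ** z) u, v]) (fun z => '[(z ** c) u, v])
  _ _ _ _ z hz).
- exact: (predual_compl c (predual_rank1 u v)).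
- exact: (predual_compr c (predual_rank1 u v)).
- by move=> _ [a Aa [b Bb <-]]; rewrite hc.
Qed.

End rslice.

(** * Reassociation of a triple tensor product *)

Section associator.
Variables (R : realType) (H K L : hilbertType R).
Variables (HK : hilbert_tensor H K) (KL : hilbert_tensor K L) (T : hilbert_tensor HK L).
Local Notation C := (cplx R).
Implicit Types (x : H) (l : seq (K * L)).

(* The space T is also a tensor product of H and KL. *)
Definition assoc_elt x l : T := \sum_(p <- l) tensor T (tensor HK x p.1) p.2.

Lemma inner_assoc_elt x x' l l' :
  '[assoc_elt x l, assoc_elt x' l'] = '[x, x'] * '[elt KL l, elt KL l'].
Proof.
rewrite /assoc_elt /elt !inner_suml mulr_sumr; apply: eq_bigr => p _.
rewrite !inner_sumr mulr_sumr; apply: eq_bigr => q _.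
by rewrite !inner_tensor mulrA.
Qed.

(** On sums of elementary tensors, v |-> x (x) v multiplies norms by |x|, so it extends to the
    completed space. *)
Lemma assoc_exists x : exists z : bop KL T, forall y w,
  z (tensor KL y w) = tensor T (tensor HK x y) w.
Proof.
have [||u e e0|z hz _] := @extend_bop _ KL T
    (fun s t => exists l, s = elt KL l /\ t = assoc_elt x l) (rnorm x) (rnorm_ge0 x).
- move=> c _ _ _ _ [l [-> ->]] [l' [-> ->]].
  exists ([seq (c *: p.1, p.2) | p <- l] ++ l').
  rewrite /elt /assoc_elt !big_cat !big_map !scaler_sumr /=; split; congr (_ + _).
    by apply: eq_bigr => p _; rewrite tensorZl.
  by apply: eq_bigr => p _; rewrite tensorZr tensorZl.
- move=> _ _ [l [-> ->]].
  rewrite -(@ler_pXn2r _ 2)// ?nnegrE ?mulr_ge0 ?rnorm_ge0//.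
  suff -> : rnorm (assoc_elt x l) ^+ 2 = (rnorm x * rnorm (elt KL l)) ^+ 2 by [].
  by apply: rc_inj; rewrite -innerxx inner_assoc_elt !innerxx [in RHS]exprMn [in RHS]rcM.
- have [l hl] := alg_dense u e0.
  by exists (elt KL l), (assoc_elt x l); split => //; exists l.
exists z => y w; apply: hz; exists [:: (y, w)].
by rewrite /elt /assoc_elt !big_seq1.
Qed.

Definition assoc_bop x : bop KL T :=
  get [set z : bop KL T | forall y w, z (tensor KL y w) = tensor T (tensor HK x y) w].

Lemma assoc_bopE x y w : assoc_bop x (tensor KL y w) = tensor T (tensor HK x y) w.
Proof. exact: (getPex (assoc_exists x)). Qed.

Lemma assoc_bop_elt x l : assoc_bop x (elt KL l) = assoc_elt x l.
Proof. by rewrite bop_sum; apply: eq_bigr => p _; rewrite assoc_bopE. Qed.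

Definition assoc_fun (x : H) (v : KL) : T := assoc_bop x v.

Lemma assoc_bilinear : bilinear_for *:%R *:%R assoc_fun.
Proof.
split=> [v c x x'|x c v v'] /=; last exact: bop_linear.
rewrite /assoc_fun -[RHS]/((c *: assoc_bop x + assoc_bop x') v); congr (bop_val _ v).
apply: bop_tensor_ext => y w.
by rewrite add_bopE scale_bopE !assoc_bopE tensorDl tensorZl tensorDl tensorZl.
Qed.

HB.instance Definition _ := bilinear_isBilinear.Build C H KL T *:%R *:%R assoc_fun
  assoc_bilinear.

Lemma assoc_inner x x' v v' : '[assoc_fun x v, assoc_fun x' v'] = '[x, x'] * '[v, v'].
Proof.
have [l hl] := alg_seq v; have [l' hl'] := alg_seq v'.
apply: (limit_unique (limit_inner (limit_bop (assoc_bop x) hl) (limit_bop (assoc_bop x') hl'))).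
have -> : (fun n => '[assoc_bop x (elt KL (l n)), assoc_bop x' (elt KL (l' n))]) =
    fun n => '[x, x'] *: ('[elt KL (l n), elt KL (l' n)] : C^o).
  by apply/funext => n; rewrite !assoc_bop_elt inner_assoc_elt.
exact: (@limitZ _ C^o _ _ _ (limit_inner hl hl')).
Qed.

(** Two approximations: a vector of T by sums of v (x) w with v in HK, then each v by sums of
    elementary tensors of H and K. *)
Lemma assoc_dense : dense (lspan [set assoc_fun x v | x in [set: H] & v in [set: KL]]).
Proof.
pose G := [set assoc_fun x v | x in [set: H] & v in [set: KL]].
have near (u : T) (e : R) : 0 < e -> exists s, lspan G s /\ rnorm (s - u) <= e.
  move=> e0; have [l hl] := alg_dense u (divr_gt0 e0 (ltr0n R 2)).
  have approx (v : HK) (w : L) (d : R) : 0 < d ->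
      exists lv : seq (H * K), rnorm (tensor T (elt HK lv) w - tensor T v w) <= d.
    move=> d0; have w0 : 0 < rnorm w + 1 by have := rnorm_ge0 w; lra.
    have [lv hlv] := alg_dense v (divr_gt0 d0 w0).
    exists lv; have -> : tensor T (elt HK lv) w - tensor T v w = tensor T (elt HK lv - v) w.
      by rewrite -[- tensor T v w]scaleN1r -tensorZl scaleN1r -tensorDl.
    rewrite rnorm_tensor.
    have -> : d = d / (rnorm w + 1) * (rnorm w + 1) by rewrite divfK ?gt_eqF.
    by rewrite ler_pM ?rnorm_ge0// lerDl.
  have [ls hls] : exists ls : seq (H * KL),
      rnorm (\sum_(p <- ls) assoc_fun p.1 p.2 - elt T l) <= e / 2.
    have : 0 < e / 2 by rewrite divr_gt0.
    move: (e / 2) => d; elim: l {hl} d => [|[v w] l IH] d d0.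
      by exists [::]; rewrite /elt !big_nil subrr rnorm0 ltW.
    have d2 : 0 < d / 2 by rewrite divr_gt0.
    have [ls hls] := IH _ d2; have [lv hlv] := approx v w _ d2.
    exists ([seq (p.1, tensor KL p.2 w) | p <- lv] ++ ls).
    rewrite big_cat big_map /elt big_cons /=.
    have -> : \sum_(p <- lv) assoc_fun p.1 (tensor KL p.2 w) = tensor T (elt HK lv) w.
      by rewrite tensor_suml; apply: eq_bigr => p _; rewrite /assoc_fun assoc_bopE.
    rewrite opprD addrACA (le_trans (rnormD _ _))//.
    by have := lerD hlv hls; rewrite -splitr.
  exists (\sum_(p <- ls) assoc_fun p.1 p.2); split.
    rewrite (big_nth (0, 0)) big_mkord; apply: lspan_sum => i.
    by exists (nth (0, 0) ls i).1 => //; exists (nth (0, 0) ls i).2.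
  by rewrite (le_trans (rnorm_triangle (elt T l) _ _))//; have := lerD hls hl; rewrite -splitr.
move=> O [u Ou] oO; have : nbhs u O by apply: open_nbhs_nbhs.
move=> /nbhs_normP[e /= e0 he].
have e0' : 0 < complex.Re e by rewrite -rc_lt ge0_ReK// ltW.
have [s [Gs hs]] := near u (complex.Re e / 2) ltac:(lra).
exists s; split => //; apply: he; rewrite /= rnormE -(ge0_ReK (ltW e0)) rc_lt rnormB; lra.
Qed.

(** As for [flip], the underlying space is unchanged, so operators built from either bracketing can
    be composed. *)
Definition assoc : hilbert_tensor H KL :=
  @HilbertTensor R H KL T (assoc_fun : {bilinear H -> KL -> T}) assoc_inner assoc_dense.

Lemma assoc_tensor_op (a : 'B(H)) (b : 'B(K)) (c : 'B(L)) :
  tensor_op assoc a (tensor_op KL b c) = tensor_op T (tensor_op HK a b) c.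
Proof.
apply: (@bop_tensor_ext R H KL assoc) => x v.
rewrite (tensor_opE assoc); have [l hl] := alg_seq v.
have lim1 := limit_bop (tensor_op T (tensor_op HK a b) c) (limit_bop (assoc_bop x) hl).
have lim2 := limit_bop (assoc_bop (a x)) (limit_bop (tensor_op KL b c) hl).
apply: (limit_unique lim2).
have -> : (fun n => assoc_bop (a x) (tensor_op KL b c (elt KL (l n)))) =
    fun n => tensor_op T (tensor_op HK a b) c (assoc_bop x (elt KL (l n))).
  apply/funext => n; rewrite !bop_sum; apply: eq_bigr => p _.
  by rewrite tensor_opE !assoc_bopE !tensor_opE.
exact: lim1.
Qed.

End associator.

(** * Forms on the normal Haagerup tensor product *)

Section forms.
Variables (R : realType) (H K : hilbertType R).
Local Notation C := (cplx R).
Variables (M : set 'B(H)) (chi : ('B(H) -> 'B(H) -> C) -> C).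
Hypothesis hchi : normal_haagerup M M chi.
Variable rho : 'B(H) -> 'B(K).
Hypothesis rho_linear : linear rho.
Hypothesis rho_normal : forall h, predual h -> predual (fun a => h (rho a)).
Hypothesis rho_mxb : forall n (a : 'I_n -> 'I_n -> 'B(H)) s, mxb a s ->
  mxb (fun i j => rho (a i j)) s.
Implicit Types (h : 'B(K) -> C) (X : 'B(K)) (u v : K).

(** One construction for two uses: [rho] is the identity for [Phi], and a |-> 1 (x) a (x) 1 for the
    operator Z. *)
Definition amp_form h X : 'B(H) -> 'B(H) -> C := fun a b => h (rho a ** X ** rho b).

(** Besides nuclear functionals, this covers vector functionals with the bound |u| |v|. The bound of
    [nuc_rank1] is a sum of squares, whereas a sesquilinear form calls for a product. *)
Definition dual_le (c : R) h := (forall r x y, h (r *: x + y) = r * h x + h y) /\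
  forall (x : 'B(K)) d, 0 <= d -> bounded_by d x -> rnorm (h x : C^o) <= c * d.

Lemma nuc_dual_le c h : nuc c h -> dual_le c h.
Proof. by move=> nh; split=> [r x y|x d]; [exact: nuc_linear nh|exact: nuc_bound]. Qed.

Lemma rank1_dual_le u v : dual_le (rnorm u * rnorm v) (fun x => '[x u, v]).
Proof.
split=> [r x y|x d d0 hd]; first by rewrite add_bopE scale_bopE innerDl innerZl.
rewrite (le_trans (cauchy_schwarz _ _))//.
have := ler_wpM2r (rnorm_ge0 v) (hd u); move/le_trans; apply.
by rewrite le_eqVlt; apply/orP; left; apply/eqP; ring.
Qed.

Lemma dual_le_sum c h (I : Type) (r : seq I) (P : pred I) (F : I -> 'B(K)) : dual_le c h ->
  h (\sum_(i <- r | P i) F i) = \sum_(i <- r | P i) h (F i).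
Proof.
move=> [hl _]; have hD x y : h (x + y) = h x + h y.
  by have := hl 1 x y; rewrite scale1r mul1r.
by apply: (big_morph h) => //; apply: (addrI (h 0)); rewrite -hD !addr0.
Qed.

Lemma dual_leZ c h r x : dual_le c h -> h (r *: x) = r * h x.
Proof.
move=> hc; have [hl _] := hc; rewrite -[r *: x]addr0 hl.
have := @dual_le_sum c h nat [::] xpredT (fun=> 0) hc; rewrite !big_nil => ->.
by rewrite addr0.
Qed.

(** The sum of the squares of B a_i - S b_i equals B (A B - S^2); if B = 0, every b_i vanishes. *)
Lemma real_cauchy_schwarz n (a b : 'I_n -> R) :
  (\sum_i a i * b i) ^+ 2 <= (\sum_i a i ^+ 2) * (\sum_i b i ^+ 2).
Proof.
set A := \sum_i a i ^+ 2; set B := \sum_i b i ^+ 2; set S := \sum_i a i * b i.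
have A0 : 0 <= A by apply: sumr_ge0 => i _; exact: sqr_ge0.
have B0 : 0 <= B by apply: sumr_ge0 => i _; exact: sqr_ge0.
have h : \sum_i (B * a i - S * b i) ^+ 2 = B * (A * B - S ^+ 2).
  have e i : (B * a i - S * b i) ^+ 2 =
      B ^+ 2 * a i ^+ 2 + (- (2 * B * S) * (a i * b i) + S ^+ 2 * b i ^+ 2) by ring.
  by under eq_bigr do rewrite e; rewrite !big_split -!mulr_sumr /= -/A -/B -/S; ring.
have : 0 <= B * (A * B - S ^+ 2) by rewrite -h sumr_ge0// => i _; exact: sqr_ge0.
have [B_eq0|Bn0] := eqVneq B 0; last first.
  by rewrite pmulr_rge0 ?subr_ge0// lt_def Bn0.
move=> _; have -> : S = 0.
  rewrite /S big1// => i _; move: B_eq0 => /eqP.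
  rewrite psumr_eq0 => [/allP/(_ i)|j _]; last exact: sqr_ge0.
  by rewrite mem_index_enum sqrf_eq0 => /(_ isT)/eqP->; rewrite mulr0.
by rewrite expr0n mulr_ge0.
Qed.

(* If w is the image of zeta under the matrix of the values of the form, then
   |w|^2 = h Y for an operator Y whose norm is controlled by |w|, |zeta| and the
   norms of a, X and b. *)
Lemma amp_form_mx n (a b : 'I_n -> 'I_n -> 'B(H)) h X c d s t (zeta : 'I_n -> C) :
  0 <= c -> dual_le c h -> 0 <= d -> bounded_by d X -> 0 <= s -> 0 <= t ->
  mxb a s -> mxb b t ->
  \sum_(i < n) rnorm (\sum_(j < n) (\sum_(l < n) amp_form h X (a i l) (b l j)) * zeta j : C^o) ^+ 2
    <= (c * d * (s * t)) ^+ 2 * \sum_(j < n) rnorm (zeta j : C^o) ^+ 2.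
Proof.
move=> c0 hc d0 hd s0 t0 ha hb.
set A := \sum_(j < n) rnorm (zeta j : C^o) ^+ 2.
pose w i := \sum_(j < n) (\sum_(l < n) amp_form h X (a i l) (b l j)) * zeta j.
pose B := \sum_(i < n) rnorm (w i : C^o) ^+ 2; change (B <= (c * d * (s * t)) ^+ 2 * A).
have A0 : 0 <= A by apply: sumr_ge0 => i _; exact: sqr_ge0.
have B0 : 0 <= B by apply: sumr_ge0 => i _; exact: sqr_ge0.
(* The weights conj(w_i) zeta_j are chosen such that h Y = sum_i |w_i|^2. *)
pose Y : 'B(K) := \sum_(i < n) \sum_(j < n) \sum_(l < n)
  (Num.conj (w i) * zeta j) *: (rho (a i l) ** X ** rho (b l j)).
have hY : h Y = rc B.
  rewrite (dual_le_sum _ _ _ hc) rc_sum; apply: eq_bigr => i _.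
  rewrite rcX -rnormE normCK [RHS]mulrC [X in _ = _ * X]/w mulr_sumr (dual_le_sum _ _ _ hc).
  apply: eq_bigr => j _; rewrite (dual_le_sum _ _ _ hc) mulr_suml mulr_sumr.
  by apply: eq_bigr => l _; rewrite (dual_leZ _ _ hc) /amp_form; ring.
(* Y is the product of the row conj(w_i), the matrix rho(a), the diagonal X, the matrix rho(b) and
   the column zeta_j, with norms at most sqrt B, s, d, t and sqrt A. *)
have YB : bounded_by (d * (s * t) * Num.sqrt A * Num.sqrt B) Y.
  apply: bounded_by_form => [|p q]; first by rewrite !mulr_ge0 ?sqrtr_ge0.
  pose u l := X (\sum_(j < n) rho (b l j) (zeta j *: p)).
  pose v i := \sum_(l < n) rho (a i l) (u l).
  have vB : \sum_(i < n) rnorm (v i) ^+ 2 <= (d * (s * t)) ^+ 2 * A * rnorm p ^+ 2.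
    apply: (le_trans (rho_mxb ha u)).
    have -> : (d * (s * t)) ^+ 2 * A * rnorm p ^+ 2 =
      s ^+ 2 * (d ^+ 2 * (t ^+ 2 * (A * rnorm p ^+ 2))) by ring.
    rewrite ler_wpM2l ?sqr_ge0//.
    have := rho_mxb hb (fun j => zeta j *: p).
    have -> : \sum_(j < n) rnorm (zeta j *: p) ^+ 2 = A * rnorm p ^+ 2.
      by rewrite /A mulr_suml; apply: eq_bigr => j _; rewrite rnormZ exprMn.
    move=> h1; apply: (le_trans _ (ler_wpM2l (sqr_ge0 d) h1)).
    rewrite mulr_sumr; apply: ler_sum => l _; rewrite -exprMn.
    by rewrite ler_pXn2r ?nnegrE ?mulr_ge0 ?rnorm_ge0//; exact: hd.
  have YE : '[Y p, q] = \sum_(i < n) Num.conj (w i) * '[v i, q].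
    rewrite sum_bopE inner_suml; apply: eq_bigr => i _.
    rewrite sum_bopE inner_suml /v inner_suml mulr_sumr.
    under eq_bigr do rewrite sum_bopE inner_suml.
    rewrite exchange_big; apply: eq_bigr => l _.
    rewrite /u bop_sum bop_sum inner_suml mulr_sumr; apply: eq_bigr => j _.
    by rewrite scale_bopE innerZl !bop_compE !bopZ innerZl mulrA.
  have h1 : rnorm ('[Y p, q] : C^o) <= (\sum_(i < n) rnorm (v i) * rnorm (w i : C^o)) * rnorm q.
    rewrite YE (le_trans (rnorm_sum (V := C^o) _ _ _))// mulr_suml.
    apply: ler_sum => i _; rewrite rnormM rnorm_conj [leRHS]mulrAC mulrC.
    by rewrite ler_wpM2r ?rnorm_ge0// cauchy_schwarz.
  apply: (le_trans h1); rewrite ler_wpM2r ?rnorm_ge0//.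
  rewrite -(@ler_pXn2r _ 2)// ?nnegrE ?sumr_ge0// ?mulr_ge0 ?sqrtr_ge0 ?rnorm_ge0//; last first.
    by move=> i _; rewrite mulr_ge0 ?rnorm_ge0.
  apply: (le_trans (real_cauchy_schwarz _ _)).
  have -> : (d * (s * t) * Num.sqrt A * Num.sqrt B * rnorm p) ^+ 2 =
      (d * (s * t)) ^+ 2 * (Num.sqrt A ^+ 2) * rnorm p ^+ 2 * (Num.sqrt B) ^+ 2 by ring.
  by rewrite !sqr_sqrtr// ler_wpM2r.
have [_ hB] := hc.
have := hB Y _ _ YB; rewrite hY rnorm_real ger0_norm//.
move=> /(_ ltac:(by rewrite !mulr_ge0 ?sqrtr_ge0)) h1.
(* Now B <= c d s t sqrt A sqrt B, and a factor sqrt B is cancelled. *)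
have [->|Bn0] := eqVneq B 0; first by rewrite mulr_ge0 ?sqr_ge0.
have sB : 0 < Num.sqrt B by rewrite sqrtr_gt0 lt_def Bn0.
have h2 : Num.sqrt B <= c * d * (s * t) * Num.sqrt A.
  rewrite -(ler_pM2r sB) -expr2 sqr_sqrtr//; apply: (le_trans h1).
  by rewrite le_eqVlt; apply/orP; left; apply/eqP; ring.
rewrite -[B]sqr_sqrtr// -[A]sqr_sqrtr// -exprMn.
by rewrite ler_pXn2r ?nnegrE ?mulr_ge0 ?sqrtr_ge0.
Qed.

Lemma mxnorm_leE (E : normedModType C) n (A : 'I_n -> 'I_n -> E -> E) (c : C) :
  mxnorm_le A c <-> exists2 s : R, c = rc s & 0 <= s /\ forall xi : 'I_n -> E,
    \sum_(i < n) rnorm (\sum_(j < n) A i j (xi j)) ^+ 2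
      <= s ^+ 2 * \sum_(j < n) rnorm (xi j) ^+ 2.
Proof.
have eqv s : (forall xi : 'I_n -> E,
    \sum_(i < n) `|\sum_(j < n) A i j (xi j)| ^+ 2 <= (rc s) ^+ 2 * \sum_(j < n) `|xi j| ^+ 2)
   <-> (forall xi : 'I_n -> E,
    \sum_(i < n) rnorm (\sum_(j < n) A i j (xi j)) ^+ 2
      <= s ^+ 2 * \sum_(j < n) rnorm (xi j) ^+ 2).
  have e xi : (\sum_(i < n) `|\sum_(j < n) A i j (xi j)| ^+ 2 <=
       (rc s) ^+ 2 * \sum_(j < n) `|xi j| ^+ 2) =
     (\sum_(i < n) rnorm (\sum_(j < n) A i j (xi j)) ^+ 2
      <= s ^+ 2 * \sum_(j < n) rnorm (xi j) ^+ 2).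
    rewrite -rc_le rc_sum [rc (s ^+ 2 * _)]rcM rc_sum [rc (s ^+ 2)]rcX.
    congr (_ <= _ * _); by apply: eq_bigr => i _; rewrite rnormE rcX.
  by split => hh xi; [rewrite -e|rewrite e].
split=> [[c0 h]|[s -> [s0 h]]].
  exists (complex.Re c); first by rewrite ge0_ReK.
  split; first by rewrite -rc_le ge0_ReK.
  by apply/eqv => xi; rewrite ge0_ReK.
by split; [rewrite -rc0 rc_le|apply/eqv].
Qed.

Lemma amp_form_cb h X c d : 0 <= c -> dual_le c h -> 0 <= d -> bounded_by d X ->
  cb_norm_le M M (amp_form h X) (rc (c * d)).
Proof.
move=> c0 hc d0 hd; split; first by rewrite -rc0 rc_le mulr_ge0.
move=> n a b _ _ _ _ /mxnorm_leE[s -> [s0 ha]] /mxnorm_leE[t -> [t0 hb]].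
apply/mxnorm_leE; exists (c * d * (s * t)); first by rewrite !rcM.
split; first by rewrite !mulr_ge0.
by move=> zeta; exact: amp_form_mx.
Qed.

(** All conditions hold on the whole of B(H) and restrict to M; normality in each variable is that
    of [rho], composed with multiplications by fixed operators. *)
Lemma amp_form_ncb h X : predual h -> ncb_forms M M (amp_form h X).
Proof.
move=> ph; have hl r := fun x y => predual_linear r x y ph.
have compl x (c : C) (y z : 'B(K)) : (c *: y + z) ** x = c *: (y ** x) + z ** x.
  exact: bop_ext.
have compr x (c : C) (y z : 'B(K)) : x ** (c *: y + z) = c *: (x ** y) + x ** z.
  by apply: bop_ext => w; rewrite /= bop_linear.
split.
- split=> c a a' b _ _ _; rewrite /amp_form rho_linear.
    by rewrite !compl hl.
  by rewrite compr hl.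
- move=> b Mb; apply: continuous_subspaceT; apply: predual_continuous.
  exact: (rho_normal (predual_compr X (predual_compr (rho b) ph))).
- move=> a Ma; apply: continuous_subspaceT; apply: predual_continuous.
  exact: (rho_normal (predual_compl (rho a ** X) ph)).
- have /predualP[c nh] := ph; have [d d0 hd] := bop_bounded X.
  exists (rc (c * d)); apply: amp_form_cb => //; first exact: nuc_ge0 nh.
  exact: nuc_dual_le.
Qed.

Lemma chi_linear (c : C) F G : ncb_forms M M F -> ncb_forms M M G ->
  chi (fun a b => c * F a b + G a b) = c * chi F + chi G.
Proof. by case: hchi => h _; exact: h. Qed.

Lemma chi_bounded : exists2 r : R, 0 <= r & forall h X c d, predual h -> 0 <= c ->
  dual_le c h -> 0 <= d -> bounded_by d X -> rnorm (chi (amp_form h X) : C^o) <= r * (c * d).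
Proof.
case: hchi => _ [r r0 hr]; exists (complex.Re r); first by rewrite -rc_le ge0_ReK.
move=> h X c d ph c0 hc d0 hd.
have := hr _ _ (amp_form_ncb X ph) (amp_form_cb c0 hc d0 hd).
by rewrite rnormE -[r](ge0_ReK r0) -rcM rc_le.
Qed.

(* This Z is (id (x) Phi_chi) X when rho a = 1 (x) a. *)
Lemma amp_Phi_exists X : exists Z : 'B(K), forall h, predual h -> h Z = chi (amp_form h X).
Proof.
have [r r0 hr] := chi_bounded; have [d d0 hd] := bop_bounded X.
pose w (u v : K) : 'B(K) -> C := fun x => '[x u, v].
have wn u v : ncb_forms M M (amp_form (w u v) X).
  by apply: amp_form_ncb; exact: predual_rank1.
have wb u v : rnorm (chi (amp_form (w u v) X) : C^o) <= r * (rnorm u * rnorm v * d).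
  apply: hr => //; [exact: predual_rank1|by rewrite mulr_ge0 ?rnorm_ge0|].
  exact: rank1_dual_le.
(* Vector functionals alone determine Z; the rest of the proof extends the identity to every normal
   h. *)
have [| | | |Z [hZ bZ]] := @form_bop _ K K (fun u v => chi (amp_form (w u v) X)) (r * d).
- move=> c u u' v; rewrite -chi_linear//; congr chi; apply/funext => a; apply/funext => b.
  by rewrite /amp_form /w bop_linear innerDl innerZl.
- move=> c u v v'; rewrite -chi_linear//; congr chi; apply/funext => a; apply/funext => b.
  by rewrite /amp_form /w innerDr innerZr.
- move=> u v; apply: (le_trans (wb u v)).
  by rewrite le_eqVlt; apply/orP; left; apply/eqP; ring.
- by rewrite mulr_ge0.
exists Z => h ph; have [c [xi [eta [h1 h2 hh]]]] := (predualP h).1 ph.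
have pp N : predual (pairing xi eta N).
  apply/predualP; exists c; apply: nuc_finite; [exact: h1|exact: h2].
(* Linearity of [chi] is available only for c F + G with F and G completely bounded forms, so the
   zero form is written as - F + F. *)
have zero : chi (fun _ _ => 0) = 0.
  have -> : (fun _ _ => 0) = fun a b => -1 * amp_form (w 0 0) X a b + amp_form (w 0 0) X a b.
    by apply/funext => a; apply/funext => b; rewrite mulN1r addNr.
  by rewrite chi_linear// mulN1r addNr.
have fin N : chi (amp_form (pairing xi eta N) X) = pairing xi eta N Z.
  elim: N => [|N IH].
    rewrite [RHS]big_ord0 -[RHS]zero; congr chi; apply/funext => a; apply/funext => b.
    by rewrite /amp_form /pairing big_ord0.
  rewrite /pairing big_ord_recr /= -/(pairing xi eta N Z) -IH hZ addrC.
  have := chi_linear 1 (wn (xi N) (eta N)) (amp_form_ncb X (pp N)); rewrite mul1r => <-.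
  congr chi; apply/funext => a; apply/funext => b.
  by rewrite /amp_form /pairing big_ord_recr /= mul1r addrC.
apply/eqP; rewrite -subr_eq0; apply/eqP; apply: (@rnorm_eq0 R C^o).
apply: (@small_eq0 _ (r * d + r * d)) => [||e e0]; first exact: rnorm_ge0.
  by rewrite addr_ge0// mulr_ge0.
have [N hN] := nuc_tail h1 h2 hh e0.
have pN : predual (fun x => h x - pairing xi eta N x) by apply/predualP; exists e.
have e0' := ltW e0.
(* The remainder of h is small on both sides: [chi] is bounded on its form, and Z is bounded by r
   d. *)
have b1 := hr _ X e d pN e0' (nuc_dual_le hN) d0 hd.
have b2 := nuc_bound hN (mulr_ge0 r0 d0) bZ.
have E : chi (amp_form h X) =
    chi (amp_form (fun x => h x - pairing xi eta N x) X) + pairing xi eta N Z.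
  have := chi_linear 1 (amp_form_ncb X pN) (amp_form_ncb X (pp N)).
  rewrite mul1r fin => <-.
  congr chi; apply/funext => a; apply/funext => b.
  by rewrite /amp_form mul1r subrK.
have -> : h Z - chi (amp_form h X) = h Z - pairing xi eta N Z -
    chi (amp_form (fun x => h x - pairing xi eta N x) X) by rewrite E; ring.
have t := rnormD (h Z - pairing xi eta N Z : C^o)
  (- chi (amp_form (fun x => h x - pairing xi eta N x) X)).
rewrite rnormN in t.
lra.
Qed.

End forms.

(** * The operator T3 *)

Section slice_module.
Variables (R : realType) (H K : hilbertType R) (T : hilbert_tensor H K).
Local Notation C := (cplx R).

(** Paired with a vector functional w, both sides are normal in x, so elementary tensors suffice; b
    and b' are absorbed into w. *)
Lemma lslice_mod (f : 'B(H) -> C) (b b' : 'B(K)) (x : 'B(T)) : predual f ->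
  lslice T f (tensor_op T (bop_id H) b ** x ** tensor_op T (bop_id H) b') =
  b ** lslice T f x ** b'.
Proof.
move=> pf; apply: bop_inner_ext => u v.
pose w : 'B(K) -> C := fun y => '[y u, v].
have pw : predual w by exact: predual_rank1.
rewrite -[LHS]/(w _) -[RHS]/(w _) lsliceP//.
have pw' := predual_comp b b' pw.
rewrite -[RHS]/((fun y => w (b ** y ** b')) (lslice T f x)) lsliceP//.
have [p1 e1] := tensor_funP T pf pw; have [p2 e2] := tensor_funP T pf pw'.
apply: (@predual_tensor_ext _ _ _ T
  (fun x => tensor_fun T f w (tensor_op T (bop_id H) b ** x ** tensor_op T (bop_id H) b'))
  (tensor_fun T f (fun y => w (b ** y ** b'))) _ p2 _ x); first exact: predual_comp.
move=> a c; rewrite e2 -e1; congr (tensor_fun T f w _).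
by rewrite !tensor_op_comp bop_comp1 bop_1comp.
Qed.

Lemma rslice_mod (g : 'B(K) -> C) (a a' : 'B(H)) (x : 'B(T)) : predual g ->
  rslice T g (tensor_op T a (bop_id K) ** x ** tensor_op T a' (bop_id K)) =
  a ** rslice T g x ** a'.
Proof.
move=> pg; apply: bop_inner_ext => u v.
pose w : 'B(H) -> C := fun y => '[y u, v].
have pw : predual w by exact: predual_rank1.
rewrite -[LHS]/(w _) -[RHS]/(w _) rsliceP//.
have pw' := predual_comp a a' pw.
rewrite -[RHS]/((fun y => w (a ** y ** a')) (rslice T g x)) rsliceP//.
have [p1 e1] := tensor_funP T pw pg; have [p2 e2] := tensor_funP T pw' pg.
apply: (@predual_tensor_ext _ _ _ T
  (fun x => tensor_fun T w g (tensor_op T a (bop_id K) ** x ** tensor_op T a' (bop_id K)))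
  (tensor_fun T (fun y => w (a ** y ** a')) g) _ p2 _ x); first exact: predual_comp.
move=> b c; rewrite e2 -e1; congr (tensor_fun T w g _).
by rewrite !tensor_op_comp bop_comp1 bop_1comp.
Qed.

End slice_module.

Section triple.
Variables (R : realType) (H : hilbertType R).
Variables (HH : hilbert_tensor H H) (HHH : hilbert_tensor HH H).
Local Notation C := (cplx R).
Implicit Types (A B : 'B(HH)) (Z : 'B(HHH)) (a b : 'B(H)) (f g w : 'B(H) -> C).

Definition op12 A : 'B(HHH) := tensor_op HHH A (bop_id H).

(** The bracketing of [assoc] makes the last two legs a single one, while the operator still acts on
    [HHH]. *)
Definition op23 B : 'B(HHH) := tensor_op (assoc HH HHH) (bop_id H) B.

Definition op2 a : 'B(HHH) := op12 (tensor_op HH (bop_id H) a).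

Lemma op12M A A' : op12 A ** op12 A' = op12 (A ** A').
Proof. by rewrite tensor_op_comp bop_comp1. Qed.

Lemma op23M B B' : op23 B ** op23 B' = op23 (B ** B').
Proof. by have := tensor_op_comp (assoc HH HHH) (bop_id H) (bop_id H) B B';
  rewrite bop_comp1. Qed.

Lemma op12_id : op12 (bop_id HH) = bop_id HHH.
Proof. exact: tensor_op_id. Qed.

Lemma op23_id : op23 (bop_id HH) = bop_id HHH.
Proof. exact: (tensor_op_id (assoc HH HHH)). Qed.

(** The middle leg is visible in both bracketings, so a_2 joins W_12 from the left as 1 (x) a, and
    b_2 joins V_23 from the right as b (x) 1. *)
Lemma op2_op23 a : op2 a = op23 (tensor_op HH a (bop_id H)).
Proof. by rewrite /op23 assoc_tensor_op. Qed.

Lemma op2_linear : linear op2.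
Proof. by move=> c a a'; rewrite /op2 /op12 tensor_op_linear tensor_op_lineal. Qed.

Lemma op2_normal (h : 'B(HHH) -> C) : predual h -> predual (fun a => h (op2 a)).
Proof. by move=> ph; exact: (predual_ampr (predual_amp ph)). Qed.

Lemma mxb_ampr (K L : hilbertType R) (T : hilbert_tensor K L) n
    (A : 'I_n -> 'I_n -> 'B(L)) s : mxb A s ->
  mxb (fun i j => tensor_op T (bop_id K) (A i j)) s.
Proof.
move=> hA; have := @mxb_amp R L K (flip T) n A s hA.
have -> // : (fun i j => tensor_op (flip T) (A i j) (bop_id K)) =
  fun i j => tensor_op T (bop_id K) (A i j).
by apply/funext => i; apply/funext => j; rewrite tensor_op_flip.
Qed.

Lemma op2_mxb n (a : 'I_n -> 'I_n -> 'B(H)) s : mxb a s -> mxb (fun i j => op2 (a i j)) s.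
Proof. by move=> ha; apply: mxb_amp; exact: mxb_ampr. Qed.

Definition fun3 f w g : 'B(HHH) -> C := tensor_fun HHH (tensor_fun HH f w) g.

Lemma fun3_predual f w g : predual f -> predual w -> predual g -> predual (fun3 f w g).
Proof.
move=> pf pw pg; have [p _] := tensor_funP HH pf pw.
by have [] := tensor_funP HHH p pg.
Qed.

Definition slice2 f g Z : 'B(H) := lslice HH f (rslice HHH g Z).

Lemma slice2P f w g Z : predual f -> predual w -> predual g ->
  w (slice2 f g Z) = fun3 f w g Z.
Proof.
move=> pf pw pg; rewrite lsliceP// rsliceP//.
by have [] := tensor_funP HH pf pw.
Qed.

Lemma slice2_mod f g a a' Z : predual f -> predual g ->
  slice2 f g (op2 a ** Z ** op2 a') = a ** slice2 f g Z ** a'.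
Proof. by move=> pf pg; rewrite /slice2 rslice_mod// lslice_mod. Qed.

(* Both sides are normal in A and in B, hence it is enough to compare them on
   elementary tensors. *)
Lemma fun3_op12_op23 f w g A B : predual f -> predual w -> predual g ->
  fun3 f w g (op12 A ** op23 B) = w (lslice HH f A ** rslice HH g B).
Proof.
move=> pf pw pg; have p3 := fun3_predual pf pw pg.
have [p12 e12] := tensor_funP HH pf pw; have [_ e3] := tensor_funP HHH p12 pg.
apply: (@predual_tensor_ext _ _ _ HH
   (fun A => fun3 f w g (op12 A ** op23 B))
   (fun A => w (lslice HH f A ** rslice HH g B)) _ _ _ A).
- exact: (predual_amp (predual_compr (op23 B) p3)).
- have pw' := predual_compr (rslice HH g B) pw.
  have [p' _] := tensor_funP HH pf pw'.
  have -> // : (fun A => w (lslice HH f A ** rslice HH g B)) =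
    tensor_fun HH f (fun y => w (y ** rslice HH g B)).
  by apply/funext => A'; rewrite -lsliceP.
move=> a1 a2.
have -> : lslice HH f (tensor_op HH a1 a2) = f a1 *: a2.
  apply: bop_inner_ext => u v.
  have pk := predual_rank1 u v; have [_ ek] := tensor_funP HH pf pk.
  rewrite (lsliceP (tensor_op HH a1 a2) pf pk) ek.
  by rewrite scale_bopE innerZl.
have pw' := predual_compl (f a1 *: a2) pw.
have [p' e'] := tensor_funP HH pw' pg.
rewrite [RHS](rsliceP B pg pw').
apply: (@predual_tensor_ext _ _ _ HH
   (fun B => fun3 f w g (op12 (tensor_op HH a1 a2) ** op23 B))
   (tensor_fun HH (fun y => w ((f a1 *: a2) ** y)) g) _ p' _ B).
  exact: (@predual_ampr R H HH (assoc HH HHH) _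
    (predual_compl (op12 (tensor_op HH a1 a2)) p3)).
move=> b1 b2; rewrite e' /op23 assoc_tensor_op /op12 !tensor_op_comp bop_comp1 bop_1comp.
rewrite /fun3 e3 e12.
have -> : (f a1 *: a2) ** b1 = f a1 *: (a2 ** b1) by exact: bop_ext.
by rewrite -[f a1 *: _]addr0 predual_linear// predual0// addr0.
Qed.

(** Slicing the outer legs along vector functionals yields all matrix coefficients on elementary
    tensors. *)
Lemma slice2_ext Z Z' :
  (forall f g, predual f -> predual g -> slice2 f g Z = slice2 f g Z') -> Z = Z'.
Proof.
move=> h.
have coef (Y : 'B(HHH)) x y z x' y' z' :
    '[Y (tensor HHH (tensor HH x y) z), tensor HHH (tensor HH x' y') z'] =
    '[slice2 (fun a => '[a x, x']) (fun a => '[a z, z']) Y y, y'].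
  have p1 := predual_rank1 x x'; have p2 := predual_rank1 y y'; have p3 := predual_rank1 z z'.
  rewrite (slice2P Y p1 p2 p3) /fun3.
  by rewrite !tensor_fun_rank1.
apply: bop_tensor_ext => u z; apply: inner_tensor_ext => u' z'.
rewrite -!sliceE; congr '[_, _]; congr (bop_val _ u).
apply: bop_tensor_ext => x y; apply: inner_tensor_ext => x' y'.
by rewrite !sliceE !coef h//; exact: predual_rank1.
Qed.

Lemma vn_commute_right (N : set 'B(H)) n A : vn_tensor HH setT N A -> commutant N n ->
  tensor_op HH (bop_id H) n ** A = A ** tensor_op HH (bop_id H) n.
Proof.
move=> hA hn; apply: (vn_commute hA) => a b _ Nb.
by rewrite !tensor_op_comp hn// bop_comp1 bop_1comp.
Qed.

Lemma vn_commute_left (N : set 'B(H)) n A : vn_tensor HH N setT A -> commutant N n ->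
  tensor_op HH n (bop_id H) ** A = A ** tensor_op HH n (bop_id H).
Proof.
move=> hA hn; apply: (vn_commute hA) => a b Na _.
by rewrite !tensor_op_comp hn// bop_comp1 bop_1comp.
Qed.

Lemma adj_id : adj (bop_id H) = bop_id H.
Proof. by apply/esym/adj_unique. Qed.

Lemma adj_op2 a : adj (op2 a) = op2 (adj a).
Proof. by rewrite /op2 /op12 !tensor_op_adj !adj_id. Qed.

Lemma op2E a x y z : op2 a (tensor HHH (tensor HH x y) z) = tensor HHH (tensor HH x (a y)) z.
Proof. by rewrite /op2 /op12 !tensor_opE. Qed.

(** For the converse, slicing Z along vectors in the third and then the first leg leaves an operator
    b with coefficients of Z. Commutation of Z with n_2 makes b commute with n, so b lies in the
    bicommutant of N; [slice_dense], used on each outer leg, leads back to Z. *)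
Lemma vn_tensor3P (N : set 'B(H)) Z : von_neumann N ->
  vn_tensor HHH (vn_tensor HH setT N) setT Z <->
  forall n, commutant N n -> op2 n ** Z = Z ** op2 n.
Proof.
move=> [_ hN]; split=> [hZ n hn|hZ].
  apply: (vn_commute hZ) => A b hA _.
  by rewrite !tensor_op_comp (vn_commute_right hA hn) bop_comp1 bop_1comp.
apply: slice_dense => z z' A hA; apply: slice_dense_flip => x x' b hb.
rewrite -hN => n hn; apply: bop_inner_ext => y y'.
rewrite !bop_compE [RHS]adjE !hb !hA -[in LHS]op2E.
rewrite -[Z (op2 n _)]/((Z ** op2 n) _) -hZ// bop_compE adjE.
by rewrite adj_op2 op2E.
Qed.

(** By the module property, the slice of n_2 Z - Z n_2 is the commutator of n with the slice of Z,
    and slices separate operators. *)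
Lemma slice2_vn (N : set 'B(H)) Z : von_neumann N ->
  (forall n, commutant N n -> op2 n ** Z = Z ** op2 n) <->
  (forall f g, predual f -> predual g -> N (slice2 f g Z)).
Proof.
have id2 : op2 (bop_id H) = bop_id HHH by rewrite /op2 tensor_op_id op12_id.
have l2 f g n Y : predual f -> predual g -> slice2 f g (op2 n ** Y) = n ** slice2 f g Y.
  move=> pf pg; rewrite -[op2 n ** Y]bop_comp1 -id2 slice2_mod//; exact: bop_comp1.
have r2 f g n Y : predual f -> predual g -> slice2 f g (Y ** op2 n) = slice2 f g Y ** n.
  move=> pf pg; rewrite -[Y]bop_1comp -id2 slice2_mod// id2 bop_1comp; congr (_ ** _).
  by rewrite !bop_1comp.
move=> [_ hN]; split=> [hZ f g pf pg|hZ n hn].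
  by rewrite -hN => n hn; rewrite -r2// -l2// hZ.
by apply: slice2_ext => f g pf pg; rewrite l2// r2// hn//; exact: hZ.
Qed.

End triple.

(** * The map Phi_chi *)

Section Phi.
Variables (R : realType) (H : hilbertType R) (M : set 'B(H)).
Local Notation C := (cplx R).
Variable chi : ('B(H) -> 'B(H) -> C) -> C.
Hypothesis hchi : normal_haagerup M M chi.

Let id_linear : linear (id : 'B(H) -> 'B(H)). Proof. by []. Qed.
Let id_normal (h : 'B(H) -> C) : predual h -> predual (fun a => h (id a)). Proof. by []. Qed.
Let id_mxb n (a : 'I_n -> 'I_n -> 'B(H)) s : mxb a s -> mxb (fun i j => id (a i j)) s.
Proof. by []. Qed.

Lemma PhiE x u v : '[Phi chi x u, v] = chi (fun a b => '[(a ** x ** b) u, v]).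
Proof.
have [Z hZ] := amp_Phi_exists hchi id_linear id_normal id_mxb x.
apply: (@getPex _ [set y : 'B(H) | forall xi eta : H,
    '[y xi, eta] = chi (fun a b => '[(a ** x ** b) xi, eta])]).
by exists Z => xi eta; exact: (hZ _ (predual_rank1 xi eta)).
Qed.

Lemma Phi_linear c x y : Phi chi (c *: x + y) = c *: Phi chi x + Phi chi y.
Proof.
apply: bop_inner_ext => u v; rewrite add_bopE scale_bopE innerDl innerZl !PhiE.
have ncb z := amp_form_ncb M id_linear id_normal id_mxb z (predual_rank1 u v).
have := chi_linear hchi c (ncb x) (ncb y); rewrite /amp_form => <-.
congr chi; apply/funext => a; apply/funext => b.
rewrite -innerZl -innerDl; congr '[_, _].
by rewrite !bop_compE add_bopE scale_bopE bop_linear.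
Qed.

Lemma Phi_bounded : exists2 r : R, 0 <= r &
  forall (x : 'B(H)) d, 0 <= d -> bounded_by d x -> bounded_by (r * d) (Phi chi x).
Proof.
have [r r0 hr] := chi_bounded hchi id_linear id_normal id_mxb.
exists r => // x d d0 hd; apply: bounded_by_form => [|u v]; first exact: mulr_ge0.
have := hr (fun y => '[y u, v]) x (rnorm u * rnorm v) d (predual_rank1 u v)
  (mulr_ge0 (rnorm_ge0 u) (rnorm_ge0 v)) (rank1_dual_le u v) d0 hd.
rewrite PhiE /amp_form => /le_trans; apply.
by rewrite le_eqVlt; apply/orP; left; apply/eqP; ring.
Qed.

(** Membership in N = N'' is tested by commutators: if y in the span satisfies |x - y| <= e, the
    commutator of Phi_chi(x) with n is bounded by 2 r d e. *)
Lemma Phi_norm_closure (N G : set 'B(H)) : von_neumann N ->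
  (forall x, G x -> N (Phi chi x)) ->
  forall x, norm_closure (lspan G) x -> N (Phi chi x).
Proof.
move=> [_ hN] hG x hx; rewrite -hN => n hn.
have comm y : lspan G y -> Phi chi y ** n = n ** Phi chi y.
  move=> [m [c [a [Ga ->]]]].
  have P0 : Phi chi 0 = 0.
    have := Phi_linear (-1) 0 0; rewrite scaler0 addr0 scaleN1r => h.
    by rewrite h addNr.
  have -> : Phi chi (\sum_(i < m) c i *: a i) = \sum_(i < m) c i *: Phi chi (a i).
    have PD y1 y2 : Phi chi (y1 + y2) = Phi chi y1 + Phi chi y2.
      by have := Phi_linear 1 y1 y2; rewrite !scale1r.
    rewrite (big_morph _ PD P0); apply: eq_bigr => i _.
    by have := Phi_linear (c i) (a i) 0; rewrite P0 !addr0.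
  apply: bop_ext => u; rewrite !bop_compE !sum_bopE bop_sum; apply: eq_bigr => i _.
  have := hG _ (Ga i); rewrite -hN => /(_ n hn) h.
  by rewrite !scale_bopE bopZ -[n (Phi chi (a i) u)]/((n ** Phi chi (a i)) u) -h.
have [r r0 hr] := Phi_bounded; have [d d0 hd] := bop_bounded n.
apply: bop_ext => u; apply/eqP; rewrite -subr_eq0; apply/eqP; apply: rnorm_eq0.
apply: (@small_eq0 _ (2 * r * d * rnorm u)) => [||e e0]; first exact: rnorm_ge0.
  by rewrite !mulr_ge0 ?rnorm_ge0.
have [|y Gy hy] := hx (rc e); first by rewrite -rc0 rc_lt.
have by_ : bounded_by e (x - y).
  by move=> v; have := hy v; rewrite !rnormE -rcM rc_le.
have hb := hr _ _ (ltW e0) by_.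
have -> : Phi chi x = Phi chi (x - y) + Phi chi y.
  by have := Phi_linear 1 (x - y) y; rewrite !scale1r subrK.
have -> : ((Phi chi (x - y) + Phi chi y) ** n) u - (n ** (Phi chi (x - y) + Phi chi y)) u =
    Phi chi (x - y) (n u) - n (Phi chi (x - y) u).
  rewrite !bop_compE !add_bopE bopD opprD addrACA.
  by rewrite -[Phi chi y (n u)]/((Phi chi y ** n) u) comm// subrr addr0.
rewrite (le_trans (rnormD _ _))// rnormN.
have h1 := hb (n u); have h2 := hd u; have h3 := hd (Phi chi (x - y) u); have h4 := hb u.
have h5 := ler_wpM2l (mulr_ge0 r0 (ltW e0)) h2.
have h6 := ler_wpM2l d0 h4.
lra.
Qed.

End Phi.

(** * The operator Z and the equivalence *)

Section main.
Variables (R : realType) (H : hilbertType R).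
Variables (HH : hilbert_tensor H H) (HHH : hilbert_tensor HH H).
Local Notation C := (cplx R).
Variables (M : set 'B(H)) (chi : ('B(H) -> 'B(H) -> C) -> C) (W V : 'B(HH)).
Hypothesis hchi : normal_haagerup M M chi.

Let Z_exists := amp_Phi_exists hchi (@op2_linear R H HH HHH) (@op2_normal R H HH HHH)
  (@op2_mxb R H HH HHH) (op12 HHH W ** op23 HHH V).

(* The image of W_12 V_23 under id (x) Phi_chi (x) id. *)
Definition W12_Phi_V23 : 'B(HHH) := get [set Z : 'B(HHH) | forall h, predual h ->
  h Z = chi (amp_form (op2 HHH) h (op12 HHH W ** op23 HHH V))].

Lemma W12_Phi_V23E h : predual h ->
  h W12_Phi_V23 = chi (amp_form (op2 HHH) h (op12 HHH W ** op23 HHH V)).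
Proof. exact: (getPex Z_exists). Qed.

Lemma slice2_W12_Phi_V23 f g : predual f -> predual g ->
  slice2 f g W12_Phi_V23 = Phi chi (lslice HH f W ** rslice HH g V).
Proof.
move=> pf pg; apply: bop_inner_ext => u v; have pw := predual_rank1 u v.
rewrite (slice2P _ pf pw pg) (PhiE hchi) W12_Phi_V23E; last exact: fun3_predual.
congr chi; apply/funext => a; apply/funext => b; rewrite /amp_form.
(* The factors 1 (x) 1 bring both legs into the shape of [lslice_mod] and [rslice_mod], by which a
   and b leave the slices. *)
have -> : op2 HHH a ** (op12 HHH W ** op23 HHH V) ** op2 HHH b =
    op12 HHH (tensor_op HH (bop_id H) a ** W ** tensor_op HH (bop_id H) (bop_id H)) **
    op23 HHH (tensor_op HH (bop_id H) (bop_id H) ** V ** tensor_op HH b (bop_id H)).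
  rewrite [op2 HHH b]op2_op23 tensor_op_id bop_comp1 bop_1comp -op12M -op23M.
  exact: bop_ext.
by rewrite (fun3_op12_op23 _ _ _ pf pw pg) lslice_mod// rslice_mod.
Qed.

(** [T3] and [mult] are chosen by [get], so the right side and its slices act as witnesses that
    solutions exist; separation by slices then identifies the operators. *)
Lemma T3E : T3 HHH (nh_map (Gamma W) (Gamma' V) chi) =
  op12 HHH (adj W) ** W12_Phi_V23 ** op23 HHH (adj V).
Proof.
set z := RHS.
have zE f w g : predual f -> predual w -> predual g -> fun3 f w g z =
    chi (fun a b => w (lslice HH f (Gamma W a) ** rslice HH g (Gamma' V b))).
  move=> pf pw pg; have p3 := fun3_predual HHH pf pw pg.
  (* The fixed outer factors are absorbed into the functional, so that [chi] sees only a_2 W_12 V_23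
     b_2. *)
  have ph := predual_comp (op12 HHH (adj W)) (op23 HHH (adj V)) p3.
  rewrite (W12_Phi_V23E ph); congr chi; apply/funext => a; apply/funext => b.
  rewrite -(fun3_op12_op23 HHH _ _ pf pw pg) /amp_form; congr (fun3 f w g _).
  rewrite [op2 HHH b]op2_op23 /Gamma /Gamma' -!op12M -!op23M.
  exact: bop_ext.
have multE f g : predual f -> predual g ->
    mult (nh_map (lslice HH f) (rslice HH g) (nh_map (Gamma W) (Gamma' V) chi)) = slice2 f g z.
  move=> pf pg; have zz w : predual w -> w (slice2 f g z) =
      nh_map (lslice HH f) (rslice HH g) (nh_map (Gamma W) (Gamma' V) chi)
        (fun a b => w (a ** b)).
    by move=> pw; rewrite (slice2P _ pf pw pg) zE.
  have /getPex hm : exists y : 'B(H), forall w, predual w -> w y =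
      nh_map (lslice HH f) (rslice HH g) (nh_map (Gamma W) (Gamma' V) chi)
        (fun a b => w (a ** b)) by exists (slice2 f g z).
  apply: bop_inner_ext => u v; have pw := predual_rank1 u v.
  by rewrite [LHS](hm _ pw) -(zz _ pw).
have /getPex hT : exists z : 'B(HHH), forall f omega g,
    predual f -> predual omega -> predual g ->
    tensor_fun HHH (tensor_fun HH f omega) g z =
    omega (mult (nh_map (lslice HH f) (rslice HH g) (nh_map (Gamma W) (Gamma' V) chi))).
  by exists z => f w g pf pw pg; rewrite multE// slice2P.
apply: slice2_ext => f g pf pg; apply: bop_inner_ext => u v; have pw := predual_rank1 u v.
by rewrite (slice2P _ pf pw pg) /fun3 [LHS](hT f _ g pf pw pg) multE.
Qed.

End main.

Theorem theorem2p3 (R : realType) (H : hilbertType R)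
    (HH : hilbert_tensor H H) (HHH : hilbert_tensor HH H)
    (M N : set 'B(H)) (hM : von_neumann M) (hN : von_neumann N)
    (chi : ('B(H) -> 'B(H) -> cplx R) -> cplx R) (hchi : normal_haagerup M M chi)
    (W V : 'B(HH)) (hW : vn_tensor HH setT N W) (hV : vn_tensor HH N setT V)
    (uW : unitary W) (uV : unitary V) :
  Phi chi @` reduced_space W V `<=` N
  <->
  vn_tensor HHH (vn_tensor HH setT N) setT
    (T3 HHH (nh_map (Gamma W) (Gamma' V) chi)).
Proof.
rewrite (T3E HHH W V hchi) (vn_tensor3P _ hN); set Z := W12_Phi_V23 HHH chi W V.
pose P := op12 HHH W; pose P' := op12 HHH (adj W).
pose Q := op23 HHH V; pose Q' := op23 HHH (adj V).
have PP' : P ** P' = bop_id HHH by rewrite op12M uW.2 op12_id.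
have P'P : P' ** P = bop_id HHH by rewrite op12M uW.1 op12_id.
have QQ' : Q ** Q' = bop_id HHH by rewrite op23M uV.2 op23_id.
have Q'Q : Q' ** Q = bop_id HHH by rewrite op23M uV.1 op23_id.
have inv_comm (U U' t : 'B(HHH)) : U ** U' = bop_id HHH -> U' ** U = bop_id HHH ->
    t ** U = U ** t -> t ** U' = U' ** t.
  move=> h1 h2 h; rewrite -[t ** U']bop_1comp -h2 -bop_compA [U ** _]bop_compA -h.
  by rewrite -bop_compA h1 bop_comp1.
have tP n : commutant N n -> op2 HHH n ** P = P ** op2 HHH n.
  by move=> hn; rewrite /P /op2 !op12M (vn_commute_right hW hn).
have tQ n : commutant N n -> op2 HHH n ** Q = Q ** op2 HHH n.
  by move=> hn; rewrite op2_op23 !op23M (vn_commute_left hV hn).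
have commE : (forall n, commutant N n -> op2 HHH n ** (P' ** Z ** Q') = P' ** Z ** Q' ** op2 HHH n)
    <-> forall f g, predual f -> predual g -> N (Phi chi (lslice HH f W ** rslice HH g V)).
  have -> : (forall f g, predual f -> predual g ->
        N (Phi chi (lslice HH f W ** rslice HH g V))) =
      (forall f g, predual f -> predual g -> N (slice2 f g Z)).
    apply/propext; split=> h f g pf pg; have := h f g pf pg;
      by rewrite (slice2_W12_Phi_V23 HHH W V hchi).
  rewrite -(slice2_vn _ hN); split=> h n hn; have := h n hn.
    move=> e.
    have -> : Z = P ** (P' ** Z ** Q') ** Q.
      rewrite -[Z in LHS]bop_comp1 -Q'Q -[Z in LHS]bop_1comp -PP'; exact: bop_ext.
    by rewrite 2!bop_compA (tP n hn) -[P ** _ ** _]bop_compA e -!bop_compA (tQ n hn).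
  move=> e; have eP := inv_comm _ _ _ PP' P'P (tP n hn).
  have eQ := inv_comm _ _ _ QQ' Q'Q (tQ n hn).
  by rewrite 2!bop_compA eP -[P' ** _ ** _]bop_compA e -!bop_compA eQ.
rewrite commE; split=> [h f g pf pg|h _ [x hx <-]].
  (* A generator lies in the closed span, being approximated by itself. *)
  apply: h; exists (lslice HH f W ** rslice HH g V) => // e e0.
  exists (lslice HH f W ** rslice HH g V).
    exists 1%N, (fun=> 1), (fun=> lslice HH f W ** rslice HH g V); split.
      by move=> _; exists f => //; exists g.
    by rewrite big_ord1 scale1r.
  by move=> xi; rewrite subrr normr0 mulr_ge0// ltW.
apply: (Phi_norm_closure hchi hN _ hx) => _ [f pf [g pg <-]]; exact: h.
Qed.
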